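(* Let $\mathcal A$ be a compact self-adjoint operator on an infinite-dimensional separable Hilbert space $H$ with simple spectrum and $\operatorname{Ker}\mathcal A=0$. Then there exists a rank one perturbation $\mathcal L=\mathcal A+a\otimes b$ ($a,b\in H$) of $\mathcal A$ with real spectrum such that both $\mathcal E(\mathcal L)$ and $\mathcal E(\mathcal L^* )$ are complete in $H$, but $\mathcal L$ does not admit spectral synthesis. Moreover, for any $N\in\mathbb N\cup\{\infty\}$ the perturbation may be chosen so that for some closed $\mathcal L$-invariant subspace $M$, $$\dim\big(M\ominus\overline{\operatorname{span}}\{\mathcal E(\mathcal L)\cap M\}\big)=N.$$
   Context: $(a\otimes b)x=(x,b)a$. $\mathcal E(\mathcal L)$ denotes the set of eigenvectors of $\mathcal L$. A continuous operator $\mathcal L$ admits spectral synthesis if every closed $\mathcal L$-invariant subspace is the closed linear span of the root vectors of $\mathcal L$ it contains. *)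

(* Defs.v *)
(* complex Hilbert spaces set up by hand over C := R[i],
   R : realType (mathcomp-analysis reals + mathcomp-real-closed complex). *)
From HB Require Import structures.
From mathcomp Require Import all_boot all_order all_algebra.
From mathcomp Require Import reals complex.
Set Implicit Arguments. Unset Strict Implicit. Unset Printing Implicit Defensive.
Import Order.TTheory GRing.Theory Num.Theory.
Local Open Scope ring_scope.
Local Open Scope complex_scope.

Section Hilbert.
Variable R : realType.
Local Notation C := (R[i]).
Variable V : lmodType C.
Variable ip : V -> V -> C.   (* inner product (x, y) *)

(* sesquilinear, Hermitian, positive definite inner product:
   linear in the first argument, conjugate-linear in the second *)
Definition is_inner_product : Prop :=
  [/\ (forall a x y z, ip (a *: x + y) z = a * ip x z + ip y z),
      (forall x y, ip y x = (ip x y)^*) &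
      (forall x, x != 0 -> 0 < ip x x)].

Definition hnorm (x : V) : C := sqrtC (ip x x).

Definition hconv (u : nat -> V) (x : V) : Prop :=
  forall e : C, 0 < e -> exists N, forall n, (N <= n)%N -> hnorm (u n - x) < e.

Definition hcauchy (u : nat -> V) : Prop :=
  forall e : C, 0 < e -> exists N, forall n m, (N <= n)%N -> (N <= m)%N ->
    hnorm (u n - u m) < e.

Definition hcomplete : Prop := forall u, hcauchy u -> exists x, hconv u x.

(* sequential closure (the space is metric) *)
Definition hclosure (S : V -> Prop) : V -> Prop :=
  fun x => exists u : nat -> V, (forall n, S (u n)) /\ hconv u x.

Definition hclosed (S : V -> Prop) : Prop := forall x, hclosure S x -> S x.

Definition separable : Prop :=
  exists d : nat -> V, forall x, hclosure (fun y => exists n, y = d n) x.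

Definition lin_indep n (v : 'I_n -> V) : Prop :=
  forall c : 'I_n -> C, \sum_(i < n) c i *: v i = 0 -> forall i, c i = 0.

Definition infinite_dimensional : Prop :=
  forall n, exists v : 'I_n -> V, lin_indep v.

(* a (complex) Hilbert space: inner product space, complete; here moreover
   separable and infinite dimensional *)
Definition sep_inf_dim_hilbert : Prop :=
  [/\ is_inner_product, hcomplete, separable & infinite_dimensional].

(* linear span (finite linear combinations) and closed linear span *)
Definition hspan (S : V -> Prop) : V -> Prop :=
  fun x => exists n (c : 'I_n -> C) (v : 'I_n -> V),
    (forall i, S (v i)) /\ x = \sum_(i < n) c i *: v i.

Definition cspan (S : V -> Prop) : V -> Prop := hclosure (hspan S).

(* a family is complete iff its closed linear span is the whole space *)
Definition hcomplete_family (S : V -> Prop) : Prop := forall x, cspan S x.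

Definition closed_subspace (M : V -> Prop) : Prop :=
  [/\ M 0, (forall a x y, M x -> M y -> M (a *: x + y)) & hclosed M].

(* bounded (= continuous) linear operators *)
Definition is_linear_op (T : V -> V) : Prop :=
  forall a x y, T (a *: x + y) = a *: T x + T y.

Definition bounded_op (T : V -> V) : Prop :=
  is_linear_op T /\ exists K : C, forall x, hnorm (T x) <= K * hnorm x.

Definition compact_op (T : V -> V) : Prop :=
  bounded_op T /\
  forall u : nat -> V, (exists K : C, forall n, hnorm (u n) <= K) ->
    exists (phi : nat -> nat) (y : V),
      (forall n, (phi n < phi n.+1)%N) /\ hconv (fun n => T (u (phi n))) y.

Definition self_adjoint (T : V -> V) : Prop :=
  forall x y, ip (T x) y = ip x (T y).

Definition is_adjoint (T Ts : V -> V) : Prop :=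
  forall x y, ip (T x) y = ip x (Ts y).

(* simple spectrum (for a compact self-adjoint operator): every eigenvalue
   has multiplicity one, i.e. every eigenspace is one-dimensional *)
Definition simple_spectrum (T : V -> V) : Prop :=
  forall (lam : C) x y, T x = lam *: x -> T y = lam *: y -> x != 0 ->
    exists c : C, y = c *: x.

Definition trivial_kernel (T : V -> V) : Prop := forall x, T x = 0 -> x = 0.

(* rank one operator  (a (x) b) x = (x, b) a *)
Definition rank_one (a b : V) : V -> V := fun x => ip x b *: a.

(* spectrum of a bounded operator: lam such that T - lam is not invertible
   (by the open mapping theorem bijectivity already gives a bounded inverse) *)
Definition spectrum (T : V -> V) (lam : C) : Prop :=
  ~ bijective (fun x => T x - lam *: x).

Definition real_spectrum (T : V -> V) : Prop :=
  forall lam, spectrum T lam -> lam \is Num.real.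

(* E(T): eigenvectors of T *)
Definition eigenvectors (T : V -> V) : V -> Prop :=
  fun x => x != 0 /\ exists lam : C, T x = lam *: x.

(* root vectors: x != 0 with (T - lam)^k x = 0 for some lam, k *)
Definition root_vectors (T : V -> V) : V -> Prop :=
  fun x => x != 0 /\ exists (lam : C) (k : nat),
    iter k (fun y => T y - lam *: y) x = 0.

Definition op_invariant (T : V -> V) (M : V -> Prop) : Prop :=
  forall x, M x -> M (T x).

Definition admits_spectral_synthesis (T : V -> V) : Prop :=
  forall M, closed_subspace M -> op_invariant T M ->
    forall x, M x <-> cspan (fun y => root_vectors T y /\ M y) x.

(* M (-) K : orthogonal complement of K in M *)
Definition ominus (M K : V -> Prop) : V -> Prop :=
  fun x => M x /\ forall y, K y -> ip x y = 0.

(* dimension of a subspace W, with None standing for infinity *)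
Definition dim_eq (W : V -> Prop) (N : option nat) : Prop :=
  match N with
  | Some n => exists v : 'I_n -> V, [/\ forall i, W (v i), lin_indep v &
                forall x, W x -> hspan (fun y => exists i, y = v i) x]
  | None => forall n, exists v : 'I_n -> V, (forall i, W (v i)) /\ lin_indep v
  end.

End Hilbert.

(* Main.v *)
Require Import Defs.
From HB Require Import structures.
From mathcomp Require Import all_boot all_order all_algebra.
From mathcomp Require Import reals complex.
From mathcomp Require Import boolp classical_sets ring lra zify.
Import Order.TTheory GRing.Theory Num.Theory Normc.
Local Open Scope ring_scope.
Local Open Scope complex_scope.
Local Notation "x ^*" := (conjc x) : ring_scope.
Set Implicit Arguments. Unset Strict Implicit. Unset Printing Implicit Defensive.

(** Choose eigenvectors of [A] with extremely fast decreasing eigenvalues, and cut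
    them into blocks (o_k, q_k, p_k). Put [a = aO + aP] and [b = bO + bQ], where
    aO, bO are supported on the nodes o_i (i < N, along the sparse blocks 2^i), aP on
    the p_k, and bQ on the q_k. Then [L = A + a (x) b] keeps the eigenvectors of [A]
    at the p_k, and its other new eigenvalues are the q_k with eigenvectors X_k: the
    function beta(lam) = 1 + ((A - lam)^-1 aO, bO), which takes the place of the
    characteristic function, is made equal to prod_i lam / (lam - o_i) by the choice
    of bO, so it has no zeros. The adjoint has the same shape with eigenvectors Y_k
    at the p_k.

    - A vector z orthogonal to all eigenvectors of [L] gives a function
      sum_i d_i prod_(j != i) (1 - o_j s), d_i = a_i (E_i, z), which is tiny at the
      points s = 1/q_k. Lagrange interpolation at 1/q_k, k = 2^m .. 2^m + m, shows
      that it is tiny at 1/o_i too, whence d_i = 0 and finally z = 0.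

    - Let M be the orthogonal complement of the Y_k and of the eigenvectors of [A]
      untouched by a and b. Its root vectors are the multiples of the X_k. After
      rescaling, X_k and Y_k are so close to e_(p_k) and e_(q_k) that the complement
      of the X_k in M is, by a Neumann series, isomorphic to the closed span of the
      nodes E_i, i < N: it has dimension N. *)

(** * Inner product spaces *)

(** Two demands pull against each other. For M to have a defect, a multiple of X_k must lie within
    2^-(k+3) of e_(p_k); but then all that X_k knows about the nodes E_i and about e_(q_k) sits in
    that tiny difference, and completeness has to read it off. The sparse position of the nodes
    reconciles the two: the blocks 2^m .. 2^m + m see the same nodes o_0, ..., o_m, hence the same
    polynomial of degree at most m, and they supply m + 1 points at which to interpolate it.

    The scales follow. The node size rho_k is below wo_k^2, so that the coefficients of bO, about
    o_i / a_i, obey the bound imposed on those of aO and the adjoint is in the same situation. The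
    sizes of p_k and q_k are below rho_k^4: off its e_(p_k) component X_k is of order rho_k^-2, and
    rescaling multiplies it by (p_k - q_k) / rho_k^2. The weight wo_(k+1) carries the power k + 2 of
    the smallest eigenvalue of block k, because a product of up to k factors 1 - o_i / q_k
    multiplies the tail of (cO, z).

    Since a and b overlap only at the nodes, an eigenvalue of L off the p_k and q_k with (x, b)
    nonzero would be a zero of beta. *)

Section ComplexModulus.
Variable R : realType.
Implicit Types (z w : R[i]) (x : R).

Lemma normc_ge0 z : 0 <= normc z.
Proof. by case: z => a b /=; apply: sqrtr_ge0. Qed.

Lemma normc_gt0 z : (0 < normc z) = (z != 0).
Proof.
rewrite lt_def normc_ge0 andbT; congr (~~ _).
by apply/eqP/eqP => [/eq0_normc|->] //; rewrite normc0.
Qed.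

Lemma normc_real x : normc x%:C = `|x|.
Proof. by rewrite /= expr0n /= addr0 sqrtr_sqr. Qed.

Lemma normc_conj z : normc z^* = normc z.
Proof. by case: z => a b /=; rewrite sqrrN. Qed.

Lemma sqr_normcE z : (normc z ^+ 2)%:C = z * z^*.
Proof. by rewrite -sqr_normc rmorphXn. Qed.

Lemma normc_ReE z : `|complex.Re z| <= normc z.
Proof. by case: z => a b /=; rewrite -sqrtr_sqr ler_wsqrtr // lerDl sqr_ge0. Qed.

Lemma normc_ImE z : `|complex.Im z| <= normc z.
Proof. by case: z => a b /=; rewrite -sqrtr_sqr ler_wsqrtr // lerDr sqr_ge0. Qed.

Lemma realcM x y : (x * y)%:C = x%:C * y%:C. Proof. exact: rmorphM. Qed.
Lemma realcB x y : (x - y)%:C = x%:C - y%:C. Proof. exact: rmorphB. Qed.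
Lemma realc_nat n : n%:R%:C = n%:R :> R[i]. Proof. exact: rmorph_nat. Qed.

Lemma realc_divff x : x != 0 -> x%:C * x^-1%:C = 1.
Proof. by move=> h; rewrite -realcM divff. Qed.

Lemma realc_mulVf x : x != 0 -> x^-1%:C * x%:C = 1.
Proof. by move=> h; rewrite -realcM mulVf. Qed.

Lemma realc_eq0 x : (x%:C == 0) = (x == 0).
Proof. by apply/eqP/eqP => [[]|->]. Qed.

Lemma conj1D z : (1 + z)^* = 1 + z^*.
Proof. by case: z => a b; apply/eqP; rewrite eq_complex /= !add0r !eqxx. Qed.

Lemma conjM z w : (z * w)^* = z^* * w^*.
Proof. exact: rmorphM. Qed.

Lemma normcD z w : normc (z + w) <= normc z + normc w.
Proof. exact: (@le_normcD R z w). Qed.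

Lemma normc_opp z : normc (- z) = normc z.
Proof. exact: (@normcN R z). Qed.

Lemma normc_prod (I : Type) (r : seq I) (P : pred I) (F : I -> R[i]) :
  normc (\prod_(i <- r | P i) F i) = \prod_(i <- r | P i) normc (F i).
Proof. by apply: (big_morph (@normc R)); [exact: normcM|exact: normc1]. Qed.

Lemma normc_sum (I : Type) (r : seq I) (P : pred I) (F : I -> R[i]) :
  normc (\sum_(i <- r | P i) F i) <= \sum_(i <- r | P i) normc (F i).
Proof.
elim/big_rec2: _ => [|i y x _ h]; first by rewrite normc0.
by apply: le_trans (normcD _ _) _; rewrite lerD2l.
Qed.

Lemma normc_subr z w : normc (z - w) = normc (w - z).
Proof. by rewrite -normc_opp opprB. Qed.

Lemma le_normcB z w : normc z - normc w <= normc (z - w).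
Proof. by rewrite lerBlDr; have := normcD (z - w) w; rewrite subrK. Qed.

End ComplexModulus.

Section Geometric.
Variable R : realType.

Lemma geo_gt0 n : 0 < 2^-1 ^+ n :> R.
Proof. by rewrite exprn_gt0 // invr_gt0. Qed.

Lemma geo_small (C e : R) : 0 < e -> exists n0, forall n, (n0 <= n)%N -> C * 2^-1 ^+ n < e.
Proof.
move=> e0; pose n0 := (Num.bound `|C / e|).
exists n0 => n hn.
have h1 : C / e < n0%:R by apply: le_lt_trans (ler_norm _) (archi_boundP (normr_ge0 _)).
have h2 : (n0%:R : R) <= 2 ^+ n.
  by rewrite -natrX ler_nat (leq_trans hn) // ltnW // ltn_expl.
rewrite exprVn ltr_pdivrMr ?exprn_gt0 //.
by rewrite -ltr_pdivrMl // mulrC (lt_le_trans h1).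
Qed.

Lemma geo_sum n : \sum_(i < n) 2^-1 ^+ i = 2 - 2 * 2^-1 ^+ n :> R.
Proof.
elim: n => [|n IH]; first by rewrite big_ord0 expr0; ring.
by rewrite big_ord_recr /= IH exprS; field.
Qed.

Lemma geo_sum_le n : \sum_(i < n) 2^-1 ^+ i <= 2 :> R.
Proof. by rewrite geo_sum gerBl mulr_ge0 // ltW // geo_gt0. Qed.

End Geometric.

Section LinearOp.
Variables (R : realType) (V : lmodType R[i]) (T : V -> V).
Hypothesis hT : is_linear_op T.

Lemma lin0 : T 0 = 0.
Proof. by have := hT (-1) 0 0; rewrite !scaleN1r !addNr. Qed.

Lemma linZ a x : T (a *: x) = a *: T x.
Proof. by have := hT a x 0; rewrite lin0 !addr0. Qed.

Lemma linD x y : T (x + y) = T x + T y.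
Proof. by have := hT 1 x y; rewrite !scale1r. Qed.

Lemma linB x y : T (x - y) = T x - T y.
Proof. by rewrite linD -[- y]scaleN1r linZ scaleN1r. Qed.

Lemma lin_sum (I : Type) (r : seq I) (P : pred I) (F : I -> V) :
  T (\sum_(i <- r | P i) F i) = \sum_(i <- r | P i) T (F i).
Proof. exact: (big_morph T linD lin0). Qed.

End LinearOp.

Section InnerProduct.
Variables (R : realType) (V : lmodType R[i]) (ip : V -> V -> R[i]).
Hypothesis hip : is_inner_product ip.
Implicit Types (x y z : V) (a : R[i]).

Lemma ipDl x y z : ip (x + y) z = ip x z + ip y z.
Proof. by have [h _ _] := hip; have := h 1 x y z; rewrite scale1r mul1r. Qed.

Lemma ip0l z : ip 0 z = 0.
Proof. by have /eqP := ipDl 0 0 z; rewrite addr0 -[X in X == _]addr0 (inj_eq (addrI _)) eq_sym => /eqP. Qed.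

Lemma ipZl a x z : ip (a *: x) z = a * ip x z.
Proof. by have [h _ _] := hip; have := h a x 0 z; rewrite addr0 ip0l addr0. Qed.

Lemma ipNl x z : ip (- x) z = - ip x z.
Proof. by rewrite -scaleN1r ipZl mulN1r. Qed.

Lemma ipBl x y z : ip (x - y) z = ip x z - ip y z.
Proof. by rewrite ipDl ipNl. Qed.

Lemma ipC x y : ip y x = (ip x y)^*.
Proof. by have [_ h _] := hip. Qed.

Lemma ipDr x y z : ip x (y + z) = ip x y + ip x z.
Proof. by rewrite ipC ipDl rmorphD /= -!ipC. Qed.

Lemma ipZr a x z : ip x (a *: z) = a^* * ip x z.
Proof. by rewrite ipC ipZl rmorphM /= -!ipC. Qed.

Lemma ip0r z : ip z 0 = 0. Proof. by rewrite ipC ip0l rmorph0. Qed.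

Lemma ipNr x z : ip x (- z) = - ip x z.
Proof. by rewrite ipC ipNl rmorphN /= -ipC. Qed.

Lemma ipBr x y z : ip x (y - z) = ip x y - ip x z.
Proof. by rewrite ipDr ipNr. Qed.

Lemma ip_suml (I : Type) (r : seq I) (P : pred I) (F : I -> V) z :
  ip (\sum_(i <- r | P i) F i) z = \sum_(i <- r | P i) ip (F i) z.
Proof. by apply: (big_morph (ip^~ z)); [move=> x y; exact: ipDl|exact: ip0l]. Qed.

Lemma ip_sumr (I : Type) (r : seq I) (P : pred I) (F : I -> V) z :
  ip z (\sum_(i <- r | P i) F i) = \sum_(i <- r | P i) ip z (F i).
Proof. by apply: (big_morph (ip z)); [move=> x y; exact: ipDr|exact: ip0r]. Qed.

Lemma ip_eq0C x y : ip x y = 0 -> ip y x = 0.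
Proof. by move=> h; rewrite ipC h rmorph0. Qed.

Definition sqn x : R := complex.Re (ip x x).
Definition nrm x : R := Num.sqrt (sqn x).

Lemma ip_sqn x : ip x x = (sqn x)%:C.
Proof.
have := ipC x x; rewrite /sqn; case: (ip x x) => a b /= [] h.
by rewrite /real_complex_def; congr Complex; lra.
Qed.

Lemma sqn_gt0 x : x != 0 -> 0 < sqn x.
Proof. by have [_ _ h] := hip => /h; rewrite ip_sqn ltcR. Qed.

Lemma sqn_ge0 x : 0 <= sqn x.
Proof.
have [->|/sqn_gt0/ltW //] := eqVneq x 0.
by rewrite /sqn ip0l.
Qed.

Lemma sqn_eq0 x : sqn x = 0 -> x = 0.
Proof. by have [//|/sqn_gt0 h e] := eqVneq x 0; rewrite e ltxx in h. Qed.

Lemma nrm_sq x : nrm x ^+ 2 = sqn x.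
Proof. by rewrite sqr_sqrtr // sqn_ge0. Qed.

Lemma nrm_ge0 x : 0 <= nrm x. Proof. exact: sqrtr_ge0. Qed.

Lemma nrm_gt0 x : x != 0 -> 0 < nrm x.
Proof. by move=> h; rewrite sqrtr_gt0 sqn_gt0. Qed.

Lemma nrm_eq0 x : nrm x = 0 -> x = 0.
Proof. by move=> h; apply: sqn_eq0; rewrite -nrm_sq h expr0n. Qed.

Lemma ip_self0 x : ip x x = 0 -> x = 0.
Proof. by move=> h; apply: sqn_eq0; rewrite /sqn h. Qed.

Lemma nrm_eq1 x : ip x x = 1 -> nrm x = 1.
Proof. by move=> h; rewrite /nrm /sqn h sqrtr1. Qed.

Lemma hnormE x : hnorm ip x = (nrm x)%:C.
Proof.
rewrite /hnorm ip_sqn -nrm_sq rmorphXn /= sqrCK //.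
by rewrite ler0c nrm_ge0.
Qed.

Lemma nrm0 : nrm 0 = 0. Proof. by rewrite /nrm /sqn ip0l sqrtr0. Qed.

Lemma sqnZ a x : sqn (a *: x) = normc a ^+ 2 * sqn x.
Proof.
apply: (@complexI R); rewrite -ip_sqn ipZl ipZr ip_sqn mulrA -sqr_normcE.
by rewrite [in RHS]rmorphM.
Qed.

Lemma nrmZ a x : nrm (a *: x) = normc a * nrm x.
Proof.
by rewrite /nrm sqnZ sqrtrM ?sqr_ge0 // sqrtr_sqr ger0_norm // normc_ge0.
Qed.

Lemma nrmN x : nrm (- x) = nrm x.
Proof. by rewrite -scaleN1r nrmZ normc_opp normc1 mul1r. Qed.

Lemma nrm_subr x y : nrm (x - y) = nrm (y - x).
Proof. by rewrite -nrmN opprB. Qed.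

Lemma sqnD x y : sqn (x + y) = sqn x + sqn y + 2 * complex.Re (ip x y).
Proof.
rewrite /sqn ipDl !ipDr (ipC x y).
by case: (ip x y) (ip x x) (ip y y) => [a b] [c d] [e f] /=; ring.
Qed.

Lemma sqnB x y : sqn (x - y) = sqn x + sqn y - 2 * complex.Re (ip x y).
Proof. by rewrite sqnD ipNr /sqn ipNl ipNr opprK; case: (ip x y) => /= *; ring. Qed.

Lemma parallelogram x y : sqn (x + y) + sqn (x - y) = 2 * sqn x + 2 * sqn y.
Proof. by rewrite sqnD sqnB; ring. Qed.

(* Expand [0 <= |x - t y|^2] at the minimizing coefficient [t = (x,y)/|y|^2]. *)
Lemma sqn_proj x y : y != 0 ->
  sqn (x - (ip x y / (sqn y)%:C) *: y) = sqn x - normc (ip x y) ^+ 2 / sqn y.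
Proof.
move=> y0; have sy := sqn_gt0 y0; have syn : sqn y != 0 by rewrite gt_eqF.
rewrite sqnB sqnZ ipZr normcM normcV normc_real gtr0_norm //.
have -> : complex.Re (conjc (ip x y / (sqn y)%:C) * ip x y) = normc (ip x y) ^+ 2 / sqn y.
  have -> : ((sqn y)%:C)^-1 = (sqn y)^-1%:C by rewrite fmorphV.
  rewrite conjM conjc_real mulrAC [conjc _ * _]mulrC.
  by rewrite -sqr_normcE -rmorphM.
by field.
Qed.

Lemma cauchy_schwarz x y : normc (ip x y) <= nrm x * nrm y.
Proof.
have [->|y0] := eqVneq y 0; first by rewrite ip0r normc0 nrm0 mulr0.
have := sqn_ge0 (x - (ip x y / (sqn y)%:C) *: y); rewrite sqn_proj // subr_ge0.
rewrite ler_pdivrMr ?sqn_gt0 // -!nrm_sq -exprMn => h.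
by rewrite -(ler_pXn2r (n := 2)) // nnegrE ?normc_ge0 // mulr_ge0 ?nrm_ge0.
Qed.

Lemma nrmD x y : nrm (x + y) <= nrm x + nrm y.
Proof.
rewrite -(ler_pXn2r (n := 2)) ?nnegrE ?addr_ge0 ?nrm_ge0 //.
rewrite nrm_sq sqnD sqrrD !nrm_sq -addrA [leRHS]addrAC -addrA lerD2l.
rewrite addrC [leRHS]addrC lerD2r // mulr_natl; apply: ler_wMn2r.
exact: le_trans (ler_norm _) (le_trans (normc_ReE _) (cauchy_schwarz _ _)).
Qed.

Lemma nrmB x y : nrm (x - y) <= nrm x + nrm y.
Proof. by rewrite -(nrmN y) nrmD. Qed.

Lemma nrm_distD x y z : nrm (x - z) <= nrm (x - y) + nrm (y - z).
Proof. by apply: le_trans (nrmD _ _); rewrite addrA subrK. Qed.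

Lemma nrm_sum (I : Type) (r : seq I) (P : pred I) (F : I -> V) :
  nrm (\sum_(i <- r | P i) F i) <= \sum_(i <- r | P i) nrm (F i).
Proof.
elim/big_rec2: _ => [|i y x _ h]; first by rewrite nrm0.
by apply: le_trans (nrmD _ _) _; rewrite lerD2l.
Qed.

Lemma ip_ext x : (forall y, ip x y = 0) -> x = 0.
Proof. by move=> h; apply: sqn_eq0; rewrite /sqn h. Qed.

Lemma hconvP u x : hconv ip u x <->
  forall e : R, 0 < e -> exists N, forall n, (N <= n)%N -> nrm (u n - x) < e.
Proof.
split=> h e e0.
  have [|N hN] := h e%:C; first by rewrite ltcR.
  by exists N => n /hN; rewrite hnormE ltcR.
have er : e = (complex.Re e)%:C by rewrite RRe_real // gtr0_real.
have [|N hN] := h (complex.Re e); first by rewrite -ltcR -er.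
by exists N => n /hN; rewrite hnormE er ltcR.
Qed.

Lemma hcauchyP u : hcauchy ip u <->
  forall e : R, 0 < e -> exists N, forall n m, (N <= n)%N -> (N <= m)%N ->
    nrm (u n - u m) < e.
Proof.
split=> h e e0.
  have [|N hN] := h e%:C; first by rewrite ltcR.
  by exists N => n m hn hm; have := hN n m hn hm; rewrite hnormE ltcR.
have er : e = (complex.Re e)%:C by rewrite RRe_real // gtr0_real.
have [|N hN] := h (complex.Re e); first by rewrite -ltcR -er.
by exists N => n m hn hm; have := hN n m hn hm; rewrite hnormE er ltcR.
Qed.

Lemma le_eps (r : R) : (forall e, 0 < e -> r <= e) -> r <= 0.
Proof.
move=> h; rewrite leNgt; apply/negP => r0.
have h2 : 0 < r / 2 by rewrite divr_gt0.
by have := h _ h2; lra.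
Qed.

Lemma hconv_const x : hconv ip (fun=> x) x.
Proof. by apply/hconvP => e e0; exists 0%N => n _; rewrite subrr nrm0. Qed.

Lemma hconv_unique u x y : hconv ip u x -> hconv ip u y -> x = y.
Proof.
move=> /hconvP hx /hconvP hy; apply/eqP; rewrite -subr_eq0; apply/eqP/nrm_eq0.
apply/eqP; rewrite eq_le nrm_ge0 andbT; apply: le_eps => e e0.
have e2 : 0 < e / 2 by rewrite divr_gt0.
have [n h1] := hx _ e2; have [m h2] := hy _ e2.
have h1' := h1 (maxn n m) (leq_maxl _ _); have h2' := h2 (maxn n m) (leq_maxr _ _).
apply: le_trans (nrm_distD x (u (maxn n m)) y) _; rewrite nrm_subr; lra.
Qed.

Lemma hconvD u v x y : hconv ip u x -> hconv ip v y ->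
  hconv ip (fun n => u n + v n) (x + y).
Proof.
move=> /hconvP hx /hconvP hy; apply/hconvP => e e0.
have e2 : 0 < e / 2 by rewrite divr_gt0.
have [n h1] := hx _ e2; have [m h2] := hy _ e2; exists (maxn n m) => k.
rewrite geq_max => /andP[/h1 h3 /h2 h4].
rewrite opprD addrACA; apply: le_lt_trans (nrmD _ _) _; lra.
Qed.

Lemma hconv_lin (T : V -> V) u x : bounded_op ip T -> hconv ip u x ->
  hconv ip (fun n => T (u n)) (T x).
Proof.
move=> [lT [K hK]] /hconvP hx; apply/hconvP => e e0.
(* [K] is complex and only its real part survives the comparison; the [+ 1] turns it into a positive
   divisor. *)
have hK' y : nrm (T y) <= (`|complex.Re K| + 1) * nrm y.
  have := hK y; rewrite !hnormE lecE => /andP[_].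
  case: K {hK} => k l /= h; rewrite mulr0 subr0 in h.
  by apply: le_trans h _; rewrite ler_wpM2r ?nrm_ge0 // (le_trans (ler_norm _)) // lerDl.
set k := _ + 1 in hK'; have k0 : 0 < k by rewrite ltr_wpDl.
have [|N h] := hx (e / k); first by rewrite divr_gt0.
exists N => n /h h'; have -> : T (u n) - T x = T (u n - x).
  by rewrite addrC -scaleN1r -lT scaleN1r addrC.
by apply: le_lt_trans (hK' _) _; rewrite mulrC -ltr_pdivlMr.
Qed.

Lemma hconvZ a u x : hconv ip u x -> hconv ip (fun n => a *: u n) (a *: x).
Proof.
apply: hconv_lin; split; first by move=> b y z; rewrite scalerDr !scalerA mulrC.
by exists (normc a)%:C => y; rewrite !hnormE nrmZ -rmorphM.
Qed.

Lemma hconv_sub u x (phi : nat -> nat) : (forall n, (n <= phi n)%N) ->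
  hconv ip u x -> hconv ip (fun n => u (phi n)) x.
Proof.
move=> hphi /hconvP hx; apply/hconvP => e /hx[N h]; exists N => n hn.
by apply: h; apply: leq_trans hn (hphi n).
Qed.

Lemma hconv_ext u v x : (exists N, forall n, (N <= n)%N -> u n = v n) ->
  hconv ip u x -> hconv ip v x.
Proof.
move=> [N huv] /hconvP h; apply/hconvP => e /h[M hM]; exists (maxn N M) => n.
by rewrite geq_max => /andP[/huv <- /hM].
Qed.

Lemma hconv_le u x z B :
  (exists N, forall n, (N <= n)%N -> nrm (u n - z) <= B) -> hconv ip u x ->
  nrm (x - z) <= B.
Proof.
move=> [N h] /hconvP hx; rewrite -subr_le0; apply: le_eps => e /hx[M hM].
have h1 := h _ (leq_maxl N M); have h2 := hM _ (leq_maxr N M).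
rewrite lerBlDr; apply: le_trans (nrm_distD _ (u (maxn N M)) _) _.
by rewrite nrm_subr lerD // ltW.
Qed.

Lemma ip_conv u x z : hconv ip u x -> forall e : R, 0 < e ->
  exists N, forall n, (N <= n)%N -> normc (ip (u n) z - ip x z) < e.
Proof.
move=> /hconvP h e e0; have z1 : 0 < nrm z + 1 by rewrite ltr_wpDl ?nrm_ge0.
have [|N hN] := h (e / (nrm z + 1)); first by rewrite divr_gt0.
exists N => n /hN hn; rewrite -ipBl; apply: le_lt_trans (cauchy_schwarz _ _) _.
rewrite ltr_pdivlMr // in hn; apply: le_lt_trans hn.
by rewrite ler_wpM2l ?nrm_ge0 // lerDl.
Qed.

Lemma ip_conv_eq u x z c : hconv ip u x ->
  (exists N, forall n, (N <= n)%N -> ip (u n) z = c) -> ip x z = c.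
Proof.
move=> hx [N h]; apply/eqP; rewrite -subr_eq0; apply/eqP/eq0_normc/eqP.
rewrite eq_le normc_ge0 andbT; apply: le_eps => e /(ip_conv z hx)[M hM].
have := hM _ (leq_maxr N M); rewrite h ?leq_maxl //.
by rewrite normc_subr => /ltW.
Qed.

(** Trades the sequence for an epsilon, so that closedness of closures needs no diagonal
    sequence. *)
Lemma hclosureP (S : V -> Prop) x : hclosure ip S x <->
  forall e : R, 0 < e -> exists2 y, S y & nrm (y - x) < e.
Proof.
split=> [[u [hS /hconvP hu]] e /hu[N h]|h]; first by exists (u N); [|exact: h].
have /choice[u hu] : forall n : nat, exists y, S y /\ nrm (y - x) < 2^-1 ^+ n.
  by move=> n; have [y h1 h2] := h _ (geo_gt0 R n); exists y.
exists u; split=> [n|]; first by case: (hu n).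
apply/hconvP => e e0; have [N hN] := geo_small 1 e0; exists N => n /hN.
by rewrite mul1r; apply: lt_trans; case: (hu n).
Qed.

Lemma hclosure_closed S : hclosed ip (hclosure ip S).
Proof.
move=> x /hclosureP h; apply/hclosureP => e e0.
have e2 : 0 < e / 2 by rewrite divr_gt0.
have [y /hclosureP hy h1] := h _ e2; have [z hz h2] := hy _ e2.
exists z => //; apply: le_lt_trans (nrm_distD _ y _) _; lra.
Qed.

Lemma hspan_sub (S : V -> Prop) x : S x -> hspan S x.
Proof. by move=> h; exists 1%N, (fun=> 1), (fun=> x); rewrite big_ord1 scale1r. Qed.

Lemma hspan_lin (S : V -> Prop) a x y : hspan S x -> hspan S y -> hspan S (a *: x + y).
Proof.
move=> [n [c [v [hv ->]]]] [m [d [w [hw ->]]]].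
exists (n + m)%N, (fun i => match split i with inl j => a * c j | inr j => d j end),
  (fun i => match split i with inl j => v j | inr j => w j end).
split=> [i|]; first by case: (split i).
rewrite big_split_ord /= scaler_sumr; congr (_ + _); apply: eq_bigr => i _.
  by rewrite (unsplitK (inl i : 'I_n + 'I_m)) scalerA.
by rewrite (unsplitK (inr i : 'I_n + 'I_m)).
Qed.

Lemma hspan0 (S : V -> Prop) : hspan S 0.
Proof. by exists 0%N, (fun=> 0), (fun=> 0); rewrite big_ord0; split=> // -[]. Qed.

Lemma hclosure_sub (S : V -> Prop) x : S x -> hclosure ip S x.
Proof. by move=> h; exists (fun=> x); split=> //; exact: hconv_const. Qed.

Lemma cspan_sub S x : S x -> cspan ip S x.
Proof. by move=> h; apply: hclosure_sub; apply: hspan_sub. Qed.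

Lemma cspan_subspace S : closed_subspace ip (cspan ip S).
Proof.
split; last exact: hclosure_closed.
  by apply: hclosure_sub; apply: hspan0.
move=> a x y [u [hu cu]] [v [hv cv]]; exists (fun n => a *: u n + v n).
split=> [n|]; first exact: hspan_lin.
exact: hconvD (hconvZ a cu) cv.
Qed.

Lemma cspan_orth S x : (forall y, S y -> ip x y = 0) -> forall y, cspan ip S y -> ip x y = 0.
Proof.
move=> h y [u [hu cu]]; apply: ip_eq0C; apply: (ip_conv_eq cu); exists 0%N => n _.
have [m [c [v [hv ->]]]] := hu n; rewrite ip_suml big1 // => i _.
by rewrite ipZl ip_eq0C ?mulr0 // h.
Qed.

Lemma closed_subspaceZ M a x : closed_subspace ip M -> M x -> M (a *: x).
Proof. by move=> [h0 h _] hx; rewrite -[_ *: _]addr0; apply: h. Qed.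

Lemma closed_subspaceD M x y : closed_subspace ip M -> M x -> M y -> M (x + y).
Proof. by move=> [h0 h _] hx hy; rewrite -[x]scale1r; apply: h. Qed.

Lemma orth_closed_subspace (S : V -> Prop) :
  closed_subspace ip (fun x => forall y, S y -> ip x y = 0).
Proof.
split=> [y _|a x y hx hy z hz|x [u [hu cu]] y hy]; first by rewrite ip0l.
  by rewrite ipDl ipZl hx // hy // mulr0 addr0.
by apply: (ip_conv_eq cu); exists 0%N => n _; apply: hu.
Qed.

(** * Geometrically convergent sequences and series *)

Section Complete.
Hypothesis hcpl : hcomplete ip.

Lemma cauchy_geom u (C : R) : (forall n, nrm (u n.+1 - u n) <= C * 2^-1 ^+ n) ->
  exists2 x, hconv ip u x & forall m, nrm (x - u m) <= 2 * C * 2^-1 ^+ m.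
Proof.
move=> h.
have C0 : 0 <= C.
  by have := le_trans (nrm_ge0 _) (h 0%N); rewrite expr0 mulr1.
(* The subtracted term makes the induction on [k] close: one step costs exactly what it loses. *)
have hk m k : nrm (u (m + k)%N - u m) <= 2 * C * 2^-1 ^+ m - 2 * C * 2^-1 ^+ (m + k).
  elim: k => [|k IH]; first by rewrite addn0 !subrr nrm0.
  apply: le_trans (nrm_distD _ (u (m + k)%N) _) _; rewrite addnS.
  have := h (m + k)%N; rewrite [_ ^+ (m + k).+1]exprS; move: IH; lra.
have hk' m k : nrm (u (m + k)%N - u m) <= 2 * C * 2^-1 ^+ m.
  by apply: le_trans (hk m k) _; rewrite gerBl !mulr_ge0 // ltW // geo_gt0.
have [|x hx] := hcpl (u := u).
  apply/hcauchyP => e e0.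
  have [N hN] := geo_small (4 * C) e0; exists N => n m hn hm.
  have hNN := hN N (leqnn N).
  apply: le_lt_trans (nrm_distD _ (u N) _) _; rewrite (nrm_subr (u N)).
  have h1 := hk' N (n - N)%N; have h2 := hk' N (m - N)%N.
  rewrite subnKC // in h1; rewrite subnKC // in h2; lra.
exists x => // m; apply: hconv_le hx; exists m => n hn.
by have := hk' m (n - m)%N; rewrite subnKC.
Qed.

Definition hser (u : nat -> V) (s : V) := hconv ip (fun n => \sum_(i < n) u i) s.

Lemma hser_geom u (C : R) : (forall n, nrm (u n) <= C * 2^-1 ^+ n) ->
  exists2 s, hser u s & forall m, nrm (s - \sum_(i < m) u i) <= 2 * C * 2^-1 ^+ m.
Proof. by move=> h; apply: cauchy_geom => n; rewrite big_ord_recr /= addrAC subrr add0r. Qed.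

End Complete.

Lemma hser_bound u s (C : R) : (forall n, nrm (u n) <= C * 2^-1 ^+ n) -> hser u s ->
  nrm s <= 2 * C.
Proof.
move=> h hs; have C0 : 0 <= C.
  by have := le_trans (nrm_ge0 _) (h 0%N); rewrite expr0 mulr1.
rewrite -[s]subr0; apply: hconv_le hs; exists 0%N => n _; rewrite subr0.
apply: le_trans (nrm_sum _ _ _) _.
apply: (@le_trans _ _ (\sum_(i < n) C * 2^-1 ^+ i)); first by apply: ler_sum.
by rewrite -mulr_sumr mulrC ler_wpM2r // geo_sum_le.
Qed.

Lemma hser_ip u s z k c : hser u s -> (forall i, (i != k) -> ip (u i) z = 0) ->
  ip (u k) z = c -> ip s z = c.
Proof.
move=> hs h0 hc; apply: (ip_conv_eq hs); exists k.+1 => n hn.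
rewrite ip_suml (bigD1 (Ordinal hn)) //= hc big1 ?addr0 // => i hi.
by rewrite h0.
Qed.

Lemma hser_ip0 u s z : hser u s -> (forall i, ip (u i) z = 0) -> ip s z = 0.
Proof. by move=> hs h; apply: (hser_ip (k := 0)) hs _ (h 0%N). Qed.

Lemma hserD u v s t : hser u s -> hser v t -> hser (fun i => u i + v i) (s + t).
Proof.
move=> hu hv; have := hconvD hu hv; apply: hconv_ext; exists 0%N => n _.
by rewrite big_split.
Qed.

Lemma hser_lin T u s : bounded_op ip T -> hser u s -> hser (fun i => T (u i)) (T s).
Proof.
move=> hT hu; have := hconv_lin hT hu; apply: hconv_ext; exists 0%N => n _.
by rewrite (lin_sum hT.1).
Qed.

Lemma hserZ a u s : hser u s -> hser (fun i => a *: u i) (a *: s).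
Proof.
move=> hu; have := hconvZ a hu; apply: hconv_ext; exists 0%N => n _.
by rewrite scaler_sumr.
Qed.

Lemma hser_ext u v s : (forall i, u i = v i) -> hser u s -> hser v s.
Proof.
move=> h; apply: hconv_ext; exists 0%N => n _; apply: eq_bigr => i _; exact: h.
Qed.

Lemma hser_unique u s t : hser u s -> hser u t -> s = t.
Proof. exact: hconv_unique. Qed.

Lemma hser_shift u s m : hser u s ->
  hser (fun i => u (m + i)%N) (s - \sum_(i < m) u i).
Proof.
move=> hs.
have h1 : hconv ip (fun n => \sum_(i < (m + n)%N) u i) s.
  by apply: (hconv_sub (u := fun n => \sum_(i < n) u i)) hs => n; rewrite leq_addl.
have := hconvD h1 (hconv_const (- \sum_(i < m) u i)).
apply: hconv_ext; exists 0%N => n _.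
by rewrite big_split_ord /= addrAC subrr add0r.
Qed.

(** The term is zeroed, not removed, so that a geometric bound on the other terms keeps its
    indexing. *)
Lemma hser_drop u s k : hser u s -> hser (fun i => if i == k then 0 else u i) (s - u k).
Proof.
move=> hs; have := hconvD hs (hconv_const (- u k)); apply: hconv_ext.
exists k.+1 => n hn; rewrite (bigD1 (Ordinal hn)) //= addrAC subrr add0r.
rewrite [RHS](bigD1 (Ordinal hn)) //= eqxx add0r; apply: eq_bigr => i hi.
by rewrite (negbTE (hi : val i != k)).
Qed.

End InnerProduct.

(** * Orthogonal projection and eigenvectors of compact self-adjoint operators *)

Section Infimum.
Variable R : realType.

Lemma inf_exists (P : R -> Prop) : (exists x, P x) -> (forall x, P x -> 0 <= x) ->
  exists2 d : R, 0 <= d /\ (forall x, P x -> d <= x) &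
    forall e, 0 < e -> exists2 x, P x & x < d + e.
Proof.
move=> [x0 h0] hge.
have hl : has_lbound P by exists 0 => x /hge.
have hi : has_inf P by split=> //; exists x0.
exists (inf P); last by move=> e e0; apply: inf_adherent.
split=> [|x hx]; first by apply: lb_le_inf => //; exists x0.
exact: ge_inf.
Qed.

Lemma sup_exists (P : R -> Prop) B : (exists x, P x) -> (forall x, P x -> x <= B) ->
  exists2 d : R, (forall x, P x -> x <= d) &
    forall e, 0 < e -> exists2 x, P x & d - e < x.
Proof.
move=> [x0 h0] hB.
have [||d [d0 h1] h2] := @inf_exists (fun y => P (B - y)).
- by exists (B - x0); rewrite subKr.
- by move=> x /hB; rewrite gerBl.
exists (B - d) => [x hx|e /h2[y hy h]].
  by have := h1 (B - x); rewrite subKr => /(_ hx); lra.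
by exists (B - y) => //; lra.
Qed.

End Infimum.

Section Spectral.
Variables (R : realType) (V : lmodType R[i]) (ip : V -> V -> R[i]).
Hypothesis hip : is_inner_product ip.
Hypothesis hcpl : hcomplete ip.
Implicit Types (x y z : V) (a : R[i]).
Local Notation nrm := (nrm ip).
Local Notation sqn := (sqn ip).

Lemma projection M x : closed_subspace ip M ->
  exists2 y, M y & forall z, M z -> ip (x - y) z = 0.
Proof.
move=> hM; have [M0 _ Mcl] := hM.
have [||d [d0 hd] hinf] := @inf_exists R (fun r => exists2 y, M y & r = sqn (x - y)).
- by exists (sqn (x - 0)), 0.
- by move=> _ [y _ ->]; apply: sqn_ge0.
(* The excess over [d] is chosen so that the parallelogram law, which multiplies it by at most 4,
   gives steps of length at most 2^-n. *)
have /choice[u hu] : forall n, exists y, M y /\ sqn (x - y) < d + (4^-1) * (2^-1 ^+ n) ^+ 2.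
  move=> n; have [|_ [y hy ->] h] := hinf (4^-1 * (2^-1 ^+ n) ^+ 2).
    by apply: mulr_gt0; [rewrite invr_gt0|apply: exprn_gt0; apply: geo_gt0].
  by exists y.
(* Parallelogram law applied to [x - u n] and [x - u n.+1], whose midpoint is
   at distance at least [d]. *)
have hC n : nrm (u n.+1 - u n) <= 1 * 2^-1 ^+ n.
  rewrite mul1r -(ler_pXn2r (n := 2)) ?nnegrE ?nrm_ge0 ?exprn_ge0 ?invr_ge0 //.
  rewrite nrm_sq //.
  have := parallelogram hip (x - u n) (x - u n.+1).
  have -> : x - u n - (x - u n.+1) = u n.+1 - u n by rewrite opprB addrC subrKA.
  have -> : x - u n + (x - u n.+1) = (2%:C : R[i]) *: (x - (2^-1)%:C *: (u n + u n.+1)).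
    rewrite scalerBr scalerA realc_divff ?pnatr_eq0 // scale1r.
    by rewrite realc_nat scaler_nat mulr2n opprD addrACA.
  rewrite sqnZ // normc_real ger0_norm //.
  have h : d <= sqn (x - (2^-1)%:C *: (u n + u n.+1)).
    apply: hd; exists ((2^-1)%:C *: (u n + u n.+1)) => //. apply: (closed_subspaceZ _ hM) => //.
    by apply: (closed_subspaceD hM) => //; [case: (hu n)|case: (hu n.+1)].
  have [_ h1] := hu n; have [_ h2] := hu n.+1.
  have h3 : (2^-1 ^+ n.+1) ^+ 2 <= (2^-1 ^+ n) ^+ 2 :> R.
    have h' := geo_gt0 R n.
    rewrite ler_pXn2r ?nnegrE ?exprn_ge0 ?invr_ge0 // exprS; lra.
  move: (_ ^+ 2) (_ ^+ 2) h1 h2 h3 => *; lra.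
have [y hy _] := cauchy_geom hip hcpl hC.
have My : M y by apply: Mcl; exists u; split=> // n; case: (hu n).
exists y => // z hz.
have hdy : sqn (x - y) <= d.
  rewrite -nrm_sq // -subr_le0; apply: le_eps => e e0; rewrite lerBlDr.
  have : nrm (y - x) <= Num.sqrt (d + e).
    have [N hN] := geo_small (4^-1) e0.
    apply: (hconv_le hip _ hy); exists N => n hn.
    rewrite nrm_subr // ler_wsqrtr // ltW //; have [_ h] := hu n.
    apply: lt_le_trans h _; rewrite lerD2l ltW //.
    apply: le_lt_trans (hN n hn); apply: ler_wpM2l; first by rewrite invr_ge0.
    rewrite expr2 ler_piMr ?exprn_ge0 ?invr_ge0 //.
    by rewrite exprn_ile1 ?invr_ge0 // invf_le1 // ler1n.
  have de0 : 0 <= d + e by rewrite addr_ge0 // ltW.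
  rewrite nrm_subr // => h; rewrite (addrC e) -[in leRHS](sqr_sqrtr de0).
  by rewrite ler_pXn2r // nnegrE ?nrm_ge0 ?sqrtr_ge0.
have [->|z0] := eqVneq z 0; first by rewrite ip0r.
(* Moving [y] by [t *: z] inside [M] would lower the squared distance below its infimum [d], unless
   (x - y, z) = 0. *)
have := sqn_proj hip (x - y) z0; set t := ip _ _ / _ => ht.
have : d <= sqn (x - y - t *: z).
  apply: hd; exists (y + t *: z); last by rewrite opprD addrA.
  by apply: (closed_subspaceD hM) => //; apply: (closed_subspaceZ _ hM).
rewrite ht => h; apply: eq0_normc; apply/eqP; rewrite -sqrf_eq0.
have h0 : normc (ip (x - y) z) ^+ 2 / sqn z <= 0 by lra.
by rewrite eq_le sqr_ge0 andbT; rewrite pmulr_lle0 ?invr_gt0 ?sqn_gt0 in h0.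
Qed.

Lemma complete_of_orth (S : V -> Prop) :
  (forall x, (forall y, S y -> ip x y = 0) -> x = 0) -> hcomplete_family ip S.
Proof.
move=> h x; have [y hy hxy] := projection x (cspan_subspace hip S).
have /eqP : x - y = 0 by apply: h => z hz; apply: hxy; apply: cspan_sub.
by rewrite subr_eq0 => /eqP ->.
Qed.

Lemma total_of_orth M : closed_subspace ip M ->
  (forall x, (forall y, M y -> ip x y = 0) -> x = 0) -> forall x, M x.
Proof.
move=> hM h x; have [y hy hxy] := projection x hM.
by have /eqP : x - y = 0 by [apply: h]; rewrite subr_eq0 => /eqP ->.
Qed.

Variable A : V -> V.
Hypotheses (hA : compact_op ip A) (hs : self_adjoint ip A) (hk : trivial_kernel A).

Let hbd : bounded_op ip A. Proof. by case: hA. Qed.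

Lemma opZ a x : A (a *: x) = a *: A x.
Proof. exact: linZ hbd.1 a x. Qed.

Lemma opD x y : A (x + y) = A x + A y.
Proof. exact: linD hbd.1 x y. Qed.

Lemma op0 : A 0 = 0. Proof. by have := opZ 0 0; rewrite !scale0r. Qed.

Lemma opN x : A (- x) = - A x.
Proof. by rewrite -scaleN1r opZ scaleN1r. Qed.

Lemma opB x y : A (x - y) = A x - A y.
Proof. by rewrite opD opN. Qed.

Lemma op_bound : exists2 K : R, 0 < K & forall x, nrm (A x) <= K * nrm x.
Proof.
have [_ [K hK]] := hbd; exists (`|complex.Re K| + 1) => [|y].
  by rewrite ltr_wpDl.
have := hK y; rewrite !hnormE // lecE => /andP[_].
case: K {hK} => k l /= h; rewrite mulr0 subr0 in h.
by apply: le_trans h _; rewrite ler_wpM2r ?nrm_ge0 // (le_trans (ler_norm _)) // lerDl.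
Qed.

(** By compactness the supremum m of |A x| on the unit sphere of [M] is attained; there (A - m)(A +
    m) x = 0, so A x + m x or x itself is an eigenvector. The trivial kernel gives m > 0. The
    relative form is needed for complements of eigenvectors. *)
Lemma eig_in_subspace M x0 : closed_subspace ip M -> (forall x, M x -> M (A x)) ->
  M x0 -> x0 != 0 -> exists mu e, [/\ M e, e != 0 & A e = mu *: e].
Proof.
move=> hM hinv hx0 x00; have [K K0 hK] := op_bound.
have [_ _ Mcl] := hM.
pose P r := exists x, [/\ M x, nrm x = 1 & r = nrm (A x)].
have nn1 x : x != 0 -> nrm ((nrm x)^-1%:C *: x) = 1.
  move=> h; have h0 := nrm_gt0 hip h.
  by rewrite nrmZ // normc_real gtr0_norm ?invr_gt0 // mulVf // gt_eqF.
have [||m hm hadh] := @sup_exists R P K.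
- exists (nrm (A ((nrm x0)^-1%:C *: x0))), ((nrm x0)^-1%:C *: x0).
  by split=> //; [apply: (closed_subspaceZ _ hM)|apply: nn1].
- by move=> _ [x [_ h1 ->]]; have := hK x; rewrite h1 mulr1.
have hmM x : M x -> nrm (A x) <= m * nrm x.
  move=> hx; have [->|h] := eqVneq x 0; first by rewrite op0 nrm0 // mulr0.
  have h0 := nrm_gt0 hip h.
  have : nrm (A ((nrm x)^-1%:C *: x)) <= m.
    by apply: hm; exists ((nrm x)^-1%:C *: x); split; [apply: (closed_subspaceZ _ hM)|exact: nn1|].
  rewrite opZ nrmZ // normc_real gtr0_norm ?invr_gt0 // mulrC.
  by rewrite ler_pdivrMr.
have m0 : 0 < m.
  have Ax0 : A x0 != 0 by apply/eqP => /hk h; rewrite h eqxx in x00.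
  have := lt_le_trans (nrm_gt0 hip Ax0) (hmM _ hx0).
  by rewrite pmulr_lgt0 // nrm_gt0.
have /choice[u hu] : forall n : nat, exists x,
    [/\ M x, nrm x = 1 & m - 2^-1 ^+ n < nrm (A x)].
  by move=> n; have [_ [x [h1 h2 ->]] h] := hadh _ (geo_gt0 R n); exists x.
have [_ hcpt] := hA.
have [|phi [y [hphi hy]]] := hcpt u.
  by exists 1%:C => n; rewrite hnormE //; case: (hu n) => _ ->.
have phi_ge n : (n <= phi n)%N.
  by elim: n => // n IH; apply: leq_ltn_trans IH (hphi n).
(* Since [|A x|] is close to the supremum [m], [x] is nearly an eigenvector of [A^2]. *)
have hA2 n : sqn (A (A (u n)) - (m ^+ 2)%:C *: u n) <= 2 * m ^+ 3 * 2^-1 ^+ n.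
  have [hM1 h1 h2] := hu n.
  rewrite sqnB // sqnZ // -!nrm_sq // h1 normc_real ger0_norm ?sqr_ge0 //.
  rewrite ipZr // conjc_real hs.
  rewrite (ip_sqn hip) -realcM /= -nrm_sq //.
  have h3 : nrm (A (A (u n))) <= m * nrm (A (u n)) by apply: hmM; apply: hinv.
  have h4 : nrm (A (u n)) <= m by rewrite -[m]mulr1 -h1; apply: hmM.
  have := nrm_ge0 ip (A (u n)); have := nrm_ge0 ip (A (A (u n))).
  move: (2^-1 ^+ n) (nrm (A (u n))) (nrm (A (A (u n)))) h2 h3 h4 => d s t h2 h3 h4 t0 s0.
  have ht2 : t ^+ 2 <= m ^+ 2 * s ^+ 2.
    by rewrite -exprMn ler_pXn2r // nnegrE // mulr_ge0 // ltW.
  have : m ^+ 2 * (m ^+ 2 - s ^+ 2) <= m ^+ 2 * (2 * m * d).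
    rewrite ler_wpM2l ?sqr_ge0 //.
    have : (m - s) * (m + s) <= (m - s) * (2 * m) by rewrite ler_wpM2l //; lra.
    have : (m - s) * (2 * m) <= d * (2 * m) by rewrite ler_wpM2r //; lra.
    by move=> *; rewrite subr_sqr; lra.
  by move=> *; nra.
(* Along the subsequence A u tends to [y], so A (A u) tends to A y; since A (A u) is close to m^2 u,
   the vectors u converge too, to this [x]. *)
pose x := (m ^- 2)%:C *: A y.
have m2 : m ^+ 2 != 0 by rewrite expf_neq0 // gt_eqF.
have hx : hconv ip (fun n => u (phi n)) x.
  have h1 := hconv_lin hip hbd hy.
  have h2 : hconv ip (fun n => (m ^+ 2)%:C *: u (phi n) - A (A (u (phi n)))) 0.
    apply/(hconvP hip) => e e0.
    have e20 : 0 < e ^+ 2 by rewrite exprn_gt0.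
    have [N hN] := geo_small (2 * m ^+ 3) e20.
    exists N => n hn; rewrite subr0 nrm_subr //.
    rewrite -(ltr_pXn2r (n := 2)) ?nnegrE ?nrm_ge0 ?(ltW e0) // nrm_sq //.
    by apply: le_lt_trans (hA2 _) (hN _ (leq_trans hn (phi_ge n))).
  have := hconvZ hip (m ^- 2)%:C (hconvD hip h2 h1).
  rewrite add0r; apply: (hconv_ext hip); exists 0%N => n _.
  by rewrite subrK scalerA realc_mulVf // scale1r.
have Mx : M x by apply: Mcl; exists (fun n => u (phi n)); split=> // n; case: (hu (phi n)).
have nx : nrm x = 1.
  apply/eqP; rewrite eq_le; apply/andP; split.
    rewrite -[x]subr0; apply: (hconv_le hip _ hx); exists 0%N => n _.
    by rewrite subr0; case: (hu (phi n)) => _ ->.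
  rewrite -subr_le0; apply: le_eps => e e0.
  have [N hN] := (hconvP hip _ _).1 hx e e0.
  have := hN N (leqnn N); have [_ h1 _] := hu (phi N).
  by have := nrmD hip (u (phi N) - x) x; rewrite subrK h1; lra.
have x_neq0 : x != 0.
  by apply/eqP => h; move: nx; rewrite h nrm0 // => /eqP; rewrite eq_sym oner_eq0.
have hAAx : A (A x) = (m ^+ 2)%:C *: x.
  have -> : A x = y by apply: (hconv_unique hip) hy; apply: hconv_lin.
  by rewrite /x scalerA realc_divff // scale1r.
clearbody x; have [h|h] := eqVneq (A x + m%:C *: x) 0.
  exists (- m%:C), x; split=> //; apply/eqP.
  by rewrite -subr_eq0 scaleNr opprK h.
exists m%:C, (A x + m%:C *: x); split=> //.
  by apply: (closed_subspaceD hM) => //; [exact: hinv|exact: (closed_subspaceZ _ hM)].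
by rewrite opD opZ hAAx scalerDr scalerA -realcM -expr2 addrC.
Qed.

Lemma eig_conj mu e : e != 0 -> A e = mu *: e -> mu^* = mu.
Proof.
move=> e0 he; have := hs e e; rewrite he ipZl // ipZr // => /eqP.
rewrite -subr_eq0 -mulrBl mulf_eq0 => /orP[|].
  by rewrite subr_eq0 => /eqP.
by rewrite ip_sqn // => /eqP[/sqn_eq0-/(_ hip) h]; rewrite h eqxx in e0.
Qed.

Lemma eig_orth mu nu x y : A x = mu *: x -> A y = nu *: y -> mu != nu -> ip x y = 0.
Proof.
move=> hx hy hne; have [->|y0] := eqVneq y 0; first by rewrite ip0r.
have hn := eig_conj y0 hy.
have := hs x y; rewrite hx hy ipZl // ipZr // hn => /eqP.
by rewrite -subr_eq0 -mulrBl mulf_eq0 subr_eq0 (negbTE hne) => /eqP.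
Qed.

(** The complement of all eigenvectors is closed and invariant; a nonzero vector in it would yield
    an eigenvector orthogonal to itself. *)
Lemma eig_complete x : (forall mu e, A e = mu *: e -> ip x e = 0) -> x = 0.
Proof.
move=> hx; have [//|x0] := eqVneq x 0.
have [|||mu [e [he e0 hAe]]] := @eig_in_subspace
  (fun x => forall e, (exists mu, A e = mu *: e) -> ip x e = 0) x _ _ _ x0.
- exact: orth_closed_subspace.
- by move=> y hy e [mu he]; rewrite hs he ipZr // hy ?mulr0 //; exists mu.
- by move=> e [mu]; apply: hx.
have h : ip e e = 0 by apply: he; exists mu.
by move: e0; rewrite (ip_self0 hip h) eqxx.
Qed.

(** The lower bound |(A - lam) x| >= |Im lam| |x| makes the range closed, and a vector orthogonal to
    the range is in the kernel of A - conj lam, which is 0 because eigenvalues are real. *)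
Lemma resolvent_surj lam y : lam \isn't Num.real -> exists x, A x - lam *: x = y.
Proof.
move=> hlam; have im0 : complex.Im lam != 0.
  by apply: contra hlam; case: lam => a b /= /eqP ->; rewrite complex_real.
pose T x := A x - lam *: x.
have TB x z : T (x - z) = T x - T z.
  by rewrite /T opB scalerBr !opprD !opprK addrACA.
have hlow x : `|complex.Im lam| * nrm x <= nrm (T x).
  have [->|x0] := eqVneq x 0; first by rewrite nrm0 // mulr0 nrm_ge0.
  have h0 := nrm_gt0 hip x0.
  rewrite -(ler_pM2r h0) -mulrA -expr2 nrm_sq //; apply: le_trans (cauchy_schwarz hip _ _).
  apply: le_trans (normc_ImE _); rewrite /T ipBl // ipZl //.
  have /eqP hr : complex.Im (ip (A x) x) == 0.
    have := ipC hip (A x) x; rewrite -hs.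
    by case: (ip (A x) x) => a b /= [] h; apply/eqP; lra.
  rewrite ip_sqn //; case: lam {T TB hlam im0} => a b /=.
  case: (ip (A x) x) hr => c d /= ->; rewrite mulr0 !add0r normrN normrM.
  by rewrite (ger0_norm (sqn_ge0 hip x)).
have hM : closed_subspace ip (fun y => exists x, T x = y).
  split; first by exists 0; rewrite /T op0 scaler0 subrr.
    move=> a _ _ [x <-] [z <-]; exists (a *: x + z).
    rewrite /T opD opZ scalerBr !scalerDr !scalerA mulrC opprD.
    by rewrite addrACA.
  move=> z [v [/choice[u hu] hv]].
  have [|x hx] := hcpl (u := u).
    apply/(hcauchyP hip) => e e0.
    have e1 : 0 < `|complex.Im lam| * e / 2 by rewrite divr_gt0 // mulr_gt0 // normr_gt0.
    have [N hN] := (hconvP hip _ _).1 hv _ e1; exists N => n k hn hk'.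
    rewrite -(ltr_pM2l (x := `|complex.Im lam|)) ?normr_gt0 //.
    apply: le_lt_trans (hlow _) _; rewrite TB !hu.
    apply: le_lt_trans (nrm_distD hip _ z _) _; rewrite (nrm_subr hip z).
    have := hN _ hn; have := hN _ hk'; lra.
  exists x; apply: (hconv_unique hip) hv.
  have := hconvD hip (hconv_lin hip hbd hx) (hconvZ hip (- lam) hx).
  rewrite scaleNr; apply: (hconv_ext hip); exists 0%N => n _.
  by rewrite scaleNr -hu.
apply: (total_of_orth hM) => x hx.
have hxx : A x = lam^* *: x.
  apply/eqP; rewrite -subr_eq0; apply/eqP/(ip_ext hip) => z; apply: (ip_eq0C hip).
  rewrite ipBr // ipZr // conjcK -hs -ipZl // -ipBl //.
  by apply: (ip_eq0C hip); apply: hx; exists z.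
have [//|x0] := eqVneq x 0.
have := eig_conj x0 hxx; rewrite conjcK; case: lam im0 {hlam T TB hlow hM hx hxx} => a b /=.
by move=> h [] h'; case/eqP: h; lra.
Qed.

End Spectral.

(** * Selecting eigenvectors with prescribed decay of the eigenvalues *)

Section Selection.
Variables (R : realType) (V : lmodType R[i]) (ip : V -> V -> R[i]).
Hypothesis hip : is_inner_product ip.
Hypothesis hcpl : hcomplete ip.
Hypothesis hdim : infinite_dimensional V.
Variable A : V -> V.
Hypotheses (hA : compact_op ip A) (hs : self_adjoint ip A) (hk : trivial_kernel A).

(** One more independent vector than there are conditions: the matrix of inner products has a
    nonzero left kernel. *)
Lemma orth_seq_neq0 (s : seq V) : exists2 x, x != 0 & forall u, u \in s -> ip x u = 0.
Proof.
have [v hv] := hdim (size s).+1.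
pose C : 'M[R[i]]_((size s).+1, size s) := \matrix_(j, i) ip (v j) s`_i.
have : kermx C != 0.
  rewrite kermx_eq0; apply/negP => /eqP h; have := rank_leq_col C.
  by rewrite h ltnn.
case/rowV0Pn => d /sub_kermxP hd d0.
exists (\sum_j d 0 j *: v j).
  by apply: contra d0 => /eqP /hv h; apply/eqP/rowP => j; rewrite h mxE.
move=> u /(nthP 0)[i hi <-]; rewrite ip_suml //.
have := congr1 (fun M : 'rV_(size s) => M 0 (Ordinal hi)) hd; rewrite !mxE => h0.
by apply: etrans h0; apply: eq_bigr => j _; rewrite ipZl // mxE.
Qed.

Lemma next_eig (s : seq V) : (forall u, u \in s -> exists mu, A u = mu *: u) ->
  exists2 e, nrm ip e = 1 &
    (exists mu : R, A e = mu%:C *: e) /\ forall u, u \in s -> ip e u = 0.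
Proof.
move=> heig; have [x x0 hx] := orth_seq_neq0 s.
have [|||mu [e [he e0 hAe]]] := @eig_in_subspace _ _ _ hip _ hA hs hk
  (fun x => forall u, u \in s -> ip x u = 0) x _ _ _ x0 => //.
- exact: orth_closed_subspace.
- move=> y hy u hu; have [mu hmu] := heig u hu.
  by rewrite hs hmu ipZr // hy ?mulr0.
have hm := eig_conj hip hs e0 hAe.
have n0 := nrm_gt0 hip e0.
exists ((nrm ip e)^-1%:C *: e).
  by rewrite nrmZ // normc_real gtr0_norm ?invr_gt0 // mulVf // gt_eqF.
split=> [|u hu]; last by rewrite ipZl // he // mulr0.
exists (complex.Re mu); rewrite (opZ hA) hAe !scalerA mulrC; congr (_ * _ *: _).
move: hm; case: (mu) => a b /= [] h; congr Complex; lra.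
Qed.

(** For orthonormal eigenvectors |A u_i - A u_j|^2 = r_i^2 + r_j^2, and compactness makes the left
    side small for two of them. *)
Lemma small_eig eps : 0 < eps -> exists re : R * V,
  [/\ nrm ip re.2 = 1, A re.2 = re.1%:C *: re.2, re.1 != 0 & `|re.1| < eps].
Proof.
move=> eps0.
(* The choice function must be total; on lists containing other vectors than eigenvectors its value
   is arbitrary. *)
have /choice[F hF] : forall s : seq V, exists e,
    (forall u, u \in s -> exists mu, A u = mu *: u) -> nrm ip e = 1 /\
    (exists mu : R, A e = mu%:C *: e) /\ forall u, u \in s -> ip e u = 0.
  move=> s; have [h|h] := pselect (forall u, u \in s -> exists mu, A u = mu *: u).
    by have [e h1 h2] := next_eig h; exists e.
  by exists 0.
pose S n := iter n (fun s => F s :: s) [::].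
have hS n : forall u, u \in S n -> exists mu, A u = mu *: u.
  elim: n => // n IH u; rewrite inE => /orP[/eqP ->|/IH //].
  by have [_ [[mu h] _]] := hF _ IH; exists mu%:C.
pose u n := F (S n).
have hmem n m : (n < m)%N -> u n \in S m.
  elim: m => // m IH; rewrite ltnS leq_eqVlt => /orP[/eqP ->|/IH h].
    by rewrite inE eqxx.
  by rewrite inE h orbT.
have horth n m : (n < m)%N -> ip (u m) (u n) = 0.
  by move=> h; have [_ [_ h2]] := hF _ (hS m); apply/h2/hmem.
have hn n : nrm ip (u n) = 1 by have [] := hF _ (hS n).
have /choice[r hr] : forall n, exists mu : R, A (u n) = mu%:C *: u n.
  by move=> n; have [_ []] := hF _ (hS n).
have r0 n : r n != 0.
  apply/eqP => h; have /hk hu : A (u n) = 0 by rewrite hr h scale0r.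
  by have := hn n; rewrite hu nrm0 // => /eqP; rewrite eq_sym oner_eq0.
have [_ hcpt] := hA.
have [|phi [y [hphi hy]]] := hcpt u.
  by exists 1%:C => n; rewrite hnormE // hn.
have e2 : 0 < eps / 2 by rewrite divr_gt0.
have [N hN] := (hconvP hip _ _).1 hy _ e2.
exists (r (phi N), u (phi N)); split=> //=.
have h1 := hN N (leqnn N); have h2 := hN N.+1 (leqnSn N).
have h3 : nrm ip (A (u (phi N)) - A (u (phi N.+1))) < eps.
  by apply: le_lt_trans (nrm_distD hip _ y _) _; rewrite (nrm_subr hip y); lra.
apply: le_lt_trans h3; rewrite -(ler_pXn2r (n := 2)) ?nnegrE ?nrm_ge0 //.
rewrite nrm_sq // !hr sqnB // !sqnZ // -!nrm_sq // !hn !normc_real.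
have -> : ip ((r (phi N))%:C *: u (phi N)) ((r (phi N.+1))%:C *: u (phi N.+1)) = 0.
  by rewrite ipZl // ipZr // (ip_eq0C hip (horth _ _ (hphi N))) !mulr0.
by rewrite !expr1n !mulr1 mulr0 subr0 lerDl sqr_ge0.
Qed.

Lemma sparse_eigs (G : nat -> R -> R) (eps : R) : 0 < eps ->
  (forall n x, 0 < x -> 0 < G n x) ->
  exists (r : nat -> R) (e : nat -> V),
    [/\ forall n, nrm ip (e n) = 1, forall n, A (e n) = (r n)%:C *: e n,
        forall n, 0 < `|r n|, `|r 0%N| < eps & forall n, `|r n.+1| < G n `|r n|].
Proof.
move=> eps0 G0.
have /choice[F hF] : forall d : R, exists re : R * V, 0 < d ->
    [/\ nrm ip re.2 = 1, A re.2 = re.1%:C *: re.2, re.1 != 0 & `|re.1| < d].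
  move=> d; have [d0|_] := ltP 0 d; last by exists (0, 0).
  by have [re hre] := small_eig d0; exists re.
pose f := fix f n := if n is m.+1 then F (G m `|(f m).1|) else F eps.
have hf n : [/\ nrm ip (f n).2 = 1, A (f n).2 = (f n).1%:C *: (f n).2, (f n).1 != 0 &
    `|(f n).1| < if n is m.+1 then G m `|(f m).1| else eps].
  elim: n => [|n [_ _ h _]]; first exact: hF.
  by apply: hF; apply: G0; rewrite normr_gt0.
exists (fun n => (f n).1), (fun n => (f n).2); split=> [n|n|n||n].
- by case: (hf n).
- by case: (hf n).
- by rewrite normr_gt0; case: (hf n).
- by case: (hf 0%N).
- by case: (hf n.+1).
Qed.

End Selection.

(** * The vector with a prescribed characteristic function *)

Section Products.
Variable R : realType.

Lemma prod_near1 (y : nat -> R[i]) n K : (n <= K)%N ->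
  (forall i, (n <= i)%N -> normc (y i) <= 2^-1 ^+ i.+2) ->
  2^-1 <= \prod_(n <= i < K) normc (1 - y i) <= 2.
Proof.
move=> hnK hy.
have step i : (n <= i)%N -> 1 - 2^-1 ^+ i.+2 <= normc (1 - y i) <= 1 + 2^-1 ^+ i.+2.
  move=> /hy h; apply/andP; split.
    by apply: le_trans (le_normcB _ _); rewrite normc1 lerD2l lerN2.
  by apply: le_trans (normcD _ _) _; rewrite normc1 normc_opp lerD2l.
have geo1 i : 2^-1 ^+ i <= 1 :> R by rewrite exprn_ile1 ?invr_ge0 // invf_le1 // ler1n.
(* The plain bounds are not inductive; the strengthened ones keep a margin that shrinks by half at
   each step and pays for the next factor. *)
suff : 2^-1 + 2^-1 ^+ K.+1 <= \prod_(n <= i < K) normc (1 - y i) <= 2 - 2^-1 ^+ K.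
  have := geo_gt0 R K; have := geo_gt0 R K.+1 => h1 h2 /andP[h3 h4].
  by apply/andP; split; lra.
elim: K hnK => [|K IH].
  by rewrite leqn0 => /eqP ->; rewrite big_geq // expr1 expr0; apply/andP; split; lra.
rewrite leq_eqVlt => /orP[/eqP <-|].
  rewrite big_geq // exprS; have := geo1 n; have := geo_gt0 R n => *.
  by apply/andP; split; lra.
rewrite ltnS => hK; rewrite big_nat_recr //=.
have /andP[h1 h2] := IH hK; have /andP[h3 h4] := step K hK.
move: h1 h2 h3 h4 (geo1 K) (geo_gt0 R K) (normc_ge0 (1 - y K)); rewrite !exprS.
move: (2^-1 ^+ K) (\prod_(_ <= _ < _) _) (normc (1 - y K)) => g P c.
move=> h1 h2 h3 h4 h5 h6 h7.
have hP : 0 <= P by lra.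
have := ler_pM (x1 := 2^-1 + 2^-1 * g) (x2 := 1 - 2^-1 * (2^-1 * g)) _ _ h1 h3.
have := ler_pM hP h7 h2 h4.
move=> k1 k2; apply/andP; split; last by nra.
apply: le_trans (k2 _ _); nra.
Qed.

End Products.

(** * The hierarchy of scales inside and between blocks *)

Section Scales.
Variables (R : realType) (rho T sg : nat -> R).

(* [wo] is the size of the coefficients of [a] and [b] at the nodes. *)
Definition wo k : R := if k is k'.+1 then (sg k' / 128) ^+ (k'.+2) else 128^-1.

Hypotheses (rho0 : forall k, 0 < rho k) (sg0 : forall k, 0 < sg k)
  (sgT : forall k, sg k <= T k) (Trho : forall k, T k <= rho k ^+ 4 / 64 ^+ (k + 8))
  (rhow : forall k, rho k <= wo k ^+ 2 / 64 ^+ (k + 7)).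

Lemma wo_gt0 k : 0 < wo k.
Proof. by case: k => [|k] /=; rewrite ?invr_gt0 // exprn_gt0 // divr_gt0. Qed.

Lemma inv64_le1 n : (64 ^+ n)^-1 <= 1 :> R.
Proof. by rewrite -exprVn exprn_ile1 ?invr_ge0 // invf_le1 // ler1n. Qed.

(** Inside block [k] the order needs [wo k] below 1, which itself comes from the order in the
    preceding block; hence the hypothesis here and the induction in [wo_le128]. *)
Lemma chain k : wo k <= 128^-1 -> rho k <= wo k /\ T k <= rho k.
Proof.
move=> h; have w0 := wo_gt0 k; have r0 := rho0 k.
have h1 : rho k <= wo k.
  apply: le_trans (rhow k) _; apply: (@le_trans _ _ (wo k ^+ 2)).
    by apply: ler_piMr; [apply: sqr_ge0|apply: inv64_le1].
  by rewrite expr2 ler_piMr ?ltW //; lra.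
split=> //; apply: le_trans (Trho k) _; apply: (@le_trans _ _ (rho k ^+ 4)).
  by apply: ler_piMr; [rewrite exprn_ge0 ?ltW|apply: inv64_le1].
by rewrite exprS ler_piMr ?(ltW r0) // exprn_ile1 ?ltW //; lra.
Qed.

Lemma wo_le128 k : wo k <= 128^-1.
Proof.
elim: k => [|k IH] //=; have [h1 h2] := chain IH.
have h3 := sgT k; have s0 := sg0 k.
have h4 : sg k / 128 <= 128^-1 by rewrite ler_pdivrMr // mulVf //; lra.
have h5 : 0 <= sg k / 128 by rewrite divr_ge0 // ltW.
rewrite exprS -[leRHS]mulr1; apply: ler_pM; rewrite ?exprn_ge0 //.
by apply: exprn_ile1 => //; lra.
Qed.

Lemma rho_le_wo k : rho k <= wo k. Proof. by case: (chain (wo_le128 k)). Qed.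
Lemma T_le_rho k : T k <= rho k. Proof. by case: (chain (wo_le128 k)). Qed.
Lemma rho_le128 k : rho k <= 128^-1.
Proof. exact: le_trans (rho_le_wo k) (wo_le128 k). Qed.
Lemma sg_le_rho k : sg k <= rho k. Proof. exact: le_trans (sgT k) (T_le_rho k). Qed.
Lemma sg_le1 k : sg k <= 1.
Proof. by have := sg_le_rho k; have := rho_le128 k; lra. Qed.

(** Of the [k + 2] factors of [wo k.+1], one is kept for [sg k]; the others pay for the geometric
    decay. *)
Lemma woS_le k : wo k.+1 <= sg k * 2^-1 ^+ (k + 6).
Proof.
rewrite /= exprS; have s0 := sg0 k; have s1 := sg_le1 k.
apply: (@le_trans _ _ (sg k / 128 * (128^-1) ^+ k.+1)).
  have h5 : 0 <= sg k / 128 by rewrite divr_ge0 // ltW.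
  have h6 : sg k / 128 <= 128^-1 by lra.
  apply: ler_wpM2l => //; apply: lerXn2r; rewrite ?nnegrE ?invr_ge0 //.
rewrite -mulrA; apply: ler_wpM2l; first exact: ltW.
rewrite -exprS.
have -> : 128^-1 = 2^-1 ^+ 7 :> R by rewrite exprVn -natrX.
rewrite -exprM; apply: ler_wiXn2l; rewrite ?invr_ge0 ?invf_le1 ?ler1n //.
by lia.
Qed.

Lemma sgS_le k : sg k.+1 <= sg k.
Proof.
apply: le_trans (sg_le_rho _) _; apply: le_trans (rho_le_wo _) _.
apply: le_trans (woS_le _) _; apply: ler_piMr; first exact: ltW.
by rewrite exprn_ile1 ?invr_ge0 // invf_le1 // ler1n.
Qed.

Lemma sg_mono i k : (i <= k)%N -> sg k <= sg i.
Proof.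
elim: k => [|k IH]; first by rewrite leqn0 => /eqP ->.
rewrite leq_eqVlt => /orP[/eqP -> //|]; rewrite ltnS => /IH.
exact: le_trans (sgS_le k).
Qed.

(** As [wo] is the largest scale of its block and [sg] the smallest, this separates whole blocks,
    with a summable factor to spare. *)
Lemma wo_lt i k : (i < k)%N -> wo k <= sg i * 2^-1 ^+ (k + 5).
Proof.
case: k => // k; rewrite ltnS => h; apply: le_trans (woS_le k) _.
rewrite addSnnS ler_wpM2r ?exprn_ge0 ?invr_ge0 //; exact: sg_mono.
Qed.

Lemma rho_lt i k : (i < k)%N -> rho k <= sg i * 2^-1 ^+ (k + 5).
Proof. by move=> h; apply: le_trans (rho_le_wo k) (wo_lt h). Qed.

Lemma woS_half k : wo k.+1 <= wo k * 2^-1.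
Proof.
apply: le_trans (woS_le k) _; apply: ler_pM; rewrite ?exprn_ge0 ?invr_ge0 //.
- exact: ltW.
- exact: le_trans (sg_le_rho k) (rho_le_wo k).
by rewrite -[leRHS]expr1; apply: ler_wiXn2l; rewrite ?invr_ge0 ?invf_le1 ?ler1n //; lia.
Qed.

Lemma wo_decay i d : wo (i + d) <= wo i * 2^-1 ^+ d.
Proof.
elim: d => [|d IH]; first by rewrite addn0 mulr1.
rewrite addnS exprSr mulrA; apply: le_trans (woS_half _) _.
by rewrite ler_wpM2r ?invr_ge0.
Qed.

Lemma wo_mono i k : (i <= k)%N -> wo k <= wo i.
Proof.
move=> /subnKC <-; apply: le_trans (wo_decay _ _) _; apply: ler_piMr; first by apply/ltW/wo_gt0.
by rewrite exprn_ile1 ?invr_ge0 // invf_le1 // ler1n.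
Qed.

Lemma wo_geo k : wo k <= 2^-1 ^+ k.
Proof.
apply: le_trans (wo_decay 0 k) _; rewrite ler_piMl ?exprn_ge0 ?invr_ge0 //=.
by rewrite invf_le1 // ler1n.
Qed.

End Scales.

(** * Partial fractions of the product of lam / (lam - o_i) *)

Section PartialFractions.
Variables (F : fieldType) (o : nat -> F).

(* [- resid K i] is the residue of [bprod K] at [o i]; it is [0] at a zero node, which
   contributes a factor [1] to [bprod K]. *)
Definition bprod n lam := \prod_(j < n) (lam / (lam - o j)).

Definition resid K i := - o i * bprod i (o i) * \prod_(i.+1 <= j < K) (1 - o j / o i)^-1.

Lemma residS K i : (i < K)%N -> resid K.+1 i = resid K i * (1 - o K / o i)^-1.
Proof. by move=> h; rewrite /resid big_nat_recr //= mulrA. Qed.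

Lemma resid_diag K : resid K.+1 K = - o K * bprod K (o K).
Proof. by rewrite /resid big_geq // mulr1. Qed.

Hypothesis o_inj : forall i j, o i != 0 -> i != j -> o i != o j.

(** The product tends to 1 at infinity, whence the constant. In the induction a new node multiplies
    the residue at [o i] by (1 - o_K / o_i)^-1, and the residue at [o K] itself is read off from the
    induction hypothesis at lam = o_K. *)
Lemma partial_fractions K lam : lam != 0 ->
  (forall i, (i < K)%N -> o i != 0 -> lam != o i) ->
  1 + \sum_(i < K) resid K i / (o i - lam) = bprod K lam.
Proof.
elim: K lam => [|K IH] lam lam0 hlam; first by rewrite /bprod !big_ord0 addr0.
have hl i : (i < K.+1)%N -> o i - lam != 0.
  rewrite subr_eq0 eq_sym => hi; have [->//|h] := eqVneq (o i) 0; exact: hlam.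
rewrite /bprod !big_ord_recr /= -/(bprod K lam) -(IH lam) //; last first.
  by move=> i hi; apply: hlam; apply: ltnW.
have [oK|oK] := eqVneq (o K) 0.
  rewrite resid_diag oK oppr0 !mul0r !addr0 divff // mulr1; congr (1 + _).
  apply: eq_bigr => i _; rewrite residS //; congr (_ / _).
  by rewrite oK mul0r subr0 invr1 mulr1.
have hK := hl K (ltnSn K).
rewrite resid_diag -(IH (o K)) //; last first.
  by move=> i hi oi; rewrite eq_sym o_inj // ltn_eqF.
set S2 := \sum_(i < K) _ / (o i - o K).
set S := \sum_(i < K) resid K i / (o i - lam).
set S1 := \sum_(i < K) _.
have hl' : lam - o K = - (o K - lam) by rewrite opprB.
have hS : S1 = S * (lam / (lam - o K)) + o K * S2 / (o K - lam).
  rewrite mulr_sumr !mulr_suml -big_split /=; apply: eq_bigr => i _.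
  have h1 := hl i (ltnW (ltn_ord i)).
  rewrite residS //; have [oi|oi] := eqVneq (o i) 0.
    by rewrite /resid oi oppr0 !mul0r mulr0 mul0r addr0.
  have h2 : o i - o K != 0 by rewrite subr_eq0 o_inj // ltn_eqF.
  have -> : (1 - o K / o i)^-1 = o i / (o i - o K).
    by rewrite -[X in X - _](divff oi) -mulrBl invf_div.
  by rewrite hl'; field; rewrite oppr_eq0 h1 h2 hK.
by rewrite hS hl'; field; rewrite oppr_eq0 hK.
Qed.

End PartialFractions.

Lemma normc_lim (R : realType) (f : nat -> R[i]) l (a b : R) :
  (forall e : R, 0 < e -> exists N, forall n, (N <= n)%N -> normc (f n - l) < e) ->
  (exists N, forall n, (N <= n)%N -> a <= normc (f n) <= b) -> a <= normc l <= b.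
Proof.
move=> hf [M hM]; apply/andP; split; rewrite -subr_le0; apply: le_eps => e /hf[N hN];
  have := hN _ (leq_maxr M N); have /andP[] := hM _ (leq_maxl M N);
  set z := f _ => h1 h2 h3.
  by have := le_normcB z l; lra.
by have := le_normcB l z; rewrite normc_subr; lra.
Qed.

(** * The vector bO that makes beta a product without zeros *)

Section Beta.
Variables (R : realType) (V : lmodType R[i]) (ip : V -> V -> R[i]).
Hypothesis hip : is_inner_product ip.
Hypothesis hcpl : hcomplete ip.
Variables (E : nat -> V) (o wa : nat -> R[i]).
Hypothesis hE : forall i j, ip (E i) (E j) = (i == j)%:R.
Hypothesis hdec : forall i j, (i < j)%N -> o i != 0 ->
  normc (o j) <= normc (o i) * 2^-1 ^+ j.+2.
Hypothesis hsmall : forall i K, (i <= K)%N -> o i != 0 ->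
  normc (o K) <= normc (wa i) * 2^-1 ^+ (2 * K + 3).
Hypothesis hwa : forall i, o i != 0 -> wa i != 0.

Lemma geo_le1 n : 2^-1 ^+ n <= 1 :> R.
Proof. by rewrite exprn_ile1 ?invr_ge0 // invf_le1 // ler1n. Qed.

Lemma dec_half i j : (i < j)%N -> o i != 0 -> normc (o j) <= normc (o i) / 4.
Proof.
move=> hij oi; apply: le_trans (hdec hij oi) _; rewrite ler_wpM2l ?normc_ge0 //.
rewrite !exprS; have := geo_le1 j; lra.
Qed.

Lemma nodes_inj i j : o i != 0 -> i != j -> o i != o j.
Proof.
move=> oi hij; have [->//|oj] := eqVneq (o j) 0.
have oi0 : 0 < normc (o i) by rewrite normc_gt0.
have oj0 : 0 < normc (o j) by rewrite normc_gt0.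
apply/eqP => h; have [hl|hl|hl] := ltngtP i j; last by rewrite hl eqxx in hij.
  by have := dec_half hl oi; rewrite -h; lra.
by have := dec_half hl oj; rewrite h; lra.
Qed.

Lemma bprod_inv K lam : lam != 0 -> bprod o K lam = \prod_(i < K) (1 - o i / lam)^-1.
Proof.
move=> h; apply: eq_bigr => i _.
by have -> : 1 - o i / lam = (lam - o i) / lam; rewrite ?invf_div // mulrBl divff.
Qed.

(** The product over [i < n] cancels the factors whose poles may lie near or beyond [lam]; the
    remaining nodes are so small against [lam] that their factors multiply to nearly 1. *)
Lemma bprod_bounds n K lam : lam != 0 ->
  (forall i, (i < n)%N -> lam != o i) ->
  (forall i, (n <= i)%N -> normc (o i) <= normc lam * 2^-1 ^+ i.+2) -> (n <= K)%N ->
  2^-1 <= normc (bprod o K lam * \prod_(i < n) (1 - o i / lam)) <= 2.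
Proof.
move=> lam0 hne hn hK; have l0 : 0 < normc lam by rewrite normc_gt0.
have /andP[h1 h2] : 2^-1 <= \prod_(n <= i < K) normc (1 - o i / lam) <= 2.
  apply: prod_near1 => // i hi; rewrite normcM normcV ler_pdivrMr // mulrC; exact: hn.
rewrite bprod_inv // -(big_mkord xpredT (fun i => (1 - o i / lam)^-1)).
rewrite (big_cat_nat (n := n)) //=.
rewrite mulrAC -[X in _ * X * _](big_mkord xpredT (fun i => 1 - o i / lam)).
rewrite -big_split /= big_nat_cond big1 ?mul1r; last first.
  move=> i /andP[/andP[_ hi] _]; rewrite mulVf // subr_eq0 eq_sym.
  apply: contra (hne i hi) => /eqP h; apply/eqP.
  by rewrite -[o i](divfK lam0) h mul1r.
rewrite prodfV normcV normc_prod.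
move: (\prod_(_ <= _ < _) _) h1 h2 => P h1 h2.
have P0 : 0 < P by lra.
by rewrite lef_pV2 ?posrE // h2 /= -[leRHS]invrK lef_pV2 ?posrE ?invr_gt0 // h1.
Qed.

(** Each earlier nonzero node is at least four times as large as [o i], so no factor exceeds 1 in
    modulus. *)
Lemma bprod_diag_le1 i : o i != 0 -> 0 < normc (bprod o i (o i)) <= 1.
Proof.
move=> oi; have oi0 : 0 < normc (o i) by rewrite normc_gt0.
rewrite /bprod normc_prod; apply/andP; split.
  apply: prodr_gt0 => j _; rewrite normc_gt0 mulf_neq0 // invr_eq0 subr_eq0.
  by rewrite nodes_inj // gtn_eqF.
have h j : (j < i)%N -> 0 <= normc (o i / (o i - o j)) <= 1.
  move=> hj; rewrite normc_ge0 /=; have [->|oj] := eqVneq (o j) 0.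
    by rewrite subr0 divff // normc1.
  have hh := dec_half hj oj; have := le_normcB (o j) (o i); rewrite normc_subr => h.
  rewrite normcM normcV ler_pdivrMr; lra.
by apply: prodr_ile1 => j _; apply: h.
Qed.

Lemma resid_bounds i K : (i < K)%N -> o i != 0 ->
  normc (o i * bprod o i (o i)) / 2 <= normc (resid o K i) <= 2 * normc (o i).
Proof.
move=> hi oi; have oi0 : 0 < normc (o i) by rewrite normc_gt0.
have /andP[h1 h2] : 2^-1 <= \prod_(i.+1 <= j < K) normc (1 - o j / o i) <= 2.
  apply: prod_near1 => // j hj; rewrite normcM normcV ler_pdivrMr // mulrC.
  exact: hdec.
have -> : normc (resid o K i) = normc (o i) * normc (bprod o i (o i)) /
    \prod_(i.+1 <= j < K) normc (1 - o j / o i).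
  by rewrite /resid prodfV !normcM normcV normc_opp -(normc_prod (index_iota _ _)).
rewrite normcM; have /andP[h3 h4] := bprod_diag_le1 oi.
move: (\prod_(_ <= _ < _) _) h1 h2 => P h1 h2.
have P0 : 0 < P by lra.
rewrite ler_pdivlMr // ler_pdivrMr //.
have h5 : 0 <= normc (o i) * normc (bprod o i (o i)) by rewrite mulr_ge0 ?normc_ge0.
apply/andP; split; first by rewrite mulrAC ler_pdivrMr // ler_wpM2l.
have : normc (o i) * normc (bprod o i (o i)) <= normc (o i) by rewrite ler_piMr ?normc_ge0.
nra.
Qed.

(** If [c] has coordinates wa_i / (o_i - lam), then (c, bvec K) is the sum of resid_i / (o_i - lam),
    that is [bprod K] minus 1; the conjugate undoes that of the second argument. *)
Definition bvec K := \sum_(i < K) (resid o K i / wa i)^* *: E i.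

(** A new node alters all earlier residues as well, so the [bvec K] are not partial sums of one
    series. The exponent 2 K + 3 in [hsmall] leaves 2^-K after adding K changes and the new term. *)
Lemma bvec_step K : nrm ip (bvec K.+1 - bvec K) <= 1 * 2^-1 ^+ K.
Proof.
rewrite mul1r /bvec big_ord_recr /= addrAC -sumrB.
have nE i : nrm ip (E i) = 1.
  by rewrite /nrm /sqn hE eqxx sqrtr1.
have [oK|oK] := eqVneq (o K) 0.
  rewrite big1 => [|i _]; last first.
    by rewrite residS // oK mul0r subr0 invr1 mulr1 subrr.
  by rewrite resid_diag oK oppr0 !mul0r rmorph0 scale0r addr0 nrm0 ?exprn_ge0 ?invr_ge0.
(* The residue at [o i], at most 2 |o_i|, changes by a factor of order o_K / o_i: the change is of
   order o_K whatever [i] is. *)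
have hterm i : (i < K)%N -> nrm ip ((resid o K.+1 i / wa i)^* *: E i
    - (resid o K i / wa i)^* *: E i) <= 4 * 2^-1 ^+ (2 * K + 3).
  move=> hi; rewrite -scalerBl -rmorphB /= -mulrBl nrmZ // nE mulr1 normc_conj.
  have [oi|oi] := eqVneq (o i) 0.
    rewrite /resid oi oppr0 !mul0r subrr mul0r normc0.
    by rewrite mulr_ge0 ?exprn_ge0 ?invr_ge0.
  have oi0 : 0 < normc (o i) by rewrite normc_gt0.
  have wi0 : 0 < normc (wa i) by rewrite normc_gt0 hwa.
  rewrite residS //; set y := o K / o i.
  have hy : normc y <= 2^-1.
    rewrite normcM normcV ler_pdivrMr //; have := dec_half hi oi; lra.
  have hy1 : 2^-1 <= normc (1 - y) by have := le_normcB 1 y; rewrite normc1; lra.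
  have y1 : 1 - y != 0 by rewrite -normc_gt0; lra.
  have -> : resid o K i * (1 - y)^-1 - resid o K i = resid o K i * y / (1 - y).
    by field.
  have hyo : normc y * normc (o i) = normc (o K) by rewrite -normcM /y divfK.
  have /andP[_ h1] := resid_bounds hi oi; have h2 := hsmall (ltnW hi) oi.
  clearbody y; move: (resid o K i) h1 => rr h1.
  rewrite !normcM !normcV ler_pdivrMr // ler_pdivrMr ?normc_gt0 //.
  apply: (@le_trans _ _ (2 * normc (o K))).
    by rewrite -hyo; have := ler_wpM2r (normc_ge0 y) h1; lra.
  have h3 : 0 <= normc (wa i) * 2^-1 ^+ (2 * K + 3).
    by rewrite mulr_ge0 ?normc_ge0 ?exprn_ge0 ?invr_ge0.
  nra.
have hlast : nrm ip ((resid o K.+1 K / wa K)^* *: E K) <= 2^-1 ^+ (2 * K + 3).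
  have wK0 : 0 < normc (wa K) by rewrite normc_gt0 hwa.
  rewrite nrmZ // nE mulr1 normc_conj resid_diag normcM normcV mulNr normc_opp normcM.
  have /andP[h3 h4] := bprod_diag_le1 oK.
  rewrite ler_pdivrMr //; apply: (@le_trans _ _ (normc (o K))).
    by rewrite ler_piMr ?normc_ge0.
  by rewrite mulrC; apply: hsmall.
apply: le_trans (nrmD hip _ _) _.
apply: (@le_trans _ _ (K%:R * (4 * 2^-1 ^+ (2 * K + 3)) + 2^-1 ^+ (2 * K + 3))).
  apply: lerD => //; apply: le_trans (nrm_sum hip _ _ _) _.
  apply: (@le_trans _ _ (\sum_(i < K) 4 * 2^-1 ^+ (2 * K + 3))).
    by apply: ler_sum => i _; apply: hterm.
  by rewrite sumr_const card_ord [leRHS]mulr_natl.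
have hK : (K%:R : R) + 1 <= 2 ^+ K.
  by rewrite natr1 -natrX ler_nat ltn_expl.
have -> : 2^-1 ^+ (2 * K + 3) = 2^-1 ^+ K * (2^-1 ^+ K * 8^-1) :> R.
  by rewrite mul2n -addnn -addnA exprD; congr (_ * _); rewrite exprD; congr (_ * _); field.
have g1 := geo_gt0 R K.
have h1 : (K%:R + 1) * 2^-1 ^+ K <= 1 :> R.
  by rewrite exprVn ler_pdivrMr ?exprn_gt0 // mul1r.
nra.
Qed.

Lemma ip_bvec K i : (i < K)%N -> ip (bvec K) (E i) = (resid o K i / wa i)^*.
Proof.
move=> hi; rewrite ip_suml // (bigD1 (Ordinal hi)) //= big1 => [|j hj].
  by rewrite addr0 ipZl // hE eqxx mulr1.
by rewrite ipZl // hE (_ : (j == i :> nat) = false) ?mulr0 //; apply/negbTE.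
Qed.

(** The last clause controls beta(lam) = 1 + (c, b). It asks only for the node coordinates of [c],
    because [b] lies in the closed span of the nodes; so it also applies at eigenvalues of A, where
    [c] is not determined by lam. *)
Lemma beta_vector : exists b : V,
  [/\ forall i, normc (ip b (E i)) * normc (wa i) <= 2 * normc (o i),
      forall i, o i != 0 -> ip b (E i) != 0,
      forall z, (forall i, o i != 0 -> ip (E i) z = 0) -> ip b z = 0 &
      forall lam c n, lam != 0 -> (forall i, lam != o i) ->
        (forall i, o i != 0 -> ip c (E i) * (o i - lam) = wa i) ->
        (forall i, (n <= i)%N -> normc (o i) <= normc lam * 2^-1 ^+ i.+2) ->
        2^-1 <= normc ((1 + ip c b) * \prod_(i < n) (1 - o i / lam)) <= 2].
Proof.
have [b hb _] := cauchy_geom hip hcpl bvec_step.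
have hres0 K i : o i = 0 -> resid o K i = 0 by move=> h; rewrite /resid h oppr0 !mul0r.
have hbE i : 2^-1 * normc (o i * bprod o i (o i)) / normc (wa i) <= normc (ip b (E i))
    <= 2 * normc (o i) / normc (wa i).
  apply: normc_lim (ip_conv hip (E i) hb) _; exists i.+1 => n hn.
  rewrite ip_bvec // normc_conj [normc (resid _ _ _ / _)]normcM normcV.
  have [oi|oi] := eqVneq (o i) 0.
    by rewrite hres0 // oi !mul0r normc0 !mulr0 !mul0r lexx.
  have wi0 : 0 < (normc (wa i))^-1 by rewrite invr_gt0 normc_gt0 hwa.
  by rewrite ![_ / normc (wa i)]mulrC !ler_pM2l // [2^-1 * _]mulrC; apply: resid_bounds.
exists b; split.
- move=> i; have [wi|wi] := eqVneq (wa i) 0.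
    by rewrite wi normc0 mulr0 mulr_ge0 ?normc_ge0.
  have /andP[_] := hbE i; rewrite ler_pdivlMr ?normc_gt0 //.
- move=> i oi; have /andP[h _] := hbE i; rewrite -normc_gt0; apply: lt_le_trans h.
  have /andP[h1 _] := bprod_diag_le1 oi.
  by rewrite normcM divr_gt0 ?mulr_gt0 ?invr_gt0 ?normc_gt0 ?hwa // -normc_gt0.
- move=> z hz; apply: (ip_conv_eq hip hb); exists 0%N => n _.
  rewrite ip_suml // big1 // => i _; rewrite ipZl //.
  have [oi|oi] := eqVneq (o i) 0; last by rewrite hz ?mulr0.
  by rewrite hres0 // mul0r rmorph0 mul0r.
move=> lam c n lam0 hlam hc hn; set P := \prod_(i < n) _.
have hbp K : 1 + ip c (bvec K) = bprod o K lam.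
  rewrite -partial_fractions //; last exact: nodes_inj.
  congr (1 + _); rewrite ip_sumr //; apply: eq_bigr => i _.
  rewrite ipZr // conjcK; have [oi|oi] := eqVneq (o i) 0.
    by rewrite hres0 // !mul0r.
  have h1 : o i - lam != 0 by rewrite subr_eq0 eq_sym.
  rewrite -mulrA; congr (_ * _); move: (hwa oi).
  rewrite -(hc i oi) mulf_eq0 negb_or => /andP[h2 _].
  by field; rewrite h1 h2.
apply: (@normc_lim _ (fun K => bprod o K lam * P)); last first.
  by exists n => K hK; apply: bprod_bounds.
move=> e e0.
have p1 : 0 < normc P + 1 by rewrite ltr_wpDl ?normc_ge0.
have [|N hN] := ip_conv hip c hb (e := e / (normc P + 1)); first by rewrite divr_gt0.
exists N => K /hN; rewrite -mulrBl -hbp opprD addrACA subrr add0r normcM.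
rewrite (ipC hip (bvec K)) (ipC hip b) -rmorphB /= normc_conj ltr_pdivlMr // => h.
by apply: le_lt_trans h; rewrite ler_wpM2l ?normc_ge0 // lerDl.
Qed.

End Beta.

(** * Eigenvectors of the perturbation and their completeness *)

Section Interpolation.
Variable F : fieldType.

Lemma size_prod_linear n (l : 'I_n) (f : 'I_n -> {poly F}) :
  (forall j, (size (f j) <= 2)%N) -> (size (\prod_(j | j != l) f j)%R <= n)%N.
Proof.
move=> hf; apply: leq_trans (size_poly_prod_leq _ _) _.
have hc : #|[pred j : 'I_n | j != l]| = n.-1 by rewrite cardC1 card_ord.
have : (\sum_(j | j != l) size (f j) <= n.-1 * 2)%N.
  by rewrite -hc -sum_nat_const; apply: leq_sum => j _; apply: hf.
move: hc; rewrite /= => ->; have := ltn_ord l; lia.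
Qed.

Lemma lagrange_interp n (p : {poly F}) (s : 'I_n -> F) x :
  (size p <= n)%N -> injective s ->
  p.[x] = \sum_l p.[s l] * \prod_(j | j != l) ((x - s j) / (s l - s j)).
Proof.
move=> hp hs.
pose L l := \prod_(j | j != l) ((s l - s j)^-1 *: ('X - (s j)%:P)).
have hL l y : (L l).[y] = \prod_(j | j != l) ((y - s j) / (s l - s j)).
  by rewrite horner_prod; apply: eq_bigr => j _; rewrite hornerZ !hornerE mulrC.
have hsL l : (size (L l) <= n)%N.
  apply: size_prod_linear => j; apply: leq_trans (size_scale_leq _ _) _.
  by rewrite size_XsubC.
suff /eqP : p - \sum_l p.[s l] *: L l = 0.
  rewrite subr_eq0 => /eqP {1}->.
  by rewrite horner_sum; apply: eq_bigr => l _; rewrite hornerZ hL.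
apply: (@roots_geq_poly_eq0 _ _ (codom s)).
- apply/allP => _ /codomP[l ->]; rewrite /root !hornerE horner_sum (bigD1 l) //=.
  rewrite hornerZ hL big1 => [|j hj]; last first.
    by rewrite divff // subr_eq0; apply: contra hj => /eqP/hs ->.
  rewrite mulr1 big1 ?addr0 ?subrr // => k hk; rewrite hornerZ hL.
  by rewrite (bigD1 l) 1?eq_sym //= subrr !mul0r mulr0.
- by rewrite map_inj_uniq ?enum_uniq.
rewrite size_map size_enum_ord; apply: leq_trans (size_polyD _ _) _.
rewrite geq_max hp size_polyN; apply: leq_trans (size_sum _ _ _) _.
by apply/bigmax_leqP => l _; apply: leq_trans (size_scale_leq _ _) (hsL l).
Qed.

End Interpolation.

(** The ratio hypothesis bounds each factor of a Lagrange basis polynomial by 4. It fits reciprocals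
    of rapidly decreasing numbers, which are as well separated as they are large. *)
Lemma interp_bound (R : realType) n (p : {poly R[i]}) (s : 'I_n -> R[i]) x (eta : R) :
  (size p <= n)%N -> injective s ->
  (forall l j, j != l -> normc (x - s j) <= 4 * normc (s l - s j)) ->
  (forall l, normc p.[s l] <= eta) -> normc p.[x] <= n%:R * (eta * 4 ^+ n).
Proof.
move=> hp hs hr he; rewrite (lagrange_interp x hp hs).
apply: le_trans (normc_sum _ _ _) _.
rewrite -[leRHS](_ : \sum_(l < n) (eta * 4 ^+ n) = _); last first.
  by rewrite sumr_const card_ord [RHS]mulr_natl.
apply: ler_sum => l _; rewrite normcM; apply: ler_pM; rewrite ?normc_ge0 //.
rewrite normc_prod; apply: (@le_trans _ _ (\prod_(j < n | j != l) 4)).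
  apply: ler_prod => j hj; rewrite normc_ge0 /= normcM normcV.
  rewrite ler_pdivrMr ?hr // normc_gt0 subr_eq0.
  by apply: contra hj => /eqP/hs ->.
rewrite prodr_const; apply: ler_weXn2l; first by rewrite ler1n.
by rewrite cardC1 card_ord leq_pred.
Qed.

(** Power count for [res_gamma]: 2^(k+5) / 64^(k+8) is at most 2^-(k+3). *)
Lemma gamma_exponent k : (k + 5 + (k + 3) <= 6 * (k + 8))%N.
Proof. lia. Qed.

Lemma pow2_exponent j : (j.+2 <= 2 ^ j + 5)%N.
Proof. by have := @ltn_expl 2 j isT; lia. Qed.

(* Everything in this section is used twice: for [L] and, with the roles of
   [(a, P, p)] and [(b, Q, q)] exchanged, for its adjoint. *)
Section Half.
Variables (R : realType) (V : lmodType R[i]) (ip : V -> V -> R[i]).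
Hypothesis hip : is_inner_product ip.
Hypothesis hcpl : hcomplete ip.
Local Notation nrm := (nrm ip).
Local Notation hser := (hser ip).
Variable A : V -> V.
Hypotheses (hbd : bounded_op ip A) (hs : self_adjoint ip A).

Variables rho T sg : nat -> R.
Hypotheses (rho0 : forall k, 0 < rho k) (sg0 : forall k, 0 < sg k)
  (sgT : forall k, sg k <= T k) (Trho : forall k, T k <= rho k ^+ 4 / 64 ^+ (k + 8))
  (rhow : forall k, rho k <= wo sg k ^+ 2 / 64 ^+ (k + 7)).

Variables (E P Q : nat -> V) (o wa : nat -> R[i]) (p q : nat -> R).
Hypotheses
  (hEE : forall i j, ip (E i) (E j) = (i == j)%:R)
  (hPP : forall i j, ip (P i) (P j) = (i == j)%:R)
  (hQQ : forall i j, ip (Q i) (Q j) = (i == j)%:R)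
  (hEP : forall i j, ip (E i) (P j) = 0)
  (hEQ : forall i j, ip (E i) (Q j) = 0)
  (hPQ : forall i j, ip (P i) (Q j) = 0)
  (hAE : forall i, o i != 0 -> A (E i) = o i *: E i)
  (hAP : forall k, A (P k) = (p k)%:C *: P k)
  (hAQ : forall k, A (Q k) = (q k)%:C *: Q k)
  (ho : forall i, o i != 0 -> normc (o i) = rho (2 ^ i))
  (hp : forall k, sg k <= `|p k| <= T k)
  (hq : forall k, sg k <= `|q k| <= T k)
  (hpq : forall k, p k != q k)
  (hwa : forall i, normc (wa i) <= wo sg (2 ^ i))
  (hwa0 : forall i, o i = 0 -> wa i = 0)
  (hwa1 : forall i, o i != 0 -> wa i != 0).
Variables aO aP bO bQ : V.
Hypotheses
  (haO : hser (fun i => wa i *: E i) aO)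
  (haP : hser (fun k => (rho k ^+ 2)%:C *: P k) aP)
  (hbQ : hser (fun k => (rho k ^+ 2)%:C *: Q k) bQ)
  (hbOP : forall k, ip (P k) bO = 0)
  (hbOQ : forall k, ip (Q k) bO = 0)
  (hbeta : forall k c n, A c - (q k)%:C *: c = aO ->
     (forall i, (n <= i)%N -> (k < 2 ^ i)%N) ->
     2^-1 <= normc ((1 + ip c bO) * \prod_(i < n) (1 - o i / (q k)%:C)) <= 2).

Definition rest_vec x := (exists mu, A x = mu *: x) /\
  [/\ forall k, ip (P k) x = 0, forall k, ip (Q k) x = 0 &
      forall i, o i != 0 -> ip (E i) x = 0].

Hypothesis hcls : forall z, (forall k, ip z (P k) = 0) -> (forall k, ip z (Q k) = 0) ->
  (forall i, o i != 0 -> ip z (E i) = 0) -> (forall x, rest_vec x -> ip z x = 0) -> z = 0.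

Let g := (fun n : nat => (2^-1 : R) ^+ n).

Let TR k : T k <= rho k := T_le_rho rho0 sg0 sgT Trho rhow k.
Let RS i k : (i < k)%N -> rho k <= sg i * g (k + 5) :=
  @rho_lt _ _ _ _ rho0 sg0 sgT Trho rhow i k.
Let WS i k : (i < k)%N -> wo sg k <= sg i * g (k + 5) :=
  @wo_lt _ _ _ _ rho0 sg0 sgT Trho rhow i k.
Let R128 k : rho k <= 128^-1 := rho_le128 rho0 sg0 sgT Trho rhow k.
Let SR k : sg k <= rho k := sg_le_rho rho0 sg0 sgT Trho rhow k.

Let g0 n : 0 < g n := geo_gt0 R n.
Let g1 n : g n <= 1 := geo_le1 R n.

Lemma half_g5 k : g (k + 5) <= 2^-1 ^+ 5.
Proof. by rewrite /g exprD ler_piMl ?exprn_ge0 ?invr_ge0 // g1. Qed.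

Lemma rho_anti i k : (i <= k)%N -> rho k <= rho i.
Proof.
rewrite leq_eqVlt => /orP[/eqP -> //|h]; apply: le_trans (RS h) _.
by apply: le_trans (SR i); rewrite ler_piMr ?g1 // ltW.
Qed.

Lemma T_small k : T k <= rho k / 4.
Proof.
apply: le_trans (Trho k) _; have r0 := rho0 k; have r1 := R128 k.
apply: (@le_trans _ _ (rho k ^+ 4)).
  by apply: ler_piMr; [rewrite exprn_ge0 ?ltW|apply: inv64_le1].
have h : rho k ^+ 2 <= 1 by apply: exprn_ile1; [apply: ltW|lra].
rewrite exprS; apply: ler_wpM2l; first exact: ltW.
by rewrite exprS; have := ler_wpM2l (ltW r0) h; lra.
Qed.

Lemma node_far i k : o i != 0 -> (2 ^ i <= k)%N ->
  [/\ rho k <= normc (o i), `|q k| <= normc (o i) / 4 &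
      normc (o i) / 2 <= normc (o i - (q k)%:C)].
Proof.
move=> oi hi; have h1 := rho_anti hi; have /andP[_ h2] := hq k.
have h3 := T_small k; have h4 := le_normcB (o i) (q k)%:C.
rewrite normc_real in h4; rewrite ho // in h4 *.
by have := rho0 (2 ^ i); move: (normc (o i - _)) h4 => z h4 h0; split=> //; lra.
Qed.

Lemma node_near i k : (k < 2 ^ i)%N ->
  normc (o i) <= sg k * g (2 ^ i + 5) /\ sg k / 2 <= normc (o i - (q k)%:C).
Proof.
move=> hi; have /andP[h1 _] := hq k.
have h2 : normc (o i) <= sg k * g (2 ^ i + 5).
  have [->|oi] := eqVneq (o i) 0; first by rewrite normc0 mulr_ge0 // ltW.
  by rewrite ho // RS.
split=> //; rewrite normc_subr; have := le_normcB (q k)%:C (o i).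
rewrite normc_real; have s0 := sg0 k.
have : sg k * g (2 ^ i + 5) <= sg k * 2^-1 ^+ 5 by rewrite ler_wpM2l ?half_g5 // ltW.
rewrite !exprS expr0; lra.
Qed.

Lemma pair_far (x y : R) i k : (i < k)%N -> sg i <= `|x| -> `|y| <= T k ->
  sg i / 2 <= `|x - y| /\ `|y| / 2 <= `|x - y|.
Proof.
move=> h hx hy; have h1 := RS h; have h2 := TR k; have s0 := sg0 i.
have h3 : sg i * g (k + 5) <= sg i * 2^-1 ^+ 5 by rewrite ler_wpM2l ?half_g5 // ltW.
have h4 := lerB_dist x y; rewrite !exprS expr0 in h3; split; lra.
Qed.

Lemma pair_far_l (x y : R) i k : (i < k)%N -> sg i <= `|x| -> `|y| <= T k ->
  `|x| / 2 <= `|x - y|.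
Proof.
move=> h hx hy; have h1 := RS h; have h2 := TR k; have s0 := sg0 i.
have h3 : sg i * g (k + 5) <= sg i * 2^-1 ^+ 5 by rewrite ler_wpM2l ?half_g5 // ltW.
have h4 := lerB_dist x y; rewrite !exprS expr0 in h3; lra.
Qed.

Lemma nrm_E i : nrm (E i) = 1. Proof. by apply: nrm_eq1; rewrite hEE eqxx. Qed.
Lemma nrm_P k : nrm (P k) = 1. Proof. by apply: nrm_eq1; rewrite hPP eqxx. Qed.
Lemma nrm_Q k : nrm (Q k) = 1. Proof. by apply: nrm_eq1; rewrite hQQ eqxx. Qed.

(** Nodes up to block [k] are at distance at least rho_k / 2 from q_k, and later weights are far
    below |q_k|. The factor 2^(k+1) makes up for the 2^-i of the geometric bound, as i <= k for the
    former nodes. *)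
Lemma resO k : exists2 c, hser (fun i => (wa i / (o i - (q k)%:C)) *: E i) c &
  nrm c <= 2 * (2 ^+ k.+1 / rho k).
Proof.
have r0 := rho0 k.
have hb i : nrm ((wa i / (o i - (q k)%:C)) *: E i) <= 2 ^+ k.+1 / rho k * 2^-1 ^+ i.
  rewrite (nrmZ hip) nrm_E mulr1.
  have hR : 0 <= 2 ^+ k.+1 / rho k * 2^-1 ^+ i.
    by rewrite mulr_ge0 ?exprn_ge0 ?invr_ge0 // divr_ge0 ?exprn_ge0 // ltW.
  have [oi|oi] := eqVneq (o i) 0; first by rewrite hwa0 // mul0r normc0.
  rewrite normcM normcV; have w1 := hwa i.
  have w0 := normc_ge0 (wa i).
  have [hi|hi] := leqP (2 ^ i) k.
    have [h1 _ h2] := node_far oi hi.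
    have d0 : 0 < normc (o i - (q k)%:C) by lra.
    rewrite ler_pdivrMr //.
    have : 1 <= 2 ^+ k.+1 / rho k * 2^-1 ^+ i * (rho k / 2).
      have -> : 2 ^+ k.+1 / rho k * 2^-1 ^+ i * (rho k / 2) = 2 ^+ k * 2^-1 ^+ i.
        by rewrite exprS; field; rewrite gt_eqF.
      rewrite exprVn ler_pdivlMr ?exprn_gt0 // mul1r ler_weXn2l ?ler1n //.
      by apply: leq_trans hi; rewrite ltnW // ltn_expl.
    have hw := wo_le128 rho0 sg0 sgT Trho rhow (2 ^ i).
    have : 2 ^+ k.+1 / rho k * 2^-1 ^+ i * (rho k / 2) <=
           2 ^+ k.+1 / rho k * 2^-1 ^+ i * normc (o i - (q k)%:C).
      by rewrite ler_wpM2l //; lra.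
    lra.
  have [_ h2] := node_near hi; have s0 := sg0 k.
  have d0 : 0 < normc (o i - (q k)%:C) by lra.
  rewrite ler_pdivrMr //; apply: le_trans w1 _; apply: le_trans (WS hi) _.
  have h3 : g (2 ^ i + 5) <= g i * 2^-1.
    rewrite /g -exprSr ler_wiXn2l ?invr_ge0 ?invf_le1 ?ler1n //.
    exact: leq_trans (@ltn_expl 2 i isT) (leq_addr _ _).
  have h4 : 1 <= 2 ^+ k.+1 / rho k.
    rewrite ler_pdivlMr // mul1r; have := R128 k.
    have : 1 <= 2 ^+ k.+1 :> R by rewrite exprn_ege1 // ler1n.
    lra.
  apply: (@le_trans _ _ (sg k * (g i * 2^-1))); first by rewrite ler_wpM2l // ltW.
  have g0i := g0 i.
  rewrite -/(g i); move: (2 ^+ k.+1 / rho k) h4 (normc (o i - _)) h2 d0 => C h4 d h2 d0.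
  have h5 : sg k / 2 <= C * d by have := ler_wpM2r (ltW d0) h4; lra.
  by have := ler_wpM2l (ltW g0i) h5; lra.
have [c hc hc'] := hser_geom hip hcpl hb; exists c => //.
exact: (hser_bound hip hb).
Qed.

Lemma resO_tail k n c : hser (fun i => (wa i / (o i - (q k)%:C)) *: E i) c ->
  (forall i, (n <= i)%N -> (k < 2 ^ i)%N) ->
  nrm (c - \sum_(i < n) (wa i / (o i - (q k)%:C)) *: E i) <= 4 * wo sg k.+1 / sg k.
Proof.
move=> hc hn; have hc' := hser_shift hip n hc; have s0 := sg0 k.
have w0 := wo_gt0 sg0 k.+1.
suff hb d : nrm ((wa (n + d) / (o (n + d) - (q k)%:C)) *: E (n + d)) <=
    (2 * wo sg k.+1 / sg k) * 2^-1 ^+ d.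
  have -> : 4 * wo sg k.+1 / sg k = 2 * (2 * wo sg k.+1 / sg k) by ring.
  exact: (hser_bound hip hb hc').
rewrite (nrmZ hip) nrm_E mulr1 normcM normcV.
have [_ h2] := node_near (hn (n + d)%N (leq_addr _ _)).
have d0 : 0 < normc (o (n + d) - (q k)%:C) by lra.
(* Each doubling of the block index advances at least one block, so the weights halve with every
   [d]. *)
have hnd : (k.+1 + d <= 2 ^ (n + d))%N.
  have : (k.+1 * 2 ^ d <= 2 ^ (n + d))%N by rewrite expnD leq_mul2r hn ?orbT.
  by have := @ltn_expl 2 d isT; nia.
have hw : normc (wa (n + d)) <= wo sg k.+1 * 2^-1 ^+ d.
  apply: le_trans (hwa _) _; apply: le_trans (wo_mono rho0 sg0 sgT Trho rhow hnd) _.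
  exact: (wo_decay rho0 sg0 sgT Trho rhow).
rewrite ler_pdivrMr //; apply: le_trans hw _.
have h : 1 <= 2 / sg k * normc (o (n + d) - (q k)%:C).
  by rewrite mulrAC ler_pdivlMr //; lra.
have h3 : 0 <= wo sg k.+1 * 2^-1 ^+ d.
  by apply: mulr_ge0; [exact: ltW|rewrite exprn_ge0 ?invr_ge0].
by have := ler_wpM2l h3 h; lra.
Qed.

Let u k i := (rho i ^+ 2 / (p i - q k))%:C *: P i.

(** The resonant term [u k k] is set apart: p_k and q_k share a block, so it is a huge multiple of
    [P k], the one that dominates X_k. *)
Lemma resP k : exists2 c, hser (u k) c & nrm (c - u k k) <= 2 * (2 ^+ k.+1 / rho k).
Proof.
have r0 := rho0 k; have s0 := sg0 k; have R1 := R128 k.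
pose C := 2 ^+ k.+1 / rho k.
have C0 : 0 < C by rewrite divr_gt0 ?exprn_gt0.
have nu i : nrm (u k i) = rho i ^+ 2 / `|p i - q k|.
  rewrite /u (nrmZ hip) nrm_P mulr1 normc_real normrM normfV.
  by rewrite ger0_norm ?sqr_ge0.
have sqle i : rho i ^+ 2 <= rho i.
  by have := R128 i; have := rho0 i; rewrite expr2 => *; rewrite ler_piMr //; lra.
have hb i : i != k -> nrm (u k i) <= C * 2^-1 ^+ i.
  move=> hik; rewrite nu; have /andP[hp1 hp2] := hp i; have /andP[hq1 hq2] := hq k.
  have [hi|hi|hi] := ltngtP i k; last by rewrite hi eqxx in hik.
    have [h1 _] := pair_far hi hp1 hq2.
    have si := sg0 i.
    have d0 : 0 < `|p i - q k| by lra.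
    rewrite ler_pdivrMr //; apply: le_trans (sqle i) _.
    have h2 : rho k <= sg i.
      by apply: le_trans (RS hi) _; rewrite ler_piMr ?g1 // ltW.
    have h3 : 1 <= C * 2^-1 ^+ i * (sg i / 2).
      apply: (@le_trans _ _ (C * 2^-1 ^+ i * (rho k / 2))); last first.
        by rewrite ler_wpM2l ?mulr_ge0 ?exprn_ge0 ?invr_ge0 ?(ltW C0) //; lra.
      have -> : C * 2^-1 ^+ i * (rho k / 2) = 2 ^+ k * 2^-1 ^+ i.
        by rewrite /C exprS; field; rewrite gt_eqF.
      by rewrite exprVn ler_pdivlMr ?exprn_gt0 // mul1r ler_weXn2l ?ler1n // ltnW.
    have h4 : C * 2^-1 ^+ i * (sg i / 2) <= C * 2^-1 ^+ i * `|p i - q k|.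
      by rewrite ler_wpM2l ?mulr_ge0 ?exprn_ge0 ?invr_ge0 ?(ltW C0) //; lra.
    by have := R128 i; lra.
  have [h1 _] := pair_far hi hq1 hp2; rewrite distrC in h1.
  have d0 : 0 < `|p i - q k| by lra.
  rewrite ler_pdivrMr //; apply: le_trans (sqle i) _; apply: le_trans (RS hi) _.
  have h3 : g (i + 5) <= g i * 2^-1.
    by rewrite /g -exprSr ler_wiXn2l ?invr_ge0 ?invf_le1 ?ler1n // -addn1 leq_add2l.
  have h4 : 1 <= C.
    rewrite /C ler_pdivlMr // mul1r.
    have : 1 <= 2 ^+ k.+1 :> R by rewrite exprn_ege1 // ler1n.
    by lra.
  apply: (@le_trans _ _ (sg k * (g i * 2^-1))); first by rewrite ler_wpM2l // ltW.
  have g0i := g0 i.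
  rewrite -/(g i); move: C h4 C0 (`|p i - q k|) h1 d0 => C h4 C0 d h1 d0.
  have h5 : sg k / 2 <= C * d by have := ler_wpM2r (ltW d0) h4; lra.
  by have := ler_wpM2l (ltW g0i) h5; lra.
(* [D] absorbs the resonant term for the sake of convergence only; the final estimate drops that
   term and uses [C]. *)
pose D := C + nrm (u k k) * 2 ^+ k.
have hD i : nrm (u k i) <= D * 2^-1 ^+ i.
  have [->|hi] := eqVneq i k.
    have e : 2 ^+ k * 2^-1 ^+ k = 1 :> R by rewrite -exprMn divff ?pnatr_eq0 // expr1n.
    rewrite /D mulrDl -[X in _ + X]mulrA e mulr1 lerDr.
    by rewrite mulr_ge0 ?exprn_ge0 ?invr_ge0 // ltW.
  apply: le_trans (hb i hi) _; rewrite ler_wpM2r ?exprn_ge0 ?invr_ge0 //.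
  by rewrite lerDl mulr_ge0 ?nrm_ge0 ?exprn_ge0.
have [c hc _] := hser_geom hip hcpl hD; exists c => //.
apply: (hser_bound (u := fun i => if i == k then 0 else u k i) hip) _ (hser_drop hip k hc) => i.
have [_|hi] := eqVneq i k; last exact: hb.
by rewrite nrm0 // mulr_ge0 ?exprn_ge0 ?invr_ge0 // ltW.
Qed.

Lemma split_index k : exists n, (forall i, (i < n)%N -> (2 ^ i <= k)%N) /\
  (forall i, (n <= i)%N -> (k < 2 ^ i)%N).
Proof.
have hex : exists n, (k < 2 ^ n)%N by exists k; apply: ltn_expl.
exists (ex_minn hex); case: ex_minnP => n hn hmin; split=> i hi.
  by rewrite leqNgt; apply/negP => /hmin; rewrite leqNgt hi.
by apply: leq_trans hn _; rewrite leq_exp2l.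
Qed.

Lemma resO_eq k c : hser (fun i => (wa i / (o i - (q k)%:C)) *: E i) c ->
  A c - (q k)%:C *: c = aO.
Proof.
move=> hO; have s0 := sg0 k; have r0 := rho0 k.
apply: (hser_unique hip) haO.
have := hserD hip (hser_lin hip hbd hO) (hserZ hip (- (q k)%:C) hO).
rewrite scaleNr; apply: (hser_ext hip) => i.
have [oi|oi] := eqVneq (o i) 0.
  by rewrite hwa0 // mul0r !scale0r (lin0 hbd.1) scaler0 addr0.
have [n [hn1 hn2]] := split_index k.
have hd : o i - (q k)%:C != 0.
  rewrite -normc_gt0; have [hi|hi] := leqP (2 ^ i) k.
    by have [h1 _ h2] := node_far oi hi; lra.
  by have [_ h2] := node_near hi; lra.
rewrite (linZ hbd.1) hAE // !scalerA -scalerDl; congr (_ *: _).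
by move: (wa i) (o i) ((q k)%:C) hd => x y z hd; field.
Qed.

(* [X] is the eigenvector at [q_k], normalized by [(X, b) = -1]: the [Q k] component
   corrects [cO + cP = (A - q_k)^-1 a] so as to reach this normalization, and
   [res_gamma] says that a multiple of [X] is close to [P k]. *)
Record res_spec k (cO cP X : V) : Prop := ResSpec {
  res_O : hser (fun i => (wa i / (o i - (q k)%:C)) *: E i) cO;
  res_AO : A cO - (q k)%:C *: cO = aO;
  res_gP : forall z, (forall j, ip (P j) z = 0) -> ip cP z = 0;
  res_X : X = cO + cP - ((1 + ip cO bO) / (rho k ^+ 2)%:C) *: Q k;
  res_eig : A X - (q k)%:C *: X = aO + aP;
  res_b : ip X (bO + bQ) = -1;
  res_Q : ip X (Q k) != 0;
  res_rest : forall x, rest_vec x -> ip X x = 0;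
  res_gamma : exists2 t : R[i], t != 0 & nrm (P k - t *: X) <= 2^-1 ^+ (k + 3) }.

(** Since (P_j, b) = 0 and (Q_j, a) = 0, the vector cO + cP meets b only through (cO, bO) = B - 1.
    Adding a multiple of [Q k], which A - q_k kills, does not disturb the equation and brings (X, b)
    to -1. That B is nonzero puts a [Q k] component into X. *)
Lemma res_exists k : exists Y : V * V * V, res_spec k Y.1.1 Y.1.2 Y.2.
Proof.
have [cO hO bdO] := resO k; have [cP hP bdP] := resP k.
pose B := 1 + ip cO bO; pose w := (rho k ^+ 2)%:C : R[i].
have r0 := rho0 k; have s0 := sg0 k; have R1 := R128 k.
have w0 : w != 0 by rewrite realc_eq0 expf_neq0 // gt_eqF.
pose X := cO + cP - (B / w) *: Q k.
have AO := resO_eq hO.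
have hPk (j : nat) : (p j - q k)%:C != 0 -> (rho j ^+ 2 / (p j - q k))%:C * ((p j)%:C - (q k)%:C)
    = (rho j ^+ 2)%:C.
  by rewrite -realcB -realcM realc_eq0 => h; rewrite divfK.
have hpqn j : p j - q k != 0.
  have [hj|hj|->] := ltngtP j k; last by rewrite subr_eq0.
    have /andP[h1 _] := hp j; have /andP[_ h2] := hq k.
    by have [h3 _] := pair_far hj h1 h2; have := sg0 j; rewrite -normr_gt0; lra.
  have /andP[_ h1] := hp j; have /andP[h2 _] := hq k.
  by have [h3 _] := pair_far hj h2 h1; rewrite distrC in h3; rewrite -normr_gt0; lra.
have AP : A cP - (q k)%:C *: cP = aP.
  apply: (hser_unique hip) haP.
  have := hserD hip (hser_lin hip hbd hP) (hserZ hip (- (q k)%:C) hP).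
  rewrite scaleNr; apply: (hser_ext hip) => i.
  rewrite /u (linZ hbd.1) hAP !scalerA -scalerDl; congr (_ *: _).
  rewrite mulNr [(q k)%:C * _]mulrC -mulrBr; apply: hPk.
  by rewrite realc_eq0.
have cObQ : ip cO bQ = 0.
  apply: (ip_eq0C hip); apply: (hser_ip0 hip hbQ) => i; rewrite (ipZl hip).
  rewrite (_ : ip (Q i) cO = 0) ?mulr0 //; apply: (ip_eq0C hip).
  by apply: (hser_ip0 hip hO) => j; rewrite (ipZl hip) hEQ mulr0.
have cPz z : (forall j, ip (P j) z = 0) -> ip cP z = 0.
  by move=> hz; apply: (hser_ip0 hip hP) => j; rewrite /u (ipZl hip) hz mulr0.
have cPbQ : ip cP bQ = 0.
  apply: cPz => j; apply: (ip_eq0C hip); apply: (hser_ip0 hip hbQ) => i.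
  by rewrite (ipZl hip) (ip_eq0C hip (hPQ j i)) mulr0.
have QbQ : ip (Q k) bQ = w.
  rewrite ipC // (hser_ip (k := k) hip hbQ (c := w)) ?conjc_real // => [i hi|].
    by rewrite (ipZl hip) hQQ (negbTE hi) mulr0.
  by rewrite (ipZl hip) hQQ eqxx mulr1.
have [n [hn1 hn2]] := split_index k.
have /andP[b1 b2] := hbeta AO hn2; rewrite -/B normcM in b1 b2.
have B0 : 0 < normc B.
  rewrite lt_def normc_ge0 andbT; apply/eqP => h; move: b1; rewrite h mul0r; lra.
(* Nodes up to block [k] are at least four times q_k, so dividing by this product keeps B bounded by
   2. *)
have hprod : 1 <= normc (\prod_(i < n) (1 - o i / (q k)%:C)).
  rewrite normc_prod; apply: (big_ind (fun x : R => 1 <= x)) => // [x y|i _].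
    by move=> hx hy; rewrite -[1]mulr1; apply: ler_pM.
  have [->|oi] := eqVneq (o i) 0; first by rewrite mul0r subr0 normc1.
  have [_ h1 _] := node_far oi (hn1 i (ltn_ord i)).
  have /andP[h2 _] := hq k.
  have q0 : 0 < `|q k| by lra.
  have := le_normcB (o i / (q k)%:C) 1; rewrite normc1 normc_subr.
  have : 2 <= normc (o i / (q k)%:C).
    by rewrite normcM normcV normc_real ler_pdivlMr //; have := normc_ge0 (o i); lra.
  lra.
have B2 : normc B <= 2 by have := ler_wpM2l (ltW B0) hprod; lra.
have XQ : ip X (Q k) = - (B / w).
  rewrite /X (ipBl hip) (ipDl hip) cPz => [|j]; last exact: hPQ.
  rewrite (hser_ip0 hip hO) => [|j]; last by rewrite (ipZl hip) hEQ mulr0.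
  by rewrite (ipZl hip) hQQ eqxx mulr1 addr0 sub0r.
exists (cO, cP, X); split=> //=.
- rewrite /X (linB hbd.1) (linD hbd.1) (linZ hbd.1) hAQ -AO -AP.
  rewrite !scalerBr !scalerDr !scalerA [_ * (q k)%:C]mulrC.
  by rewrite opprB subrKA opprD addrACA.
- rewrite /X (ipBl hip) (ipDl hip) (ipZl hip) !(ipDr hip) cObQ cPbQ QbQ hbOQ.
  rewrite (cPz bO) => [|j]; last exact: hbOP.
  by rewrite addr0 !add0r addr0 divfK // /B opprD addrCA subrr addr0.
- by rewrite XQ oppr_eq0 mulf_neq0 ?invr_eq0 // -normc_gt0.
- move=> x [_ [h1 h2 h3]]; rewrite /X (ipBl hip) (ipDl hip) (ipZl hip) h2 mulr0 subr0.
  rewrite cPz // addr0; apply: (hser_ip0 hip hO) => i; rewrite (ipZl hip).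
  have [oi|oi] := eqVneq (o i) 0; first by rewrite hwa0 // mul0r mul0r.
  by rewrite h3 // mulr0.
have t0 : p k - q k != 0 by rewrite subr_eq0.
(* This factor turns the resonant term [u k k] into exactly [P k]. *)
exists ((p k - q k) / rho k ^+ 2)%:C.
  by rewrite realc_eq0 mulf_neq0 ?invr_eq0 // expf_neq0 // gt_eqF.
set t := (_ / _)%:C.
have -> : P k - t *: X = - (t *: (cO + (cP - u k k) - (B / w) *: Q k)).
  have hu : t *: u k k = P k.
    rewrite /u scalerA -realcM mulrA divfK ?expf_neq0 ?gt_eqF //.
    by rewrite divff // scale1r.
  rewrite -[X in X - _]hu -scalerBr -scalerN; congr (_ *: _).
  by rewrite /X addrA !opprB addrCA.
rewrite (nrmN hip) (nrmZ hip).
have nQ := nrm_Q k.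
have hB : nrm ((B / w) *: Q k) <= 2 / rho k ^+ 2.
  rewrite (nrmZ hip) nQ mulr1 normcM normcV normc_real ger0_norm ?sqr_ge0 //.
  by rewrite ler_wpM2r // invr_ge0 sqr_ge0.
have ht : normc t <= 2 * T k / rho k ^+ 2.
  rewrite normc_real normrM normfV (ger0_norm (sqr_ge0 (rho k))).
  rewrite ler_wpM2r ?invr_ge0 ?sqr_ge0 //; apply: le_trans (ler_normB _ _) _.
  by have /andP[_ h1] := hp k; have /andP[_ h2] := hq k; lra.
have hv : nrm (cO + (cP - u k k) - (B / w) *: Q k) <= 2 ^+ (k + 4) / rho k ^+ 2.
  apply: le_trans (nrmB hip _ _) _; apply: le_trans (lerD (nrmD hip _ _) hB) _.
  apply: le_trans (lerD (lerD bdO bdP) (lexx _)) _.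
  have h1 : (rho k)^-1 <= (rho k ^+ 2)^-1.
    by rewrite lef_pV2 ?posrE ?exprn_gt0 // expr2 ler_piMr ?(ltW r0) //; lra.
  have h2 : 1 <= 2 ^+ k :> R by rewrite exprn_ege1 // ler1n.
  have h3 : 0 < (rho k ^+ 2)^-1 by rewrite invr_gt0 exprn_gt0.
  rewrite exprD exprS; move: (2 ^+ k) h2 ((rho k)^-1) ((rho k ^+ 2)^-1) h1 h3 => a ha b c hbc hc.
  have : a * b <= a * c by rewrite ler_wpM2l //; lra.
  have : 1 * c <= a * c by rewrite ler_wpM2r // ltW.
  rewrite !exprS expr0; lra.
have hT : T k / rho k ^+ 4 <= (64 ^+ (k + 8))^-1.
  by rewrite ler_pdivrMr ?exprn_gt0 // mulrC; apply: Trho.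
apply: le_trans (ler_pM (normc_ge0 _) (nrm_ge0 _ _) ht hv) _.
have -> : 2 * T k / rho k ^+ 2 * (2 ^+ (k + 4) / rho k ^+ 2) =
    2 ^+ (k + 5) * (T k / rho k ^+ 4).
  have -> : (k + 5 = (k + 4).+1)%N by rewrite addnS.
  rewrite [2 ^+ (k + 4).+1]exprS; move: (2 ^+ (k + 4)) => z; field; rewrite gt_eqF //.
apply: le_trans (ler_wpM2l _ hT) _; first by rewrite exprn_ge0.
have -> : 64 = 2 ^+ 6 :> R by rewrite -natrX.
rewrite -exprM exprVn ler_pdivrMr ?exprn_gt0 // mulrC ler_pdivlMr ?exprn_gt0 // -exprD.
by rewrite ler_weXn2l ?ler1n // gamma_exponent.
Qed.

(** The numerator, in the variable 1 / lam, of the sum of d_i / (o_i - lam) with d_i = wa_i (E_i,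
    z): clearing denominators by the product of the 1 - o_j / lam leaves a polynomial, up to the
    factor -1 / lam. *)
Let node_poly (z : V) n : {poly R[i]} :=
  \sum_(i < n) (wa i * ip (E i) z) *: \prod_(j < n | j != i) (1 - o j *: 'X).

Lemma node_poly_size z n : (size (node_poly z n) <= n)%N.
Proof.
apply: leq_trans (size_sum _ _ _) _; apply/bigmax_leqP => i _.
apply: leq_trans (size_scale_leq _ _) _; apply: size_prod_linear => j.
apply: leq_trans (size_polyD _ _) _; rewrite geq_max size_poly1 size_polyN /=.
by apply: leq_trans (size_scale_leq _ _) _; rewrite size_polyX.
Qed.

Lemma node_poly_eval z n x : (node_poly z n).[x] =
  \sum_(i < n) wa i * ip (E i) z * \prod_(j < n | j != i) (1 - o j * x).
Proof.
rewrite horner_sum; apply: eq_bigr => i _; rewrite hornerZ horner_prod.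
by congr (_ * _); apply: eq_bigr => j _; rewrite !hornerE.
Qed.

(* [(X, z) = 0] expresses [(cO, z)] by [B = 1 + (cO, bO)], and [- 1/q_k] times the
   value at [1/q_k] is [Pi * (cO, z)] up to the tail of the series of [cO], where
   [|B * Pi| <= 2]. *)
Lemma node_poly_at_q z n k cO cP X : res_spec k cO cP X ->
  (forall j, ip (P j) z = 0) -> ip X z = 0 ->
  (0 < k)%N -> (n <= k)%N -> (forall i, (n <= i)%N -> (k < 2 ^ i)%N) ->
  normc (node_poly z n).[(q k)%:C^-1] <= 2 * nrm z / 64 ^+ k.
Proof.
move=> [hO AO hP hX _ _ _ _ _] hPz hXz k0 hnk hn.
have r0 := rho0 k; have s0 := sg0 k; have R1 := R128 k.
have /andP[hq1 hq2] := hq k.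
have q0 : (q k)%:C != 0 by rewrite realc_eq0 -normr_gt0; lra.
set B := 1 + ip cO bO in hX.
have w0 : (rho k ^+ 2)%:C != 0 :> R[i] by rewrite realc_eq0 expf_neq0 // gt_eqF.
set tail := cO - \sum_(i < n) (wa i / (o i - (q k)%:C)) *: E i.
have cOz : ip cO z = B / (rho k ^+ 2)%:C * ip (Q k) z.
  have := hXz; rewrite hX (ipBl hip) (ipDl hip) hP // addr0 (ipZl hip).
  by move/eqP; rewrite subr_eq0 => /eqP.
have hd i : o i - (q k)%:C != 0.
  rewrite -normc_gt0; have [n' [h1 h2]] := split_index k.
  have [oi|oi] := eqVneq (o i) 0.
    by rewrite oi sub0r normc_opp normc_gt0.
  have [hi|hi] := leqP (2 ^ i) k.
    by have [h3 _ h4] := node_far oi hi; lra.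
  by have [_ h4] := node_near hi; lra.
pose Pi := \prod_(j < n) (1 - o j / (q k)%:C).
have hDE : (node_poly z n).[(q k)%:C^-1] =
    - (q k)%:C * (Pi * (B / (rho k ^+ 2)%:C * ip (Q k) z - ip tail z)).
  rewrite -cOz -(ipBl hip) /tail opprB addrC subrK (ip_suml hip) node_poly_eval.
  rewrite mulrCA !mulr_sumr; apply: eq_bigr => i _; rewrite (ipZl hip).
  have -> : Pi = (1 - o i / (q k)%:C) * \prod_(j < n | j != i) (1 - o j / (q k)%:C).
    by rewrite /Pi (bigD1 i).
  move: (\prod_(j < n | j != i) _) => Pj.
  have := hd i; move: (wa i) (ip _ _) (o i) ((q k)%:C) q0 => x y t s q0 h.
  by field; rewrite q0 h.
have /andP[_ hb] := hbeta AO hn; rewrite -/B -/Pi normcM in hb.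
have htail : nrm tail <= 4 * wo sg k.+1 / sg k by apply: resO_tail.
have hPi : normc Pi <= (2 / sg k) ^+ k.
  rewrite /Pi normc_prod; apply: (@le_trans _ _ (\prod_(j < n) (2 / sg k))).
    apply: ler_prod => j _; rewrite normc_ge0 /=; apply: le_trans (normcD _ _) _.
    rewrite normc1 normc_opp normcM normcV normc_real.
    have oj1 : normc (o j) <= 1.
      have [->|oj] := eqVneq (o j) 0; first by rewrite normc0.
      by rewrite ho //; have := R128 (2 ^ j); lra.
    have s1 : 1 <= (sg k)^-1 by rewrite invf_ge1 //; have := SR k; lra.
    have h1 : normc (o j) / `|q k| <= 1 * (sg k)^-1.
      by apply: ler_pM; rewrite ?normc_ge0 ?invr_ge0 // lef_pV2 ?posrE //; lra.
    by move: s1 h1; move: (_ / _) (sg k)^-1 => a b; lra.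
  rewrite prodr_const card_ord; apply: ler_weXn2l => //.
  by rewrite ler_pdivlMr //; have := SR k; lra.
have nQ := nrm_Q k.
have hQz : normc (ip (Q k) z) <= nrm z.
  by apply: le_trans (cauchy_schwarz hip _ _) _; rewrite nQ mul1r.
have hTz : normc (ip tail z) <= 4 * wo sg k.+1 / sg k * nrm z.
  apply: le_trans (cauchy_schwarz hip _ _) _; apply: ler_wpM2r => //.
  exact: nrm_ge0.
rewrite hDE normcM normc_opp normc_real mulrBr.
have z0 := nrm_ge0 ip z.
have h1 : normc (Pi * (B / (rho k ^+ 2)%:C * ip (Q k) z)) <= 2 / rho k ^+ 2 * nrm z.
  rewrite !normcM normcV normc_real ger0_norm ?sqr_ge0 // !mulrA.
  apply: ler_pM => //; rewrite ?normc_ge0 ?mulr_ge0 ?invr_ge0 ?normc_ge0 ?sqr_ge0 //.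
  by rewrite ler_wpM2r ?invr_ge0 ?sqr_ge0 // mulrC.
have h2 : normc (Pi * ip tail z) <= (2 / sg k) ^+ k * (4 * wo sg k.+1 / sg k * nrm z).
  by rewrite normcM; apply: ler_pM; rewrite ?normc_ge0.
have q1 : `|q k| <= 1 by have := TR k; lra.
(* Main term: the loss 1 / rho_k^2 of the [Q k] coefficient is covered by |q_k| <= T_k. *)
have e1 : `|q k| * (2 / rho k ^+ 2 * nrm z) <= nrm z / 64 ^+ k.
  have : `|q k| * 2 / rho k ^+ 2 <= (64 ^+ k)^-1.
    rewrite ler_pdivrMr ?exprn_gt0 //; apply: (@le_trans _ _ (T k * 2)).
      by rewrite ler_wpM2r.
    have h64 : 0 < 64 ^+ k :> R by rewrite exprn_gt0.
    apply: (@le_trans _ _ (rho k ^+ 4 / 64 ^+ (k + 8) * 2)); first by rewrite ler_wpM2r.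
    have a1 : rho k ^+ 2 <= 1 by apply: exprn_ile1; [apply: ltW|lra].
    have a2 : (64 ^+ 8)^-1 * 2 <= 1 :> R.
      by rewrite mulrC ler_pdivrMr ?exprn_gt0 // mul1r -natrX ler_nat.
    have a3 : 0 <= (64 ^+ 8)^-1 * 2 :> R by rewrite mulr_ge0 ?invr_ge0 ?exprn_ge0.
    have -> : rho k ^+ 4 / 64 ^+ (k + 8) * 2 =
        ((64 ^+ k)^-1 * rho k ^+ 2) * (rho k ^+ 2 * ((64 ^+ 8)^-1 * 2)).
      rewrite [rho k ^+ 4](exprD _ 2 2) exprD invfM.
      move: (64 ^+ k)^-1 (64 ^+ 8)^-1 => x y; ring.
    apply: ler_piMr; first by rewrite mulr_ge0 ?invr_ge0 ?sqr_ge0 ?(ltW h64).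
    by apply: mulr_ile1; rewrite ?sqr_ge0.
  by move=> /(ler_wpM2r z0) h; rewrite [leRHS]mulrC; apply: le_trans h; rewrite !mulrA.
(* Tail: of the k + 2 powers of [sg k] in [wo sg k.+1], k cancel the product, one cancels the
   denominator of the tail, and one is left over. *)
have e2 : `|q k| * ((2 / sg k) ^+ k * (4 * wo sg k.+1 / sg k * nrm z)) <= nrm z / 64 ^+ k.
  have : (2 / sg k) ^+ k * (4 * wo sg k.+1 / sg k) <= (64 ^+ k)^-1.
    have sn : sg k != 0 by rewrite gt_eqF.
    have -> : (2 / sg k) ^+ k * (4 * wo sg k.+1 / sg k) =
        (64 ^+ k)^-1 * (4 * sg k / 128 ^+ 2).
      have -> : wo sg k.+1 = (sg k / 128) ^+ k * (sg k / 128) ^+ 2.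
        by rewrite /= -exprD addn2.
      have <- : (2 / sg k) ^+ k * (sg k / 128) ^+ k = (64 ^+ k)^-1.
        by rewrite -exprMn -exprVn; congr (_ ^+ _); field; rewrite sn.
      move: (_ ^+ k) (_ ^+ k) => x y; by field; rewrite sn.
    have h64 : 0 < 64 ^+ k :> R by rewrite exprn_gt0.
    rewrite ler_piMr ?invr_ge0 ?(ltW h64) //.
    by rewrite ler_pdivrMr ?exprn_gt0 // !exprS; have := SR k; lra.
  move=> /(ler_wpM2r z0) h; rewrite [leRHS]mulrC [X in _ * X]mulrA.
  apply: le_trans h; apply: ler_piMl => //; apply: mulr_ge0 => //.
  apply: mulr_ge0; first by rewrite exprn_ge0 // divr_ge0 // ltW.
  by rewrite divr_ge0 ?(ltW s0) // mulr_ge0 // ltW // wo_gt0.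
apply: le_trans (ler_wpM2l (normr_ge0 _) (normcD _ _)) _; rewrite normc_opp mulrDr.
have -> : 2 * nrm z / 64 ^+ k = nrm z / 64 ^+ k + nrm z / 64 ^+ k by ring.
apply: lerD; [apply: le_trans e1|apply: le_trans e2]; exact: ler_wpM2l.
Qed.

Lemma nodes_dec i j : (i < j)%N -> o i != 0 ->
  normc (o j) <= normc (o i) * 2^-1 ^+ j.+2.
Proof.
move=> hij oi; have [->|oj] := eqVneq (o j) 0.
  by rewrite normc0 mulr_ge0 ?normc_ge0 ?exprn_ge0 ?invr_ge0.
rewrite !ho //; have h : (2 ^ i < 2 ^ j)%N by rewrite ltn_exp2l.
apply: le_trans (RS h) _; apply: ler_pM => //; rewrite ?exprn_ge0 ?invr_ge0 //.
- exact: ltW.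
- rewrite /g ler_wiXn2l ?invr_ge0 ?invf_le1 ?ler1n //.
  exact: pow2_exponent.
Qed.

(** At 1 / o_i every summand but the i-th has a vanishing factor. In the i-th, the factors of
    earlier nodes have modulus at least 1 and those of later nodes multiply to at least 1/2. *)
Lemma node_poly_at_o z n i : (i < n)%N -> o i != 0 ->
  normc (wa i * ip (E i) z) / 2 <= normc (node_poly z n).[(o i)^-1].
Proof.
move=> hi oi; have hz (j : 'I_n) : j != Ordinal hi ->
    wa j * ip (E j) z * \prod_(l < n | l != j) (1 - o l / o i) = 0.
  by move=> hj; rewrite (bigD1 (Ordinal hi)) 1?eq_sym //= divff // subrr mul0r mulr0.
rewrite node_poly_eval (bigD1 (Ordinal hi)) //= (big1 _ _ _ hz) addr0.
rewrite [X in _ <= X]normcM; apply: ler_wpM2l; first exact: normc_ge0.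
pose y j := if j == i then 0 else o j / o i.
have -> : \prod_(j < n | j != Ordinal hi) (1 - o j / o i) = \prod_(0 <= j < n) (1 - y j).
  rewrite big_mkord [RHS](bigD1 (Ordinal hi)) //= /y eqxx subr0 mul1r.
  by apply: eq_bigr => j hj; rewrite (_ : (j == i :> nat) = false) //; apply/negbTE.
rewrite (big_cat_nat (n := i.+1)) //= normcM !normc_prod.
have oi0 : 0 < normc (o i) by rewrite normc_gt0.
have /andP[h1 _] : 2^-1 <= \prod_(i.+1 <= j < n) normc (1 - y j) <= 2.
  apply: prod_near1 => // j hj; rewrite /y gtn_eqF //.
  by rewrite normcM normcV ler_pdivrMr // mulrC nodes_dec.
have h2 : 1 <= \prod_(0 <= j < i.+1) normc (1 - y j).
  rewrite big_nat; apply: (big_ind (fun x : R => 1 <= x)) => // [a b|j /andP[_ hj]].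
    by move=> ha hb; rewrite -[1]mulr1; apply: ler_pM.
  rewrite /y; have [_|hne] := eqVneq j i; first by rewrite subr0 normc1.
  have [->|oj] := eqVneq (o j) 0; first by rewrite mul0r subr0 normc1.
  have hji : (j < i)%N by rewrite ltn_neqAle hne -ltnS.
  have := nodes_dec hji oj; have := le_normcB (o j / o i) 1; rewrite normc1 normc_subr.
  rewrite normcM normcV => h3 h4; apply: le_trans h3.
  suff : 2 <= normc (o j) / normc (o i) by lra.
  have : 2^-1 ^+ i.+2 <= 2^-1 ^+ 2 :> R.
    by rewrite ler_wiXn2l ?invr_ge0 ?invf_le1 ?ler1n.
  move=> /(ler_wpM2l (normc_ge0 (o j))); rewrite ler_pdivlMr // !exprS expr0 => h5.
  move: h4 h5; rewrite !exprS; lra.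
by move: (\prod_(_ <= _ < _) _) (\prod_(_ <= _ < _) _) h1 h2 => a b h1 h2; nra.
Qed.

Lemma half_complete (Y : nat -> V * V * V) z :
  (forall k, res_spec k (Y k).1.1 (Y k).1.2 (Y k).2) ->
  (forall k, ip (Y k).2 z = 0) -> (forall j, ip (P j) z = 0) ->
  (forall x, rest_vec x -> ip x z = 0) -> z = 0.
Proof.
move=> hY hYz hPz hRz; have nz := nrm_ge0 ip z.
have hd i m : o i != 0 -> (i <= m)%N -> normc (wa i * ip (E i) z) <= 4 * nrm z * 2^-1 ^+ m.
  move=> oi him; pose s (l : 'I_m.+1) := (q (2 ^ m + l)%N)%:C^-1 : R[i].
  have m2 : (m < 2 ^ m)%N := @ltn_expl 2 m isT.
  have hk (l : 'I_m.+1) : (m < 2 ^ m + l)%N by apply: ltn_addr.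
  have q0 k : (q k)%:C != 0.
    by rewrite realc_eq0 -normr_gt0; have /andP[h _] := hq k; have := sg0 k; lra.
  have hqq k j : k != j -> `|q k| / 2 <= `|q j - q k|.
    have /andP[a1 a2] := hq k; have /andP[a3 a4] := hq j.
    have [h|h|->] := ltngtP k j; last by [].
      by rewrite distrC; have := pair_far_l h a1 a4.
    by have [_ h1] := pair_far h a3 a2.
  have hinj : injective s.
    move=> l j /(congr1 (fun x => x^-1)); rewrite !invrK => -[] h; apply/eqP.
    rewrite -[_ == _]negbK; apply/negP => hne.
    have := hqq (2 ^ m + l)%N (2 ^ m + j)%N; rewrite eqn_add2l => /(_ hne).
    rewrite h subrr normr0; have := q0 (2 ^ m + j)%N; rewrite realc_eq0 -normr_gt0; lra.
  (* The left side is at most 2 / |q_j|, as o_i dominates q_j, and |1/q_l - 1/q_j| is at least 1 /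
     (2 |q_j|); here the index j stands for block 2^m + j. *)
  have hr l j : j != l -> normc ((o i)^-1 - s j) <= 4 * normc (s l - s j).
    move=> hjl; rewrite /s; have hi : (2 ^ i <= 2 ^ m + j)%N.
      by apply: leq_trans (leq_addr _ _); rewrite leq_exp2l.
    have [_ h1 _] := node_far oi hi.
    have h2 := hqq (2 ^ m + l)%N (2 ^ m + j)%N; rewrite eqn_add2l eq_sym in h2.
    have {}h2 := h2 hjl; move: h1 h2 (q0 (2 ^ m + l)%N) (q0 (2 ^ m + j)%N).
    move: (q (2 ^ m + l)%N) (q (2 ^ m + j)%N) => a b h1 h2 a0 b0.
    have -> : (o i)^-1 - b%:C^-1 = (b%:C - o i) / (o i * b%:C) by field; rewrite oi b0.
    have -> : a%:C^-1 - b%:C^-1 = (b%:C - a%:C) / (a%:C * b%:C) by field; rewrite a0 b0.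
    rewrite -realcB !normcM !normcV !normcM !normc_real.
    have oi0 : 0 < normc (o i) by rewrite normc_gt0.
    have a1 : 0 < `|a| by rewrite normr_gt0 -realc_eq0.
    have b1 : 0 < `|b| by rewrite normr_gt0 -realc_eq0.
    have h3 : normc (b%:C - o i) <= 2 * normc (o i).
      by have := normcD b%:C (- o i); rewrite normc_opp normc_real; lra.
    rewrite ler_pdivrMr ?mulr_gt0 //.
    have -> : 4 * (`|b - a| / (`|a| * `|b|)) * (normc (o i) * `|b|) =
        4 * `|b - a| * normc (o i) / `|a| by field; rewrite !gt_eqF.
    rewrite ler_pdivlMr //.
    apply: (@le_trans _ _ (2 * normc (o i) * `|a|)); first by rewrite ler_wpM2r // ltW.
    by nra.
  have he l : normc (node_poly z m.+1).[s l] <= 2 * nrm z / 64 ^+ m.+1.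
    have hl := hk l; have h0 := hY (2 ^ m + l)%N.
    apply: le_trans (node_poly_at_q h0 hPz (hYz _) _ _ _) _ => //.
    - exact: leq_trans hl.
    - move=> j hj; apply: (@leq_trans (2 ^ m.+1)); last by rewrite leq_exp2l.
      by rewrite expnS mul2n -addnn ltn_add2l; apply: leq_trans (ltn_ord l) m2.
    rewrite ler_wpM2l ?mulr_ge0 // lef_pV2 ?posrE ?exprn_gt0 //.
    by rewrite ler_weXn2l ?ler1n.
  have := interp_bound (node_poly_size z m.+1) hinj hr he.
  have := @node_poly_at_o z m.+1 i him oi => h1 h2.
  have {}h1 := le_trans h1 h2.
  have hm1 : (m.+1%:R : R) <= 2 ^+ m.+1 by rewrite -natrX ler_nat ltnW // ltn_expl.
  (* Of 64 = 2 * 2 * 4 * 4, one 2 pays for the m + 1 summands, the other is the decay that remains,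
     and one 4 pays for the Lagrange factors. *)
  have e1 : m.+1%:R * (2 * nrm z / 64 ^+ m.+1 * 4 ^+ m.+1) <= 2 * nrm z * 2^-1 ^+ m.+1.
    have p2 : 0 < 2 ^+ m.+1 :> R by rewrite exprn_gt0.
    have p4 : 1 <= 4 ^+ m.+1 :> R by rewrite exprn_ege1 // ler1n.
    have x1 : m.+1%:R / 2 ^+ m.+1 <= 1 :> R by rewrite ler_pdivrMr // mul1r.
    have x0 : 0 <= m.+1%:R / 2 ^+ m.+1 :> R by rewrite divr_ge0 // ltW.
    have y0 : 0 <= 2 * nrm z / 2 ^+ m.+1 by rewrite divr_ge0 ?mulr_ge0 // ltW.
    have -> : m.+1%:R * (2 * nrm z / 64 ^+ m.+1 * 4 ^+ m.+1) =
        (m.+1%:R / 2 ^+ m.+1) * (2 * nrm z / 2 ^+ m.+1) / 4 ^+ m.+1.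
      have -> : 64 = 2 * 2 * (4 * 4) :> R by rewrite -!natrM.
      rewrite !exprMn; field; rewrite !gt_eqF //; lra.
    rewrite exprVn ler_pdivrMr; last by lra.
    apply: le_trans (ler_piMl y0 x1) _; exact: ler_peMr.
  have {h1 h2 e1} := le_trans h1 e1; rewrite [2^-1 ^+ m.+1]exprS.
  have := geo_gt0 R m; have : 0 <= nrm z * 2^-1 ^+ m.
    by rewrite mulr_ge0 ?exprn_ge0 ?invr_ge0.
  by lra.
have hE0 i : o i != 0 -> ip (E i) z = 0.
  move=> oi; have : wa i * ip (E i) z = 0.
    apply: eq0_normc; apply/eqP; rewrite eq_le normc_ge0 andbT.
    apply: le_eps => e e0; have [N hN] := geo_small (4 * nrm z) e0.
    by apply: le_trans (hd _ _ oi (leq_maxr N i)) (ltW (hN _ (leq_maxl _ _))).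
  by move/eqP; rewrite mulf_eq0 (negbTE (hwa1 oi)) => /eqP.
apply: hcls => [k|k|i oi|x hx]; apply: (ip_eq0C hip); [exact: hPz| |exact: hE0|exact: hRz].
(* With the node and [P] coordinates of [z] gone, (X_k, z) = 0 reduces to the [Q k] term, whose
   coefficient is nonzero by [res_Q]. *)
have [hO AO hP hX _ _ hXQ _ _] := hY k.
have cOz w : (forall i, o i != 0 -> ip (E i) w = 0) -> ip (Y k).1.1 w = 0.
  move=> h; apply: (hser_ip0 hip hO) => i; rewrite (ipZl hip).
  by have [oi|oi] := eqVneq (o i) 0; [rewrite hwa0 // !mul0r|rewrite h // mulr0].
have := hYz k; have := hXQ; rewrite hX !(ipBl hip) !(ipDl hip) !(ipZl hip).
rewrite (cOz z hE0) (cOz (Q k) (fun i _ => hEQ i k)) (hP z hPz) (hP (Q k) (hPQ ^~ k)).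
rewrite hQQ eqxx mulr1 add0r !sub0r oppr_eq0 => h1 /eqP.
by rewrite oppr_eq0 mulf_eq0 (negbTE h1) => /eqP.
Qed.

End Half.

(** * The orthogonal complement of the root vectors *)

Section Neumann.
Variables (R : realType) (V : lmodType R[i]) (ip : V -> V -> R[i]).
Hypothesis hip : is_inner_product ip.
Hypothesis hcpl : hcomplete ip.
Local Notation nrm := (nrm ip).
Variables F G f g : nat -> V.
Hypotheses (hF : forall k, nrm (F k) = 1) (hG : forall k, nrm (G k) = 1)
  (hf : forall k, nrm (f k) <= 2^-1 ^+ (k + 3)) (hg : forall k, nrm (g k) <= 2^-1 ^+ (k + 3)).

(** For f_k = P_k - t X_k with t nonzero, x is orthogonal to X_k exactly when (x, P_k) = (x, f_k);
    likewise for g_k, Q_k and Y_k. Orthogonality to all X_k and Y_k thus becomes the equation x = v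
    + sum of [u x k], with v the part of x orthogonal to all P_k and Q_k. *)
Let u x k := ip x (f k) *: F k + ip x (g k) *: G k.

Lemma neumann_term x k : nrm (u x k) <= nrm x / 4 * 2^-1 ^+ k.
Proof.
have e : 2^-1 ^+ (k + 3) = 2^-1 ^+ k / 8 :> R.
  by rewrite exprD; congr (_ * _); rewrite exprVn -natrX.
have hx := nrm_ge0 ip x.
have h (y : V) : nrm y <= 2^-1 ^+ (k + 3) -> normc (ip x y) <= nrm x * (2^-1 ^+ k / 8).
  by rewrite e => hy; apply: le_trans (cauchy_schwarz hip _ _) _; apply: ler_wpM2l.
apply: le_trans (nrmD hip _ _) _; rewrite !(nrmZ hip) hF hG !mulr1.
by have := h _ (hf k); have := h _ (hg k); lra.
Qed.

(** Two families with weights 2^-(k+3) sum to 1/2, the contraction constant. *)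
Lemma neumann_op : exists2 Gam : V -> V, forall x, hser ip (u x) (Gam x) &
  forall x, nrm (Gam x) <= nrm x / 2.
Proof.
have /choice[Gam hGam] : forall x, exists y, hser ip (u x) y.
  by move=> x; have [y hy _] := hser_geom hip hcpl (neumann_term x); exists y.
exists Gam => // x; have := hser_bound hip (neumann_term x) (hGam x); lra.
Qed.

Lemma neumann_solve v : exists x y, hser ip (u x) y /\ x = v + y.
Proof.
have [Gam hG1 hG2] := neumann_op.
have linG : is_linear_op Gam.
  move=> a x y; apply: (hser_unique hip (hG1 _)).
  have := hserD hip (hserZ hip a (hG1 x)) (hG1 y); apply: (hser_ext hip) => k.
  by rewrite /u !(ipDl hip) !(ipZl hip) !scalerDl scalerDr !scalerA addrACA.
have bG : bounded_op ip Gam.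
  split=> //; exists (2^-1)%:C => x; rewrite !hnormE // -realcM lecR mulrC.
  exact: hG2.
pose w := fix w n := if n is m.+1 then v + Gam (w m) else v.
have hw n : nrm (w n.+1 - w n) <= nrm (Gam v) * 2^-1 ^+ n.
  elim: n => [|n IH]; first by rewrite /= addrAC subrr add0r mulr1.
  rewrite [w n.+2]/= [in X in _ - X]/= opprD addrACA subrr add0r -(linB linG).
  by apply: le_trans (hG2 _) _; rewrite exprS; move: IH; rewrite /=; lra.
have [x hx _] := cauchy_geom hip hcpl hw.
exists x, (Gam x); split=> //; apply: (hconv_unique hip (u := fun n => w n.+1)).
  exact: (hconv_sub (phi := S) hip _ hx).
exact: hconvD (hconv_const hip v) (hconv_lin hip bG hx).
Qed.

Lemma neumann_unique x : hser ip (u x) x -> x = 0.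
Proof.
move=> h; apply: (nrm_eq0 hip); have := hser_bound hip (neumann_term x) h.
by have := nrm_ge0 ip x; lra.
Qed.

End Neumann.

(** * Scales read off from the selected eigenvalues *)

Section ScalesOfSequence.
Variables (R : realType) (r : nat -> R).
Hypotheses (r0 : forall n, 0 < `|r n|) (r00 : `|r 0%N| < 128^-1 ^+ 20)
  (rS : forall n, `|r n.+1| < (`|r n| / 128) ^+ (2 * n + 20)).

Lemma seq_le1 n : `|r n| <= 1.
Proof.
elim: n => [|n IH].
  by apply: le_trans (ltW r00) _; rewrite exprn_ile1 ?invr_ge0 // invf_le1 // ler1n.
apply: le_trans (ltW (rS n)) _; apply: exprn_ile1; first by rewrite divr_ge0.
by lra.
Qed.

Lemma seq_pow n m : (m <= 2 * n + 20)%N -> `|r n.+1| <= (`|r n| / 128) ^+ m.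
Proof.
move=> h; apply: le_trans (ltW (rS n)) _; apply: ler_wiXn2l => //.
  by rewrite divr_ge0.
by have := seq_le1 n; have := r0 n; lra.
Qed.

Lemma seq_ltS n : `|r n.+1| < `|r n|.
Proof.
apply: le_lt_trans (seq_pow (m := 1) _) _; first by rewrite addnC.
by rewrite expr1; have := r0 n; lra.
Qed.

Lemma seq_dec i j : (i < j)%N -> `|r j| < `|r i|.
Proof.
elim: j => // j IH; rewrite ltnS leq_eqVlt => /orP[/eqP ->|/IH]; first exact: seq_ltS.
exact: lt_trans (seq_ltS j).
Qed.

Lemma seq_inj i j : i != j -> r i != r j.
Proof.
by move=> h; apply/eqP => e; have [/seq_dec|/seq_dec|/eqP] := ltngtP i j;
  rewrite ?e ?ltxx // (negbTE h).
Qed.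

(** Every block has a node slot, hence a value of [rhoS], although only the blocks 2^i may carry a
    node. *)
Definition rhoS k := `|r (3 * k)%N|.
Definition TS k := `|r (3 * k).+1|.
Definition sgS k := `|r (3 * k).+2|.

Lemma sgTS k : sgS k <= TS k. Proof. exact: ltW (seq_ltS _). Qed.

(** The exponent 2 n + 20 of the decay has to cover the step from rho_k to T_k, here at n = 3 k, and
    in [exponent_rho] the step to the next block, at n = 3 k + 2. *)
Lemma exponent_T4 k : ((k + 8) + 4 <= 2 * (3 * k) + 20)%N. Proof. lia. Qed.
Lemma exponent_rho k : (k.+2 + k.+2 + (k + 8) <= 2 * (3 * k).+2 + 20)%N. Proof. lia. Qed.

Lemma pow128 (x : R) m : 0 <= x <= 1 -> (x / 128) ^+ m <= (64 ^+ m)^-1.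
Proof.
move=> /andP[x0 x1]; rewrite -exprVn lerXn2r ?nnegrE ?divr_ge0 ?invr_ge0 //; lra.
Qed.

Lemma TrhoS k : TS k <= rhoS k ^+ 4 / 64 ^+ (k + 8).
Proof.
rewrite /TS /rhoS; apply: le_trans (seq_pow (exponent_T4 k)) _.
have x0 := normr_ge0 (r (3 * k)%N); have x1 := seq_le1 (3 * k).
rewrite exprD mulrC; apply: ler_pM; rewrite ?exprn_ge0 ?divr_ge0 //.
  by rewrite lerXn2r ?nnegrE ?divr_ge0 //; lra.
by apply: pow128; rewrite x0.
Qed.

Lemma rhowS k : rhoS k <= wo sgS k ^+ 2 / 64 ^+ (k + 7).
Proof.
(* Block 0 has no predecessor; the bound on [r 0] replaces the decay. *)
case: k => [|k]; rewrite /rhoS.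
  rewrite muln0; apply: le_trans (ltW r00) _ => /=.
  have e128 : 128^-1 = 2^-1 ^+ 7 :> R by rewrite exprVn -natrX.
  have e64 : 64^-1 = 2^-1 ^+ 6 :> R by rewrite exprVn -natrX.
  rewrite add0n -[(64 ^+ 7)^-1]exprVn e128 e64 -!exprM -exprD.
  by apply: ler_wiXn2l; rewrite ?invr_ge0 ?invf_le1 ?ler1n.
have -> : (3 * k.+1 = (3 * k).+3)%N by rewrite mulnS.
apply: le_trans (seq_pow (exponent_rho k)) _.
have x0 := normr_ge0 (r (3 * k).+2); have x1 := seq_le1 (3 * k).+2.
have -> : (k.+1 + 7 = k + 8)%N by rewrite addSnnS.
rewrite exprD; apply: ler_pM.
- by rewrite exprn_ge0 // divr_ge0.
- by rewrite exprn_ge0 // divr_ge0.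
- by rewrite /= /sgS -exprM muln2 addnn.
by apply: pow128; rewrite x0.
Qed.

End ScalesOfSequence.

Lemma index_EP i j : (3 * 2 ^ i == (3 * j).+2)%N = false. Proof. lia. Qed.
Lemma index_EQ i j : (3 * 2 ^ i == (3 * j).+1)%N = false. Proof. lia. Qed.
Lemma index_PQ i j : ((3 * i).+2 == (3 * j).+1)%N = false. Proof. lia. Qed.
Lemma index_EE i j : (3 * 2 ^ i == 3 * 2 ^ j)%N = (i == j).
Proof. by rewrite eqn_pmul2l // eqn_exp2l. Qed.
Lemma index_QQ i j : ((3 * i).+1 == (3 * j).+1)%N = (i == j). Proof. lia. Qed.
Lemma index_PP i j : ((3 * i).+2 == (3 * j).+2)%N = (i == j). Proof. lia. Qed.
Lemma exponent_small K : (2 * K + 3 <= 6 * (2 ^ K + 7))%N.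
Proof. by have := @ltn_expl 2 K isT; lia. Qed.
Lemma exponent_node i : (i.+2 + i <= 6 * (2 ^ i + 7))%N.
Proof. by have := @ltn_expl 2 i isT; lia. Qed.

Lemma subrBB (U : zmodType) (a b c d : U) : a - b - (c - d) = (a - c) - (b - d).
Proof. by rewrite [in LHS]opprD [in RHS]opprD !opprK addrACA. Qed.

(** * The perturbation *)

Section Construction.
Variables (R : realType) (V : lmodType R[i]) (ip : V -> V -> R[i]) (A : V -> V).
Hypotheses (hip : is_inner_product ip) (hcpl : hcomplete ip).
Hypotheses (hA : compact_op ip A) (hs : self_adjoint ip A)
  (hsim : simple_spectrum A) (hk : trivial_kernel A).
Variables (r : nat -> R) (e : nat -> V).
Hypotheses (he1 : forall n, nrm ip (e n) = 1) (he2 : forall n, A (e n) = (r n)%:C *: e n)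
  (r0 : forall n, 0 < `|r n|) (r00 : `|r 0%N| < 128^-1 ^+ 20)
  (rS : forall n, `|r n.+1| < (`|r n| / 128) ^+ (2 * n + 20)).
Variable N : option nat.

Let hbd : bounded_op ip A. Proof. by case: hA. Qed.
Local Notation rho := (rhoS r).
Local Notation T := (TS r).
Local Notation sg := (sgS r).

Definition evP k := e (3 * k).+2.
Definition evQ k := e (3 * k).+1.
Definition evE i := e (3 * 2 ^ i)%N.
Definition lamP k := r (3 * k).+2.
Definition lamQ k := r (3 * k).+1.
Definition active i := if N is Some n then (i < n)%N else true.
(* For finite [N] the data are padded by zeros: a zero node stands for no node at
   all, and the corresponding [E i] is then an ordinary eigenvector of [A]. *)
Definition node i : R[i] := if active i then (r (3 * 2 ^ i)%N)%:C else 0.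
Definition wgt i : R[i] := if active i then (wo sg (2 ^ i))%:C else 0.

Local Notation P := evP.
Local Notation Q := evQ.
Local Notation E := evE.
Local Notation p := lamP.
Local Notation q := lamQ.
Local Notation o := node.
Local Notation wa := wgt.

Lemma rho0 k : 0 < rho k. Proof. exact: r0. Qed.
Lemma sg0 k : 0 < sg k. Proof. exact: r0. Qed.
Lemma sgT k : sg k <= T k. Proof. exact: (sgTS r0 r00 rS). Qed.
Lemma Trho k : T k <= rho k ^+ 4 / 64 ^+ (k + 8). Proof. exact: (TrhoS r0 r00 rS). Qed.
Lemma rhow k : rho k <= wo sg k ^+ 2 / 64 ^+ (k + 7). Proof. exact: (rhowS r0 r00 rS). Qed.

Lemma e_orth i j : ip (e i) (e j) = (i == j)%:R.
Proof.
have [->|h] := eqVneq i j; first by rewrite (ip_sqn hip) -(nrm_sq hip) he1 expr1n.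
apply: (eig_orth hip hs (he2 i) (he2 j)); apply/eqP => -[].
by apply/eqP; apply: (seq_inj r0 r00 rS).
Qed.

Lemma hEE i j : ip (E i) (E j) = (i == j)%:R. Proof. by rewrite e_orth index_EE. Qed.
Lemma hPP i j : ip (P i) (P j) = (i == j)%:R. Proof. by rewrite e_orth index_PP. Qed.
Lemma hQQ i j : ip (Q i) (Q j) = (i == j)%:R. Proof. by rewrite e_orth index_QQ. Qed.
Lemma hEP i j : ip (E i) (P j) = 0. Proof. by rewrite e_orth index_EP. Qed.
Lemma hEQ i j : ip (E i) (Q j) = 0. Proof. by rewrite e_orth index_EQ. Qed.
Lemma hPQ i j : ip (P i) (Q j) = 0. Proof. by rewrite e_orth index_PQ. Qed.
Lemma hQP i j : ip (Q i) (P j) = 0. Proof. by rewrite (ip_eq0C hip (hPQ j i)). Qed.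

Lemma e_neq0 n : e n != 0.
Proof. by apply/eqP => h; have := he1 n; rewrite h (nrm0 hip) => /eqP; rewrite eq_sym oner_eq0. Qed.

Lemma r_neq0 n : (r n)%:C != 0 :> R[i]. Proof. by rewrite realc_eq0 -normr_gt0. Qed.

Lemma node_neq0 i : (o i != 0) = active i.
Proof. by rewrite /o; case: (active i); rewrite ?r_neq0 ?eqxx. Qed.

Lemma nodeE i : o i != 0 -> o i = (r (3 * 2 ^ i)%N)%:C.
Proof. by rewrite node_neq0 /o => ->. Qed.

Lemma node_conj i : (o i)^* = o i.
Proof. by rewrite /o; case: (active i); rewrite ?conjc_real ?rmorph0. Qed.

Lemma hAE i : o i != 0 -> A (E i) = o i *: E i. Proof. by move=> /nodeE ->; apply: he2. Qed.
Lemma hAP k : A (P k) = (p k)%:C *: P k. Proof. exact: he2. Qed.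
Lemma hAQ k : A (Q k) = (q k)%:C *: Q k. Proof. exact: he2. Qed.
Lemma ho i : o i != 0 -> normc (o i) = rho (2 ^ i).
Proof. by move=> /nodeE ->; rewrite normc_real. Qed.
Lemma hp k : sg k <= `|p k| <= T k. Proof. by rewrite lexx; apply: sgT. Qed.
Lemma hq k : sg k <= `|q k| <= T k. Proof. by rewrite lexx andbT; apply: sgT. Qed.
Lemma hpq k : p k != q k. Proof. by apply: (seq_inj r0 r00 rS); rewrite index_PQ. Qed.
Lemma hqp k : q k != p k. Proof. by rewrite eq_sym hpq. Qed.

Lemma wo0 k : 0 < wo sg k. Proof. exact: (wo_gt0 sg0). Qed.
Lemma wo128 k : wo sg k <= 128^-1. Proof. exact: (wo_le128 rho0 sg0 sgT Trho rhow). Qed.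

Lemma hwa i : normc (wa i) <= wo sg (2 ^ i).
Proof.
rewrite /wa; case: (active i); first by rewrite normc_real gtr0_norm ?wo0.
by rewrite normc0 ltW // wo0.
Qed.

Lemma hwa0 i : o i = 0 -> wa i = 0.
Proof. by move/eqP; apply: contraTeq; rewrite /wa node_neq0; case: (active i) => //; rewrite eqxx. Qed.

Lemma hwa1 i : o i != 0 -> wa i != 0.
Proof. by rewrite node_neq0 /wa => ->; rewrite realc_eq0 gt_eqF // wo0. Qed.

Lemma wgt_normc i : o i != 0 -> normc (wa i) = wo sg (2 ^ i).
Proof. by rewrite node_neq0 /wa => ->; rewrite normc_real gtr0_norm // wo0. Qed.

Lemma inv64 n : (64 ^+ n)^-1 = 2^-1 ^+ (6 * n) :> R.
Proof. by rewrite exprM -exprVn; congr (_ ^+ _); rewrite exprVn -natrX. Qed.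

Lemma hsmall i K : (i <= K)%N -> o i != 0 ->
  normc (o K) <= normc (wa i) * 2^-1 ^+ (2 * K + 3).
Proof.
move=> hi oi; rewrite wgt_normc //; have w0 := wo0 (2 ^ i).
have [->|oK] := eqVneq (o K) 0.
  by rewrite normc0 mulr_ge0 ?exprn_ge0 ?invr_ge0 // ltW.
rewrite ho //; apply: le_trans (rhow _) _; rewrite inv64; apply: ler_pM.
- exact: sqr_ge0.
- by rewrite exprn_ge0 ?invr_ge0.
- apply: le_trans (_ : wo sg (2 ^ K) <= _).
    by have := wo0 (2 ^ K); have := wo128 (2 ^ K) => *; rewrite expr2 ler_piMr //; lra.
  by apply: (wo_mono rho0 sg0 sgT Trho rhow); rewrite leq_exp2l.
by rewrite ler_wiXn2l ?invr_ge0 ?invf_le1 ?ler1n // exponent_small.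
Qed.

Lemma node_geo i : normc (o i) <= 2^-1 ^+ i.+2 * 2^-1 ^+ i.
Proof.
have [->|oi] := eqVneq (o i) 0; first by rewrite normc0 mulr_ge0 ?exprn_ge0 ?invr_ge0.
rewrite ho //; apply: le_trans (rhow _) _; rewrite inv64 -exprD.
apply: (@le_trans _ _ (1 * 2^-1 ^+ (6 * (2 ^ i + 7)))).
  rewrite ler_wpM2r ?exprn_ge0 ?invr_ge0 //; have := wo0 (2 ^ i); have := wo128 (2 ^ i).
  by move=> *; apply: exprn_ile1; lra.
by rewrite mul1r ler_wiXn2l ?invr_ge0 ?invf_le1 ?ler1n // exponent_node.
Qed.

Definition rest x := rest_vec ip A E P Q o x.

(** By simplicity of the spectrum an eigenvector of A that is not orthogonal to some chosen e_n is a
    multiple of it; all others satisfy [rest]. *)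
Lemma hcls z : (forall k, ip z (P k) = 0) -> (forall k, ip z (Q k) = 0) ->
  (forall i, o i != 0 -> ip z (E i) = 0) -> (forall x, rest x -> ip z x = 0) -> z = 0.
Proof.
move=> hzP hzQ hzE hzR; apply: (eig_complete hip hA hs hk) => mu x hx.
have key n : ip z (e n) = 0 -> ip (e n) x != 0 -> ip z x = 0.
  move=> h1 h2; have [hm|hm] := eqVneq (r n)%:C mu; last first.
    by rewrite (eig_orth hip hs (he2 n) hx hm) eqxx in h2.
  rewrite -hm in hx; have [c ->] := hsim (he2 n) hx (e_neq0 n).
  by rewrite (ipZr hip) h1 mulr0.
have [[k hk']|hP] := pselect (exists k, ip (P k) x != 0); first exact: key (hzP k) hk'.
have [[k hk']|hQ] := pselect (exists k, ip (Q k) x != 0); first exact: key (hzQ k) hk'.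
have [[k [ok hk']]|hE] := pselect (exists k, o k != 0 /\ ip (E k) x != 0).
  exact: key (hzE k ok) hk'.
apply: hzR; split; first by exists mu.
split=> [k|k|i oi]; apply/eqP; rewrite -[_ == _]negbK; apply/negP => h.
- by apply: hP; exists k.
- by apply: hQ; exists k.
- by apply: hE; exists i.
Qed.

Lemma rest_swap x : rest_vec ip A E Q P o x <-> rest x.
Proof. by split=> -[h1 [h2 h3 h4]]. Qed.

Lemma hcls_swap z : (forall k, ip z (Q k) = 0) -> (forall k, ip z (P k) = 0) ->
  (forall i, o i != 0 -> ip z (E i) = 0) ->
  (forall x, rest_vec ip A E Q P o x -> ip z x = 0) -> z = 0.
Proof. by move=> h1 h2 h3 h4; apply: hcls => // x /rest_swap; apply: h4. Qed.

Definition beta_spec (b : V) :=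
  [/\ forall i, normc (ip b (E i)) * normc (wa i) <= 2 * normc (o i),
      forall i, o i != 0 -> ip b (E i) != 0,
      forall z, (forall i, o i != 0 -> ip (E i) z = 0) -> ip b z = 0 &
      forall lam c n, lam != 0 -> (forall i, lam != o i) ->
        (forall i, o i != 0 -> ip c (E i) * (o i - lam) = wa i) ->
        (forall i, (n <= i)%N -> normc (o i) <= normc lam * 2^-1 ^+ i.+2) ->
        2^-1 <= normc ((1 + ip c b) * \prod_(i < n) (1 - o i / lam)) <= 2].

Lemma beta_exists : exists b, beta_spec b.
Proof.
apply: (beta_vector hip hcpl hEE _ hsmall hwa1) => i j hij oi.
exact: (nodes_dec rho0 sg0 sgT Trho rhow ho hij oi).
Qed.

Lemma series_exist : exists aO aP bQ : V,
  [/\ hser ip (fun i => wa i *: E i) aO,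
      hser ip (fun k => (rho k ^+ 2)%:C *: P k) aP &
      hser ip (fun k => (rho k ^+ 2)%:C *: Q k) bQ].
Proof.
have wgeo k : wo sg k <= 2^-1 ^+ k := wo_geo rho0 sg0 sgT Trho rhow k.
have hO i : nrm ip (wa i *: E i) <= 1 * 2^-1 ^+ i.
  rewrite (nrmZ hip) he1 mulr1 mul1r; apply: le_trans (hwa i) _.
  apply: le_trans (wgeo _) _; rewrite ler_wiXn2l ?invr_ge0 ?invf_le1 ?ler1n //.
  by rewrite ltnW // ltn_expl.
have hPQ2 n k : nrm ip ((rho k ^+ 2)%:C *: e n) <= 1 * 2^-1 ^+ k.
  rewrite (nrmZ hip) he1 mulr1 mul1r normc_real ger0_norm ?sqr_ge0 //.
  apply: le_trans (wgeo k); apply: le_trans (rho_le_wo rho0 sg0 sgT Trho rhow k).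
  rewrite expr2; apply: ler_piMr; [exact: ltW (rho0 k)|exact: (seq_le1 r00 rS)].
have [aO haO _] := hser_geom hip hcpl hO.
have [aP haP _] := hser_geom hip hcpl (fun k => hPQ2 (3 * k).+2 k).
have [bQ hbQ _] := hser_geom hip hcpl (fun k => hPQ2 (3 * k).+1 k).
by exists aO, aP, bQ.
Qed.

Section Perturbation.
Variables aO aP bO bQ : V.
Hypotheses
  (haO : hser ip (fun i => wa i *: E i) aO)
  (haP : hser ip (fun k => (rho k ^+ 2)%:C *: P k) aP)
  (hbQ : hser ip (fun k => (rho k ^+ 2)%:C *: Q k) bQ)
  (hb : beta_spec bO).

Local Notation wb i := (ip bO (E i)).

Lemma bO_orth z : (forall i, o i != 0 -> ip (E i) z = 0) -> ip bO z = 0.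
Proof. by have [_ _ h _] := hb; apply: h. Qed.

Lemma hbOP k : ip (P k) bO = 0.
Proof. by apply: (ip_eq0C hip); apply: bO_orth => i _; apply: hEP. Qed.

Lemma hbOQ k : ip (Q k) bO = 0.
Proof. by apply: (ip_eq0C hip); apply: bO_orth => i _; apply: hEQ. Qed.

Lemma aO_orth z : (forall i, o i != 0 -> ip (E i) z = 0) -> ip aO z = 0.
Proof.
move=> hz; apply: (hser_ip0 hip haO) => i; rewrite (ipZl hip).
by have [oi|oi] := eqVneq (o i) 0; [rewrite hwa0 // mul0r|rewrite hz // mulr0].
Qed.

Lemma haOP k : ip (P k) aO = 0.
Proof. by apply: (ip_eq0C hip); apply: aO_orth => i _; apply: hEP. Qed.

Lemma haOQ k : ip (Q k) aO = 0.
Proof. by apply: (ip_eq0C hip); apply: aO_orth => i _; apply: hEQ. Qed.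

Lemma aP_orth z : (forall k, ip (P k) z = 0) -> ip aP z = 0.
Proof. by move=> hz; apply: (hser_ip0 hip haP) => k; rewrite (ipZl hip) hz mulr0. Qed.

Lemma bQ_orth z : (forall k, ip (Q k) z = 0) -> ip bQ z = 0.
Proof. by move=> hz; apply: (hser_ip0 hip hbQ) => k; rewrite (ipZl hip) hz mulr0. Qed.

Lemma ip_aO_E i : ip aO (E i) = wa i.
Proof.
apply: (hser_ip (k := i) hip haO) => [j hj|]; rewrite (ipZl hip) hEE.
  by rewrite (negbTE hj) mulr0.
by rewrite eqxx mulr1.
Qed.

Lemma ip_aP_P k : ip aP (P k) = (rho k ^+ 2)%:C.
Proof.
apply: (hser_ip (k := k) hip haP) => [j hj|]; rewrite (ipZl hip) hPP.
  by rewrite (negbTE hj) mulr0.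
by rewrite eqxx mulr1.
Qed.

Lemma ip_bQ_Q k : ip bQ (Q k) = (rho k ^+ 2)%:C.
Proof.
apply: (hser_ip (k := k) hip hbQ) => [j hj|]; rewrite (ipZl hip) hQQ.
  by rewrite (negbTE hj) mulr0.
by rewrite eqxx mulr1.
Qed.

Lemma hwb0 i : o i = 0 -> wb i = 0.
Proof.
move=> oi; apply: bO_orth => j oj; rewrite hEE; case: eqVneq => // h.
by rewrite h oi eqxx in oj.
Qed.

Lemma hwb1 i : o i != 0 -> wb i != 0.
Proof. by have [_ h _ _] := hb; apply: h. Qed.

(** Here the square of [wo] in [rhow] pays off: dividing the node size by one [wo] still leaves the
    bound required of [wa], so [Half] applies to the adjoint. *)
Lemma hwb i : normc (wb i) <= wo sg (2 ^ i).
Proof.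
have w0 := wo0 (2 ^ i); have [oi|oi] := eqVneq (o i) 0.
  by rewrite hwb0 // normc0 ltW.
have [h _ _ _] := hb; have := h i; rewrite wgt_normc // ho // => {}h.
rewrite -(ler_pM2r w0); apply: le_trans h _; have := rhow (2 ^ i).
have : (64 ^+ (2 ^ i + 7))^-1 <= 2^-1 :> R.
  rewrite inv64 -[leRHS]expr1; apply: ler_wiXn2l; rewrite ?invr_ge0 ?invf_le1 ?ler1n //.
  by rewrite addnC.
move=> /(ler_wpM2l (sqr_ge0 (wo sg (2 ^ i)))); rewrite !expr2; lra.
Qed.

(** [beta_vector] yields bO as a limit of vectors with changing coefficients, while [Half] wants a
    series for the adjoint. The difference of the two is orthogonal to the complete system of
    [hcls]. *)
Lemma hbO : hser ip (fun i => wb i *: E i) bO.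
Proof.
have hO i : nrm ip (wb i *: E i) <= 1 * 2^-1 ^+ i.
  rewrite (nrmZ hip) he1 mulr1 mul1r; apply: le_trans (hwb i) _.
  apply: le_trans (wo_geo rho0 sg0 sgT Trho rhow _) _.
  rewrite ler_wiXn2l ?invr_ge0 ?invf_le1 ?ler1n //.
  by rewrite ltnW // ltn_expl.
have [s hs' _] := hser_geom hip hcpl hO.
suff /eqP : bO - s = 0 by rewrite subr_eq0 => /eqP {2}->.
have s_orth z : (forall i, o i != 0 -> ip (E i) z = 0) -> ip s z = 0.
  move=> hz; apply: (hser_ip0 hip hs') => i; rewrite (ipZl hip).
  by have [oi|oi] := eqVneq (o i) 0; [rewrite hwb0 // mul0r|rewrite hz // mulr0].
apply: hcls => [k|k|i oi|x [_ [_ _ h]]]; rewrite (ipBl hip).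
- by rewrite bO_orth ?s_orth ?subr0 // => i _; apply: hEP.
- by rewrite bO_orth ?s_orth ?subr0 // => i _; apply: hEQ.
- rewrite (hser_ip (k := i) (c := wb i) hip hs') ?subrr // => [j hj|].
    by rewrite (ipZl hip) hEE (negbTE hj) mulr0.
  by rewrite (ipZl hip) hEE eqxx mulr1.
- by rewrite bO_orth ?s_orth ?subr0.
Qed.

Lemma res_coord lam c i : A c - lam *: c = aO -> o i != 0 -> ip c (E i) * (o i - lam) = wa i.
Proof.
move=> hc oi; rewrite -ip_aO_E -hc (ipBl hip) hs hAE // (ipZr hip) node_conj (ipZl hip).
by rewrite mulrBr mulrC [ip c _ * lam]mulrC.
Qed.

Lemma beta_real (s : R) k c n : sg k <= `|s| -> (forall i, s != r (3 * 2 ^ i)%N) ->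
  A c - s%:C *: c = aO -> (forall i, (n <= i)%N -> (k < 2 ^ i)%N) ->
  2^-1 <= normc ((1 + ip c bO) * \prod_(i < n) (1 - o i / s%:C)) <= 2.
Proof.
move=> hsk hne hc hn; have s0 : s != 0 by rewrite -normr_gt0 (lt_le_trans (sg0 k)).
have [_ _ _ h] := hb; apply: h.
- by rewrite realc_eq0.
- move=> i; have [->|oi] := eqVneq (o i) 0; first by rewrite realc_eq0.
  by rewrite nodeE //; apply: contra (hne i) => /eqP[->].
- by move=> i oi; apply: res_coord.
move=> i hi; have [->|oi] := eqVneq (o i) 0.
  by rewrite normc0 mulr_ge0 ?normc_ge0 ?exprn_ge0 ?invr_ge0.
rewrite ho // normc_real; apply: le_trans (rho_lt rho0 sg0 sgT Trho rhow (hn i hi)) _.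
apply: ler_pM => //; first exact: ltW (sg0 k).
  by rewrite exprn_ge0 ?invr_ge0.
by rewrite ler_wiXn2l ?invr_ge0 ?invf_le1 ?ler1n // pow2_exponent.
Qed.

Lemma beta_q k c n : A c - (q k)%:C *: c = aO -> (forall i, (n <= i)%N -> (k < 2 ^ i)%N) ->
  2^-1 <= normc ((1 + ip c bO) * \prod_(i < n) (1 - o i / (q k)%:C)) <= 2.
Proof.
move=> hc hn; apply: (beta_real _ _ hc hn); first by case/andP: (hq k).
by move=> i; apply: (seq_inj r0 r00 rS); rewrite eq_sym index_EQ.
Qed.

(* The adjoint has the conjugate characteristic function:
   [(c', aO) = (c', (A - p) c) = ((A - p) c', c) = (bO, c)]. *)
Lemma beta_p k c n : A c - (p k)%:C *: c = bO -> (forall i, (n <= i)%N -> (k < 2 ^ i)%N) ->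
  2^-1 <= normc ((1 + ip c aO) * \prod_(i < n) (1 - o i / (p k)%:C)) <= 2.
Proof.
move=> hc hn.
have [d hd _] := resO hip hcpl rho0 sg0 sgT Trho rhow hEE ho hp hwa hwa0 k.
have {}hd := resO_eq hip hbd rho0 sg0 sgT Trho rhow hAE ho hp hwa0 haO hd.
have -> : 1 + ip c aO = (1 + ip d bO)^*.
  rewrite conj1D -(ipC hip) -hc -hd; congr (1 + _).
  by rewrite (ipBl hip) (ipBr hip) (ipZl hip) (ipZr hip) conjc_real hs.
rewrite normcM normc_conj -normcM; apply: (beta_real _ _ hd hn).
  by case/andP: (hp k).
by move=> i; apply: (seq_inj r0 r00 rS); rewrite eq_sym index_EP.
Qed.

Local Notation specX k Y := (res_spec ip A rho E P Q o wa q aO aP bO bQ k Y.1.1 Y.1.2 Y.2).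
Local Notation specY k Y :=
  (res_spec ip A rho E Q P o (fun i => wb i) p bO bQ aO aP k Y.1.1 Y.1.2 Y.2).

Lemma X_exists : exists X : nat -> V * V * V, forall k, specX k (X k).
Proof.
have /choice[X hX] := res_exists hip hcpl hbd rho0 sg0 sgT Trho rhow hEE hPP hQQ
  hEQ hPQ hAE hAP hAQ ho hp hq hpq hwa hwa0 haO haP hbQ hbOP hbOQ beta_q.
by exists X.
Qed.

Lemma Y_exists : exists Y : nat -> V * V * V, forall k, specY k (Y k).
Proof.
have /choice[Y hY] := res_exists hip hcpl hbd rho0 sg0 sgT Trho rhow hEE hQQ hPP
  hEP hQP hAE hAQ hAP ho hq hp hqp hwb hwb0 hbO hbQ haP haOQ haOP beta_p.
by exists Y.
Qed.

Lemma X_complete (X : nat -> V * V * V) z : (forall k, specX k (X k)) ->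
  (forall k, ip (X k).2 z = 0) -> (forall k, ip (P k) z = 0) ->
  (forall x, rest x -> ip x z = 0) -> z = 0.
Proof.
move=> hX; apply: (half_complete hip rho0 sg0 sgT Trho rhow hEE hQQ hEQ hPQ ho hq
  hwa hwa0 hwa1 beta_q hcls hX).
Qed.

Lemma Y_complete (Y : nat -> V * V * V) z : (forall k, specY k (Y k)) ->
  (forall k, ip (Y k).2 z = 0) -> (forall k, ip (Q k) z = 0) ->
  (forall x, rest x -> ip x z = 0) -> z = 0.
Proof.
move=> hY h1 h2 h3; apply: (half_complete hip rho0 sg0 sgT Trho rhow hEE hPP hEP hQP ho hp
  hwb hwb0 hwb1 beta_p hcls_swap hY h1 h2) => x /rest_swap; exact: h3.
Qed.

(** * The operator L: eigenvectors, spectrum and failure of synthesis *)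

Section Operator.
Variables X Y : nat -> V * V * V.
Hypotheses (hX : forall k, specX k (X k)) (hY : forall k, specY k (Y k)).
Local Notation x k := (X k).2.
Local Notation y k := (Y k).2.
Local Notation aa := (aO + aP).
Local Notation bb := (bO + bQ).

Definition pert v := A v + rank_one ip aa bb v.
Definition pert_adj v := A v + rank_one ip bb aa v.
Local Notation L := pert.
Local Notation Ls := pert_adj.

Lemma rest_b v : rest v -> ip v bb = 0.
Proof.
by move=> [_ [_ h1 h2]]; apply: (ip_eq0C hip); rewrite (ipDl hip) bO_orth // bQ_orth // addr0.
Qed.

Lemma rest_a v : rest v -> ip v aa = 0.
Proof.
by move=> [_ [h1 _ h2]]; apply: (ip_eq0C hip); rewrite (ipDl hip) aO_orth // aP_orth // addr0.
Qed.

Lemma P_b k : ip (P k) bb = 0.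
Proof.
rewrite (ipDr hip) hbOP add0r; apply: (ip_eq0C hip); apply: bQ_orth => j; exact: hQP.
Qed.

Lemma Q_a k : ip (Q k) aa = 0.
Proof.
rewrite (ipDr hip) haOQ add0r; apply: (ip_eq0C hip); apply: aP_orth => j; exact: hPQ.
Qed.

Lemma rho2_neq0 k : (rho k ^+ 2)%:C != 0 :> R[i].
Proof. by rewrite realc_eq0 expf_neq0 // gt_eqF // rho0. Qed.

Lemma Q_b k : ip (Q k) bb != 0.
Proof.
rewrite (ipDr hip) hbOQ add0r (ipC hip) ip_bQ_Q conjc_real; exact: rho2_neq0.
Qed.

Lemma E_b i : o i != 0 -> ip (E i) bb != 0.
Proof.
move=> oi; rewrite (ipDr hip) (_ : ip (E i) bQ = 0) ?addr0.
  by apply: contra (hwb1 oi) => /eqP/(ip_eq0C hip) ->.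
by apply: (ip_eq0C hip); apply: bQ_orth => k; rewrite (ip_eq0C hip (hEQ i k)).
Qed.

Lemma aa_E i : ip aa (E i) = wa i.
Proof.
rewrite (ipDl hip) ip_aO_E aP_orth ?addr0 // => k; exact: (ip_eq0C hip (hEP i k)).
Qed.

Lemma aa_P k : ip aa (P k) = (rho k ^+ 2)%:C.
Proof. by rewrite (ipDl hip) ip_aP_P (ip_eq0C hip (haOP k)) add0r. Qed.

Lemma aa_Q k : ip aa (Q k) = 0.
Proof. exact: (ip_eq0C hip (Q_a k)). Qed.

Lemma L_lin : is_linear_op L.
Proof.
move=> a u v; rewrite /L /rank_one (linD hbd.1) (linZ hbd.1) (ipDl hip) (ipZl hip).
by rewrite [(_ + _) *: aa]scalerDl -[(a * _) *: _]scalerA [a *: (_ + _)]scalerDr addrACA.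
Qed.

Lemma L_adj u v : ip (L u) v = ip u (Ls v).
Proof.
rewrite /L /Ls /rank_one (ipDl hip) hs [RHS](ipDr hip) (ipZl hip).
by rewrite [ip u (_ *: _)](ipZr hip) -(ipC hip) mulrC.
Qed.

Lemma L_x k : L (x k) = (q k)%:C *: x k.
Proof.
have [_ _ _ _ h1 h2 _ _ _] := hX k.
by rewrite /L /rank_one h2 scaleN1r -h1 opprB addrC subrK.
Qed.

Lemma Ls_y k : Ls (y k) = (p k)%:C *: y k.
Proof.
have [_ _ _ _ h1 h2 _ _ _] := hY k.
by rewrite /Ls /rank_one h2 scaleN1r -h1 opprB addrC subrK.
Qed.

Lemma L_P k : L (P k) = (p k)%:C *: P k.
Proof. by rewrite /L /rank_one P_b scale0r addr0 hAP. Qed.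

Lemma Ls_Q k : Ls (Q k) = (q k)%:C *: Q k.
Proof. by rewrite /Ls /rank_one Q_a scale0r addr0 hAQ. Qed.

Lemma L_rest v : rest v -> L v = A v.
Proof. by move=> h; rewrite /L /rank_one rest_b // scale0r addr0. Qed.

Lemma Ls_rest v : rest v -> Ls v = A v.
Proof. by move=> h; rewrite /Ls /rank_one rest_a // scale0r addr0. Qed.

Lemma x_Q k : ip (x k) (Q k) != 0. Proof. by case: (hX k). Qed.
Lemma y_P k : ip (y k) (P k) != 0. Proof. by case: (hY k). Qed.

Lemma x_neq0 k : x k != 0.
Proof. by apply: contra (x_Q k) => /eqP ->; rewrite (ip0l hip). Qed.

Lemma y_neq0 k : y k != 0.
Proof. by apply: contra (y_P k) => /eqP ->; rewrite (ip0l hip). Qed.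

Lemma L_complete : hcomplete_family ip (eigenvectors L).
Proof.
apply: (complete_of_orth hip hcpl) => z hz.
apply: (X_complete hX) => [k|k|v hv]; apply: (ip_eq0C hip).
- by apply: hz; split; [exact: x_neq0|exists (q k)%:C; exact: L_x].
- by apply: hz; split; [exact: e_neq0|exists (p k)%:C; exact: L_P].
have [->|v0] := eqVneq v 0; first by rewrite (ip0r hip).
by apply: hz; split=> //; have [[mu h] _] := hv; exists mu; rewrite L_rest.
Qed.

Lemma Ls_complete : hcomplete_family ip (eigenvectors Ls).
Proof.
apply: (complete_of_orth hip hcpl) => z hz.
apply: (Y_complete hY) => [k|k|v hv]; apply: (ip_eq0C hip).
- by apply: hz; split; [exact: y_neq0|exists (p k)%:C; exact: Ls_y].
- by apply: hz; split; [exact: e_neq0|exists (q k)%:C; exact: Ls_Q].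
have [->|v0] := eqVneq v 0; first by rewrite (ip0r hip).
by apply: hz; split=> //; have [[mu h] _] := hv; exists mu; rewrite Ls_rest.
Qed.

(** The nodes tend to 0, so for any nonzero [lam] a large enough [n] makes the lower bound of
    [beta_spec] available. *)
Lemma beta_neq0 lam c : lam != 0 -> (forall i, lam != o i) ->
  (forall i, o i != 0 -> ip c (E i) * (o i - lam) = wa i) -> 1 + ip c bO != 0.
Proof.
move=> lam0 hlam hc; have l0 : 0 < normc lam by rewrite normc_gt0.
have [n hn] := geo_small 1 l0.
have hn' i : (n <= i)%N -> normc (o i) <= normc lam * 2^-1 ^+ i.+2.
  move=> /hn hi; apply: le_trans (node_geo i) _; rewrite mulrC ler_wpM2r ?exprn_ge0 ?invr_ge0 //.
  by rewrite mul1r in hi; apply: ltW.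
have [_ _ _ h] := hb; have /andP[h1 _] := h lam c n lam0 hlam hc hn'.
apply/eqP => h0; move: h1; rewrite h0 mul0r normc0; lra.
Qed.

(** The rank one inversion formula: L - lam is inverted through the resolvent of A with denominator
    1 + (c, b), where c = (A - lam)^-1 a. As c has no [Q] components, the denominator is beta(lam),
    which is nonzero. *)
Lemma spectrum_real : real_spectrum L.
Proof.
move=> lam hsp; apply: contrapT => /negP hlam; apply: hsp.
have hne n : (r n)%:C - lam != 0.
  rewrite subr_eq0; apply: contra hlam => /eqP <-; apply/complex_realP; by exists (r n).
have hinj u : A u - lam *: u = 0 -> u = 0.
  move/eqP; rewrite subr_eq0 => /eqP hu; have [//|u0] := eqVneq u 0.
  have := eig_conj hip hs u0 hu; case: lam hlam {hne hu} => a b.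
  by rewrite complex_real => h [] h'; case/eqP: h; lra.
have lam0 : lam != 0 by apply: contra hlam => /eqP ->; apply: real0.
have hlamo i : lam != o i.
  have [->//|oi] := eqVneq (o i) 0; rewrite nodeE // eq_sym -subr_eq0; exact: hne.
have [c hc] := resolvent_surj hip hcpl hA hs aa hlam.
have hcE i : o i != 0 -> ip c (E i) * (o i - lam) = wa i.
  move=> oi; rewrite -aa_E -hc (ipBl hip) hs hAE // (ipZr hip) node_conj (ipZl hip).
  by rewrite mulrBr mulrC [ip c _ * lam]mulrC.
have hcQ : ip c bQ = 0.
  apply: (ip_eq0C hip); apply: bQ_orth => k; apply: (ip_eq0C hip).
  have : ip c (Q k) * ((q k)%:C - lam) = 0.
    rewrite -(aa_Q k) -hc (ipBl hip) hs hAQ (ipZr hip) conjc_real (ipZl hip).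
    by rewrite mulrBr mulrC [ip c _ * lam]mulrC.
  by move/eqP; rewrite mulf_eq0 (negbTE (hne _)) orbF => /eqP.
have D0 : 1 + ip c bb != 0 by rewrite (ipDr hip) hcQ addr0; apply: beta_neq0 hcE.
have /choice[G hG] : forall v, exists u, L u - lam *: u = v.
  move=> v; have [u hu] := resolvent_surj hip hcpl hA hs v hlam.
  pose t := ip u bb / (1 + ip c bb); exists (u - t *: c).
  have e1 : ip (u - t *: c) bb = t.
    by rewrite (ipBl hip) (ipZl hip) /t; move: (ip u bb) (ip c bb) D0 => a b h; field.
  have e2 : t *: aa = t *: A c - (t * lam) *: c by rewrite -hc scalerBr scalerA.
  rewrite /L /rank_one e1 e2 -[RHS]hu (linB hbd.1) (linZ hbd.1).
  by rewrite scalerBr scalerA [lam * t]mulrC addrA subrK opprB addrA subrK.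
exists G => u; last exact: hG.
apply/eqP; rewrite -subr_eq0; apply/eqP; set w := _ - u.
have hw : L w - lam *: w = 0.
  by rewrite /w (linB L_lin) scalerBr subrBB hG subrr.
(* A kernel vector of L - lam satisfies (A - lam) w = -(w, b) a, so it is a multiple of [c]. *)
have hw2 : w = - ip w bb *: c.
  apply/eqP; rewrite -subr_eq0; apply/eqP; apply: hinj; set s := - _.
  rewrite (linB hbd.1) (linZ hbd.1) scalerBr scalerA [lam * _]mulrC -scalerA.
  rewrite subrBB -scalerBr hc.
  by rewrite /s scaleNr opprK -hw /L /rank_one addrAC.
have : ip w bb * (1 + ip c bb) = 0.
  by rewrite mulrDr mulr1 {1}hw2 (ipZl hip) mulNr addNr.
by move/eqP; rewrite mulf_eq0 (negbTE D0) orbF => /eqP h; rewrite hw2 h oppr0 scale0r.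
Qed.

(* The invariant subspace for which synthesis fails. *)
Definition inM h := forall v, ((exists k, v = y k) \/ rest v) -> ip h v = 0.

Lemma M_closed : closed_subspace ip inM.
Proof. exact: orth_closed_subspace. Qed.

Lemma M_inv : op_invariant L inM.
Proof.
move=> h hh v hv; rewrite L_adj; case: hv => [[k ->]|hv].
  by rewrite Ls_y (ipZr hip) hh ?mulr0 //; left; exists k.
by rewrite Ls_rest //; have [[mu ->] _] := hv; rewrite (ipZr hip) hh ?mulr0 //; right.
Qed.

(** Eigenvectors of L and of its adjoint at distinct real eigenvalues are orthogonal. *)
Lemma x_in_M k : inM (x k).
Proof.
move=> v [[j ->]|hv]; last by have [_ _ _ _ _ _ _ h _] := hX k; apply: h.
have := L_adj (x k) (y j); rewrite L_x Ls_y (ipZl hip) (ipZr hip) conjc_real.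
move/eqP; rewrite -subr_eq0 -mulrBl mulf_eq0 -realcB realc_eq0 subr_eq0.
have hne : q k != p j by rewrite eq_sym; apply: (seq_inj r0 r00 rS); rewrite index_PQ.
by rewrite (negbTE hne) => /eqP.
Qed.

Lemma aa_coord lam c n : A c - lam *: c = aa ->
  ip c (e n) * ((r n)%:C - lam) = ip aa (e n).
Proof.
move=> <-; rewrite (ipBl hip) hs he2 (ipZr hip) conjc_real (ipZl hip).
by rewrite mulrBr mulrC [ip c _ * lam]mulrC.
Qed.

(** Excludes the eigenvalue 0, where beta gives no information: the coordinate of [c] at [P n] would
    have modulus rho_n^2 / |p_n|, which is unbounded. *)
Lemma no_kernel_coord c : A c <> aa.
Proof.
move=> hc; have {}hc : A c - 0 *: c = aa by rewrite scale0r subr0.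
have [n hn] := geo_small (nrm ip c) (ltr01 : 0 < 1 :> R).
have := aa_coord (3 * n).+2 hc; rewrite subr0 aa_P => /(congr1 (@normc R)).
rewrite normcM !normc_real (ger0_norm (sqr_ge0 _)) => hP.
have h1 : normc (ip c (e (3 * n).+2)) <= nrm ip c.
  by apply: le_trans (cauchy_schwarz hip _ _) _; rewrite he1 mulr1.
have /andP[_ h2] := hp n; have h3 := Trho n; have rn := rho0 n.
have h4 : rho n ^+ 2 <= nrm ip c * (rho n ^+ 4 / 64 ^+ (n + 8)).
  by rewrite -hP; apply: ler_pM h1 (le_trans h2 h3); rewrite ?normc_ge0 ?normr_ge0.
have h5 : 1 <= nrm ip c * (rho n ^+ 2 / 64 ^+ (n + 8)).
  rewrite -(ler_pM2r (exprn_gt0 2 rn)) mul1r; apply: le_trans h4 _.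
  by rewrite le_eqVlt; apply/orP; left; apply/eqP; ring.
have h6 : rho n ^+ 2 / 64 ^+ (n + 8) <= 2^-1 ^+ n.
  rewrite inv64 -[leRHS]mul1r; apply: ler_pM; rewrite ?sqr_ge0 ?exprn_ge0 ?invr_ge0 //.
    by apply: exprn_ile1; [exact: ltW|exact: (seq_le1 r00 rS)].
  rewrite ler_wiXn2l ?invr_ge0 ?invf_le1 ?ler1n //.
  by apply: leq_trans (leq_addr 8 n) _; rewrite leq_pmull.
have := hn n (leqnn n); rewrite ltNge => /negP; apply.
by apply: le_trans h5 _; rewrite ler_wpM2l // nrm_ge0.
Qed.

Lemma eig_multiple lam v n : A v = lam *: v -> ip v (e n) != 0 -> exists c, v = c *: e n.
Proof.
move=> hv hn; have [hm|hm] := eqVneq lam (r n)%:C; last first.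
  by rewrite (eig_orth hip hs hv (he2 n) hm) eqxx in hn.
by rewrite hm in hv; apply: (hsim (he2 n) hv (e_neq0 n)).
Qed.

(** If (v, b) = 0, then v is an eigenvector of A, and b, the Y_k and [rest] together leave no room
    for it. Otherwise v rescales to a solution of (A - lam) c = a with (c, b) = -1; as beta does not
    vanish, c must have some [Q k] component, and this forces lam = q_k. *)
Lemma eig_in_M lam v : L v = lam *: v -> inM v -> v != 0 ->
  exists k c, lam = (q k)%:C /\ v = c *: x k.
Proof.
move=> hv hM v0; have [f0|f0] := eqVneq (ip v bb) 0.
  have hAv : A v = lam *: v by rewrite -hv /L /rank_one f0 scale0r addr0.
  have key n (z : V) : ip (e n) z != 0 -> ip v z = 0 -> ip v (e n) = 0.
    move=> h1 h2; apply/eqP; rewrite -[_ == _]negbK; apply/negP => /(eig_multiple hAv)[c hc].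
    move: h2; rewrite hc (ipZl hip) => /eqP; rewrite mulf_eq0 (negbTE h1) orbF => /eqP c0.
    by rewrite hc c0 scale0r eqxx in v0.
  case/eqP: v0; apply: hcls => [k|k|i oi|z hz].
  - apply: (key _ (y k)); last by apply: hM; left; exists k.
    by apply: contra (y_P k) => /eqP/(ip_eq0C hip) ->.
  - exact: key (Q_b k) f0.
  - exact: key (E_b oi) f0.
  - by apply: hM; right.
pose c := - (ip v bb)^-1 *: v.
have hc : A c - lam *: c = aa.
  rewrite /c (linZ hbd.1) scalerA [lam * _]mulrC -scalerA -scalerBr -hv /L /rank_one.
  by rewrite opprD addrA subrr sub0r scalerN scaleNr opprK scalerA mulVf // scale1r.
have hcb : ip c bb = -1 by rewrite /c (ipZl hip) mulNr mulVf.
have lam0 : lam != 0.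
  apply/eqP => l0; apply: (@no_kernel_coord c); rewrite -hc l0 scale0r subr0.
  by [].
have hcE i : o i != 0 -> ip c (E i) * (o i - lam) = wa i.
  by move=> oi; rewrite nodeE // (aa_coord _ hc) aa_E.
have hlam i : lam != o i.
  have [->//|oi] := eqVneq (o i) 0; apply: contra (hwa1 oi) => /eqP h.
  by rewrite -hcE // h subrr mulr0.
have B0 := beta_neq0 lam0 hlam hcE.
have [k hQ] : exists k, ip c (Q k) != 0.
  apply: contrapT => hno; case/eqP: B0.
  have hcQ : ip c bQ = 0.
    apply: (ip_eq0C hip); apply: bQ_orth => k; apply: (ip_eq0C hip).
    by apply/eqP; rewrite -[_ == _]negbK; apply/negP => h; apply: hno; exists k.
  by move: hcb; rewrite (ipDr hip) hcQ addr0 => ->; rewrite subrr.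
have hlq : lam = (q k)%:C.
  have := aa_coord (3 * k).+1 hc; rewrite aa_Q => /eqP; rewrite mulf_eq0 (negbTE hQ) /=.
  by rewrite subr_eq0 => /eqP.
exists k, (- ip v bb); split=> //.
have [_ _ _ _ hx1 hx2 _ _ _] := hX k.
(* Both vectors solve the same equation, so they differ by a multiple of [Q k]; both have inner
   product -1 with b, so the multiple is 0. *)
have hd : A (c - x k) = (q k)%:C *: (c - x k).
  apply/eqP; rewrite -subr_eq0 (linB hbd.1) scalerBr subrBB hx1.
  by rewrite -hlq hc subrr.
have [t ht] := hsim (hAQ k) hd (e_neq0 _).
have : ip (c - x k) bb = 0 by rewrite (ipBl hip) hcb hx2 subrr.
rewrite ht (ipZl hip) => /eqP; rewrite mulf_eq0 (negbTE (Q_b k)) orbF => /eqP t0.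
move: ht; rewrite t0 scale0r => /eqP; rewrite subr_eq0 => /eqP <-.
by rewrite /c scalerA mulrNN divff // scale1r.
Qed.

Definition inW h := inM h /\ forall k, ip h (x k) = 0.

Lemma ominusE h :
  ominus ip inM (cspan ip (fun v => eigenvectors L v /\ inM v)) h <-> inW h.
Proof.
split=> -[h1 h2]; split=> //.
  move=> k; apply: h2; apply: (cspan_sub hip); split; last exact: x_in_M.
  by split; [exact: x_neq0|exists (q k)%:C; exact: L_x].
apply: (cspan_orth hip) => v [[v0 [lam hv]] hM].
have [k [c [_ ->]]] := eig_in_M hv hM v0.
by rewrite (ipZr hip) h2 mulr0.
Qed.

Lemma gammas : exists t s : nat -> R[i], [/\ forall k, t k != 0, forall k, s k != 0,
  forall k, nrm ip (P k - t k *: x k) <= 2^-1 ^+ (k + 3) &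
  forall k, nrm ip (Q k - s k *: y k) <= 2^-1 ^+ (k + 3)].
Proof.
have /choice[t ht] : forall k, exists t, t != 0 /\ nrm ip (P k - t *: x k) <= 2^-1 ^+ (k + 3).
  by move=> k; have [_ _ _ _ _ _ _ _ [t t0 ht]] := hX k; exists t.
have /choice[s hs'] : forall k, exists s, s != 0 /\ nrm ip (Q k - s *: y k) <= 2^-1 ^+ (k + 3).
  by move=> k; have [_ _ _ _ _ _ _ _ [t' t0 ht']] := hY k; exists t'.
by exists t, s; split=> k; [case: (ht k)|case: (hs' k)|case: (ht k)|case: (hs' k)].
Qed.

(** The fixed point equation is solved with right side [E i]; the corrections lie along the [P k]
    and [Q k] and leave the coordinates at the [E j] untouched. *)
Lemma W_sol i : o i != 0 -> exists h, inW h /\ forall j, ip h (E j) = (i == j)%:R.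
Proof.
move=> oi; have [t [s [t0 s0 ht hs']]] := gammas.
have nP k : nrm ip (P k) = 1 by apply: he1.
have nQ k : nrm ip (Q k) = 1 by apply: he1.
have [h [z [hz hE]]] := neumann_solve hip hcpl nP nQ ht hs' (E i).
exists h; split.
  split; last first.
    move=> k; have : ip h (P k) = ip h (P k - t k *: x k).
      rewrite {1}hE (ipDl hip) hEP add0r; apply: (hser_ip (k := k) hip hz) => [j hj|].
        by rewrite (ipDl hip) !(ipZl hip) hPP hQP (negbTE hj) !mulr0 addr0.
      by rewrite (ipDl hip) !(ipZl hip) hPP hQP eqxx mulr1 mulr0 addr0.
    rewrite (ipBr hip) (ipZr hip) => /eqP; rewrite -subr_eq0 subKr mulf_eq0.
    by rewrite conjc_eq0 (negbTE (t0 k)) => /eqP.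
  move=> v [[k ->]|hv]; last first.
    have [_ [h1 h2 h3]] := hv; rewrite hE (ipDl hip) h3 // add0r.
    by apply: (hser_ip0 hip hz) => j; rewrite (ipDl hip) !(ipZl hip) h1 h2 !mulr0 addr0.
  have : ip h (Q k) = ip h (Q k - s k *: y k).
    rewrite {1}hE (ipDl hip) hEQ add0r; apply: (hser_ip (k := k) hip hz) => [j hj|].
      by rewrite (ipDl hip) !(ipZl hip) hPQ hQQ (negbTE hj) !mulr0 addr0.
    by rewrite (ipDl hip) !(ipZl hip) hPQ hQQ eqxx mulr1 mulr0 add0r.
  rewrite (ipBr hip) (ipZr hip) => /eqP; rewrite -subr_eq0 subKr mulf_eq0.
  by rewrite conjc_eq0 (negbTE (s0 k)) => /eqP.
move=> j; rewrite hE (ipDl hip) hEE (hser_ip0 hip hz) ?addr0 // => k.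
rewrite (ipDl hip) !(ipZl hip) (ip_eq0C hip (hEP j k)) (ip_eq0C hip (hEQ j k)).
by rewrite !mulr0 addr0.
Qed.

(** Without node coordinates [h] has no free term left: h - Gam h is orthogonal to a complete
    system, so [h] is a fixed point of a contraction. *)
Lemma W_unique h : inW h -> (forall i, o i != 0 -> ip h (E i) = 0) -> h = 0.
Proof.
move=> [hM hx] hE; have [t [s [t0 s0 ht hs']]] := gammas.
have nP k : nrm ip (P k) = 1 by apply: he1.
have nQ k : nrm ip (Q k) = 1 by apply: he1.
have [Gam hG _] := neumann_op hip hcpl nP nQ ht hs'.
suff /eqP : h - Gam h = 0.
  rewrite subr_eq0 => /eqP hh; apply: (neumann_unique hip nP nQ ht hs').
  by have := hG h; rewrite -hh.
have hz := hG h; apply: hcls => [k|k|i oi|v hv]; rewrite (ipBl hip).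
- rewrite (hser_ip (k := k) (c := ip h (P k - t k *: x k)) hip hz) => [|j hj|].
  + by rewrite (ipBr hip) (ipZr hip) hx mulr0 subr0 subrr.
  + by rewrite (ipDl hip) !(ipZl hip) hPP hQP (negbTE hj) !mulr0 addr0.
  + by rewrite (ipDl hip) !(ipZl hip) hPP hQP eqxx mulr1 mulr0 addr0.
- rewrite (hser_ip (k := k) (c := ip h (Q k - s k *: y k)) hip hz) => [|j hj|].
  + rewrite (ipBr hip) (ipZr hip) (hM (y k)) ?mulr0 ?subr0 ?subrr //.
    by left; exists k.
  + by rewrite (ipDl hip) !(ipZl hip) hPQ hQQ (negbTE hj) !mulr0 addr0.
  + by rewrite (ipDl hip) !(ipZl hip) hPQ hQQ eqxx mulr1 mulr0 add0r.
- rewrite hE // (hser_ip0 hip hz) ?subrr // => k.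
  rewrite (ipDl hip) !(ipZl hip) (ip_eq0C hip (hEP i k)) (ip_eq0C hip (hEQ i k)).
  by rewrite !mulr0 addr0.
have [_ [h1 h2 h3]] := hv; rewrite (hM v) ?sub0r; last by right.
rewrite (hser_ip0 hip hz) ?oppr0 // => j.
by rewrite (ipDl hip) !(ipZl hip) h1 h2 !mulr0 addr0.
Qed.

Lemma inW_sub h1 h2 : inW h1 -> inW h2 -> inW (h1 - h2).
Proof.
move=> [a1 a2] [b1 b2]; split=> [v hv|k]; first by rewrite (ipBl hip) a1 // b1 // subrr.
by rewrite (ipBl hip) a2 b2 subrr.
Qed.

Lemma inW_sum n (c : 'I_n -> R[i]) (v : 'I_n -> V) : (forall i, inW (v i)) ->
  inW (\sum_i c i *: v i).
Proof.
move=> hv; split=> [z hz|k]; rewrite (ip_suml hip) big1 // => i _; rewrite (ipZl hip).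
  by have [h _] := hv i; rewrite h // mulr0.
by have [_ h] := hv i; rewrite h mulr0.
Qed.

Lemma W_indep n : (forall i, (i < n)%N -> active i) ->
  exists v : 'I_n -> V, [/\ forall i, inW (v i), lin_indep v &
    forall (i : 'I_n) j, ip (v i) (E j) = (i == j :> nat)%:R].
Proof.
move=> hact; have /choice[v hv] : forall i : 'I_n, exists h, inW h /\
    forall j, ip h (E j) = (i == j :> nat)%:R.
  by move=> i; apply: W_sol; rewrite node_neq0; apply: hact.
exists v; split=> [i||i j]; [by case: (hv i)| |by case: (hv i)].
move=> c hc i; have := congr1 (fun w => ip w (E i)) hc.
rewrite /= (ip0l hip) (ip_suml hip) (bigD1 i) //= big1 ?addr0 => [|j hj].
  by rewrite (ipZl hip); have [_ ->] := hv i; rewrite eqxx mulr1.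
rewrite (ipZl hip); have [_ ->] := hv j; rewrite (_ : (j == i :> nat) = false) ?mulr0 //.
exact/negbTE.
Qed.

Lemma W_dim : dim_eq (ominus ip inM (cspan ip (fun v => eigenvectors L v /\ inM v))) N.
Proof.
case hN: N => [n|] /=; last first.
  move=> n; have [i _|v [h1 h2 _]] := @W_indep n; first by rewrite /active hN.
  by exists v; split=> // i; apply/ominusE.
have [i hi|v [h1 h2 h3]] := @W_indep n; first by rewrite /active hN.
exists v; split=> [i||h /ominusE hW]; [exact/ominusE|by []|].
(* Subtracting the combination with the same node coordinates leaves an element of the complement to
   which [W_unique] applies. *)
exists n, (fun i => ip h (E i)), v; split=> [i|]; first by exists i.
apply/eqP; rewrite -subr_eq0; apply/eqP; apply: W_unique.
  by apply: inW_sub hW _; apply: inW_sum.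
move=> i; rewrite node_neq0 /active hN => hi.
rewrite (ipBl hip) (ip_suml hip) (bigD1 (Ordinal hi)) //= big1 => [|j hj].
  by rewrite (ipZl hip) h3 eqxx mulr1 addr0 subrr.
rewrite (ipZl hip) h3 (_ : (j == i :> nat) = false) ?mulr0 //.
exact/negbTE.
Qed.

(** A Jordan chain in M would make u = (L - lam) v a nonzero multiple of X_k with lam = q_k. But (u,
    Q_k) = 0, as [Q k] is an eigenvector of the adjoint at q_k, whereas (X_k, Q_k) is nonzero. *)
Lemma root_in_M lam n v : inM v -> iter n (fun u => L u - lam *: u) v = 0 ->
  L v = lam *: v.
Proof.
elim: n v => [|n IH] v hM; first by move=> /= ->; rewrite (lin0 L_lin) scaler0.
rewrite iterSr; set u := _ - _ => hu.
have uM : inM u.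
  by move=> w hw; rewrite /u (ipBl hip) (ipZl hip) (M_inv hM hw) (hM w hw) mulr0 subrr.
have hLu := IH u uM hu; have [u0|u0] := eqVneq u 0.
  by apply/eqP; rewrite -subr_eq0; apply/eqP.
have [k [c [hlam hc]]] := eig_in_M hLu uM u0.
have : ip u (Q k) = 0.
  rewrite /u (ipBl hip) (ipZl hip) L_adj Ls_Q (ipZr hip) conjc_real hlam subrr //.
move/eqP; rewrite hc (ipZl hip) mulf_eq0 (negbTE (x_Q k)) orbF => /eqP c0.
by rewrite hc c0 scale0r eqxx in u0.
Qed.

(** As N is not 0, node 0 is active and gives a vector of M orthogonal to every root vector in M;
    synthesis would make it orthogonal to itself. *)
Lemma no_synthesis : N <> Some 0%N -> ~ admits_spectral_synthesis ip L.
Proof.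
move=> hN hsyn; have o0 : o 0%N != 0.
  by rewrite node_neq0 /active; case: N hN => [[]|].
have [h [hW hE]] := W_sol o0; have [hM hx] := hW.
have := (hsyn inM M_closed M_inv h).1 hM.
move/(cspan_orth hip) => hcs.
have : ip h h = 0.
  apply: hcs => v [[v0 [lam [n hn]]] vM].
  have [k [c [_ ->]]] := eig_in_M (root_in_M vM hn) vM v0.
  by rewrite (ipZr hip) hx mulr0.
move=> /(congr1 (@complex.Re R))/(sqn_eq0 hip) h0.
have := hE 0%N; rewrite h0 (ip0l hip) eqxx => /eqP.
by rewrite eq_sym oner_eq0.
Qed.

Lemma pert_spec : N <> Some 0%N ->
  let L := fun v => A v + rank_one ip aa bb v in
  [/\ real_spectrum L, hcomplete_family ip (eigenvectors L),
      exists Ls : V -> V, is_adjoint ip L Ls /\ hcomplete_family ip (eigenvectors Ls),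
      ~ admits_spectral_synthesis ip L &
      exists M : V -> Prop, [/\ closed_subspace ip M, op_invariant L M &
        dim_eq (ominus ip M (cspan ip (fun v => eigenvectors L v /\ M v))) N]].
Proof.
move=> hN; split; [exact: spectrum_real|exact: L_complete| |exact: no_synthesis|].
  by exists Ls; split; [exact: L_adj|exact: Ls_complete].
by exists inM; split; [exact: M_closed|exact: M_inv|exact: W_dim].
Qed.

End Operator.

End Perturbation.

End Construction.

Theorem theorem1p5 (R : realType) (V : lmodType R[i]) (ip : V -> V -> R[i])
  (A : V -> V) :
  sep_inf_dim_hilbert ip ->
  compact_op ip A -> self_adjoint ip A -> simple_spectrum A ->
  trivial_kernel A ->
  forall N : option nat, N <> Some 0%N ->
  exists a b : V,
    let L := fun x => A x + rank_one ip a b x in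
    [/\ real_spectrum L,
        hcomplete_family ip (eigenvectors L),
        (exists Ls : V -> V, is_adjoint ip L Ls /\
            hcomplete_family ip (eigenvectors Ls)),
        ~ admits_spectral_synthesis ip L &
        exists M : V -> Prop, [/\ closed_subspace ip M, op_invariant L M &
          dim_eq (ominus ip M (cspan ip (fun y => eigenvectors L y /\ M y))) N]].

Proof.
move=> [hip hcpl _ hdim] hA hs hsim hk N hN.
have i128 : 0 < 128^-1 :> R by rewrite invr_gt0 ltr0n.
have G0 n (x : R) : 0 < x -> 0 < (x / 128) ^+ (2 * n + 20).
  by move=> x0; rewrite exprn_gt0 // mulr_gt0.
have [r [e [he1 he2 r0 r00 rS]]] :=
  sparse_eigs hip hdim hA hs hk (exprn_gt0 20 i128) G0.
have [aO [aP [bQ [haO haP hbQ]]]] := series_exist hip hcpl he1 r0 r00 rS N.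
have [bO hb] := beta_exists hip hcpl hs he1 he2 r0 r00 rS N.
have [X hX] := X_exists hip hcpl hA hs he1 he2 r0 r00 rS haO haP hbQ hb.
have [Y hY] := Y_exists hip hcpl hA hs hsim hk he1 he2 r0 r00 rS haO haP hbQ hb.
exists (aO + aP), (bO + bQ).
exact: (pert_spec hip hcpl hA hs hsim hk he1 he2 r0 r00 rS haO haP hbQ hb hX hY hN).
Qed.
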